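(* Let $0<s<\frac12$, let $J$ be a kernel satisfying the hypothesis with exponent $s$ stated in the context, and let $f$ be an ignition nonlinearity with threshold $\theta\in(0,1)$ as defined in the context. Let $u$ be the solution of $$u_t(t,x)=\mathcal{D}[u](t,x)+f(u(t,x))\quad (t>0,\ x\in\mathbb{R}),\qquad u(0,\cdot)=\mathbf{1}_{(-\infty,0]}.$$ For $\lambda\in(0,1)$ and $t>0$ put $x_\lambda(t):=\sup\{x\in\mathbb{R}: u(t,x)\ge\lambda\}$. Then for any $\lambda\in(0,1)$ the level line $x_\lambda(t)$ accelerates with the following rate: $$t^{\frac{1}{2s}}\ \lesssim\ x_\lambda(t)\ \lesssim\ t^{\frac{1}{2s}+0}.$$ That is, for every $\lambda\in(0,1)$: (i) there exist constants $C>0$ and $T>0$ such that $x_\lambda(t)\ge C\,t^{\frac{1}{2s}}$ for all $t\ge T$; and (ii) for every $\rho>0$ there exist constants $C_\rho>0$ and $T_\rho>0$ such that $x_\lambda(t)\le C_\rho\,t^{\frac{1}{2s}+\rho}$ for all $t\ge T_\rho$.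
   Context: Kernel hypothesis (with exponent $s$): $J:\mathbb{R}\to[0,\infty)$ is measurable and symmetric ($J(-z)=J(z)$), and there are positive constants $\mathcal{J}_0,\mathcal{J}_1$ and $R_0\ge 1$ such that $$\int_{|z|\le 1}J(z)|z|^2\,dz\le 2\mathcal{J}_1,\qquad J(z)\le\frac{\mathcal{J}_0}{|z|^{1+2s}}\ \text{ for } |z|\ge 1,\qquad J(z)\ge\frac{\mathcal{J}_0^{-1}}{|z|^{1+2s}}\ \text{ for } |z|\ge R_0.$$ Operator: $\mathcal{D}[u](t,x):=\mathrm{P.V.}\int_{\mathbb{R}}[u(t,y)-u(t,x)]J(x-y)\,dy$, where P.V. means the limit as $\delta\to0^+$ of the integral over $|x-y|>\delta$. Ignition nonlinearity with threshold $\theta\in(0,1)$: a Lipschitz continuous function $f:[0,1]\to\mathbb{R}$ with $f(1)=0$, $f(u)=0$ for $0\le u\le\theta$, and $f(u)>0$ for $\theta<u<1$. Solution: $u$ is the bounded mild solution, with values in $[0,1]$, i.e. $u(t,\cdot)=P_t\mathbf{1}_{(-\infty,0]}+\int_0^tP_{t-\tau}f(u(\tau,\cdot))\,d\tau$, where $(P_t)_{t\ge0}$ is the convolution semigroup generated by $\mathcal{D}$, namely convolution with the probability measures whose Fourier transforms are $\exp(tW(\xi))$, $W(\xi)=\int_{\mathbb{R}}(\cos(\xi y)-1)J(y)\,dy$. For each $t$ the function $x\mapsto u(t,x)$ is nonincreasing, with limits $1$ at $-\infty$ and $0$ at $+\infty$. *)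

(* Defs.v *)
From HB Require Import structures.
From mathcomp Require Import all_boot all_order all_algebra.
From mathcomp Require Import complex.
From mathcomp Require Import all_classical all_reals all_analysis.

Set Implicit Arguments.
Unset Strict Implicit.
Unset Printing Implicit Defensive.

Import Order.TTheory GRing.Theory Num.Theory.
Import numFieldNormedType.Exports.

Local Open Scope classical_set_scope.
Local Open Scope ring_scope.

Definition kernel_hyp (R : realType) (s : R) (J : R -> R) : Prop :=
  [/\ measurable_fun [set: R] J,
      (forall z : R, 0 <= J z),
      (forall z : R, J (- z) = J z) &
      exists J0 J1 R0 : R,
        [/\ 0 < J0, 0 < J1 & 1 <= R0] /\
        [/\ (\int[lebesgue_measure]_(z in [set z : R | (`|z| <= 1)%R])
               (J z * `|z| ^+ 2)%:E <= (2 * J1)%:E)%E,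
            (forall z : R, 1 <= `|z| -> J z <= J0 / `|z| `^ (1 + 2 * s)) &
            (forall z : R, R0 <= `|z| -> J0^-1 / `|z| `^ (1 + 2 * s) <= J z)]].

(* Only the values of f on [0, 1] are constrained: f stands for a function
   defined on [0, 1] and is only ever evaluated there. *)
Definition ignition (R : realType) (theta : R) (f : R -> R) : Prop :=
  [/\ [lipschitz f x | x in `[0, 1]],
      f 1 = 0,
      (forall v : R, 0 <= v <= theta -> f v = 0) &
      (forall v : R, theta < v < 1 -> 0 < f v)].

Definition symbol (R : realType) (J : R -> R) (xi : R) : R :=
  \int[lebesgue_measure]_y ((cos (xi * y) - 1) * J y).

(* The integral of exp(- i xi y) against mu, split into its real and imaginary
   parts. *)
Definition fourier (R : realType) (mu : probability (measurableTypeR R) R)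
    (xi : R) : R[i] :=
  Complex (\int[mu]_y cos (xi * y)) (- \int[mu]_y sin (xi * y)).

(* The probability measures [mu t], t >= 0, of the convolution semigroup
   generated by u |-> P.V. \int (u(y) - u(x)) J(x - y) dy; a probability measure
   is determined by its Fourier transform. *)
Definition semigroup_measures (R : realType) (J : R -> R)
    (mu : R -> probability (measurableTypeR R) R) : Prop :=
  forall t xi : R, 0 <= t ->
    fourier (mu t) xi = real_complex R (expR (t * symbol J xi)).

Definition semigroup (R : realType)
    (mu : R -> probability (measurableTypeR R) R) (t : R) (g : R -> R)
    (x : R) : R :=
  \int[mu t]_y g (x - y).

Definition mild_solution (R : realType)
    (mu : R -> probability (measurableTypeR R) R) (f u0 : R -> R)
    (u : R -> R -> R) : Prop :=
  [/\ measurable_fun [set p : R * R | 0 <= p.1] (fun p : R * R => u p.1 p.2),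
      (forall t x : R, 0 <= t -> 0 <= u t x <= 1) &
      (forall t x : R, 0 <= t ->
         u t x = semigroup mu t u0 x +
           \int[lebesgue_measure]_(tau in `[0, t])
             semigroup mu (t - tau) (fun y => f (u tau y)) x)].

Definition front_profile (R : realType) (v : R -> R) : Prop :=
  [/\ nonincreasing_fun v, v x @[x --> -oo] --> (1 : R) & v x @[x --> +oo] --> (0 : R)].

Definition level_line (R : realType) (u : R -> R -> R) (lambda t : R) : R :=
  sup [set x : R | lambda <= u t x].

(* Main.v *)
From HB Require Import structures.
From mathcomp Require Import all_boot all_order all_algebra.
From mathcomp Require Import all_classical all_reals all_analysis measurable_realfun.
From mathcomp Require Import ring lra.
Set Implicit Arguments.
Unset Strict Implicit.
Unset Printing Implicit Defensive.
Import Order.TTheory GRing.Theory Num.Theory.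
Import numFieldNormedType.Exports.
Local Open Scope classical_set_scope.
Local Open Scope ring_scope.
Require Import Defs.

(** The front is carried by far jumps. From a plateau of height close to one on
    the left of the front, a point at distance [x] ahead receives mass at the rate
    [x^(-2s)], and everything rests on two bounds for the measures of the
    semigroup, at times of order one: the truncated first moment at scale [r] is at
    most a multiple of [r^(-2s)] ([truncated_moment]), and the probability of a jump
    longer than [r] is at least a multiple of [r^(-2s)] ([far_lower_bound]). Both
    are read off the Fourier transforms [exp (t W)], where [- W (xi)] is of order
    [|xi|^(2s)] at low frequencies ([symbol_bounds]), by integrating the measures
    against triangle functions, whose transforms are explicit ([hat_fourier]). The
    truncated moment is finite because [s < 1/2]. The same identity shows that the
    measures are determined by their transforms and depend measurably on time, so
    Duhamel's formula may be restarted at any positive time ([mild_restart]).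
    All comparisons are then made over time steps of bounded length, directly on
    this formula: [lower_step] exploits that
    [f v + K v] is nondecreasing, [upper_step] that [f v] is at most
    [K (v - theta1)] for [v >= theta1], and vanishes below, if [theta1 <= theta].

    Lower bound. Take a profile equal to some [a] in [(theta, 1)] on the left and
    decaying like [- b ln (x / L)] on the right. Beyond [L], its second differences
    are nonnegative for jumps shorter than [x], since [- ln] is convex, and
    bounded below for jumps of length between [x] and [M x], whose leftward half
    lands on the plateau ([log_profile_second_difference]); longer jumps are too
    rare to offset this. Hence the linear flow raises it by a multiple
    of [x^(-2s)], while a translation by [v] costs at most a multiple of [v / x]:
    one can afford [v] of order [L^(1 - 2s)] per unit of time. Before [L] the profile
    is above the ignition threshold and nearly flat, and the reaction pays for the
    translation ([lower_front]). After time [t] the plateau has moved by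
    [t L^(1 - 2s)], which is a multiple of [L] for [L] of order [t^(1/(2s))]
    ([solution_accelerates]).

    Upper bound. Take [w] equal to one up to [l] and to [(x / l)^(- al)] beyond, with
    [al] small, and let the supersolution be a translate of [w] raised by a small
    constant. A jump by [z] from [x] increases [w] by at most [|z| / x] ([power_profile_jump]), so
    the linear flow adds at most a multiple of [x^(-2s)]. Since the reaction vanishes
    at small values, it acts only within a distance of order [l] of the plateau, up
    to far jumps. A translation by a multiple of [l] during each short time step
    gains a fixed amount near the plateau and [l^(1 + al) x^(- 1 - al)] further away;
    this beats [x^(-2s)] up to the distance [N] with [N^(1 + al - 2s)] of order
    [l^(1 + al)], and beyond [N] one raises the supersolution by a multiple of
    [N^(-2s)] instead ([upper_front]). For [l] of order [N / t], this means
    [N] of order [t^((1 + al)/(2s))]: the front has then moved by at most [N] at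
    time [t], and the raises sum up to at most a multiple of [t^(- al)]
    ([solution_small_ahead]). *)

(** * Integration and trigonometry *)

Lemma integrable_scale d (T : measurableType d) (R : realType)
    (mu : {measure set T -> \bar R}) (D : set T) (k : R) (f : T -> R) : measurable D ->
  mu.-integrable D (EFin \o f) -> mu.-integrable D (EFin \o (fun x => k * f x)).
Proof. by move=> mD fi; exact: (integrableZl mD k fi). Qed.

Lemma integrable_add d (T : measurableType d) (R : realType)
    (mu : {measure set T -> \bar R}) (D : set T) (f g : T -> R) : measurable D ->
  mu.-integrable D (EFin \o f) -> mu.-integrable D (EFin \o g) ->
  mu.-integrable D (EFin \o (fun x => f x + g x)).
Proof. by move=> mD fi gi; exact: (integrableD mD fi gi). Qed.

Lemma integrable_sub d (T : measurableType d) (R : realType)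
    (mu : {measure set T -> \bar R}) (D : set T) (f g : T -> R) : measurable D ->
  mu.-integrable D (EFin \o f) -> mu.-integrable D (EFin \o g) ->
  mu.-integrable D (EFin \o (fun x => f x - g x)).
Proof. by move=> mD fi gi; exact: (integrableB mD fi gi). Qed.

Lemma dominated_integrable d (T : measurableType d) (R : realType)
    (mu : {measure set T -> \bar R}) (D : set T) (g f : T -> R) : measurable D ->
  mu.-integrable D (EFin \o g) -> measurable_fun D f ->
  (forall x, D x -> `|f x| <= g x) -> mu.-integrable D (EFin \o f).
Proof.
move=> mD ig mf fg; apply: le_integrable ig => //; first exact/measurable_EFinP.
by move=> x Dx; rewrite /= lee_fin (le_trans (fg x Dx))// ler_norm.
Qed.

(** The image of Lebesgue measure under the dilation, multiplied by [b], has
    the right value on intervals, hence is Lebesgue measure by uniqueness. *)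
Lemma ge0_integral_dilation (R : realType) (b : R) (G : R -> \bar R) : 0 < b ->
  measurable_fun [set: R] G -> (forall x, (0 <= G x)%E) ->
  (\int[lebesgue_measure]_x G (b * x)%R = (b^-1)%:E * \int[lebesgue_measure]_x G x)%E.
Proof.
move=> b0 mG G0.
have bn : 0 <= b by exact: ltW.
pose phi (x : measurableTypeR R) : measurableTypeR R := b * x.
have mphi : measurable_fun [set: measurableTypeR R] phi by exact: measurable_funM.
pose m := mscale (NngNum bn) (pushforward lebesgue_measure phi).
have mE A : measurable A -> lebesgue_measure A = m mphi A.
  move=> mA; apply: lebesgue_measure_unique => // _ [[p q]] _ <-.
  transitivity (b%:E * lebesgue_measure (phi @^-1` `]p, q]))%E => //.
  have -> : phi @^-1` `]p, q] = [set` `]b^-1 * p, b^-1 * q]].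
    by apply/seteqP; split => x/=; rewrite !in_itv/= ler_pdivlMl// ltr_pdivrMl.
  rewrite !lebesgue_measure_itv/= !lte_fin ltr_pM2l ?invr_gt0//.
  case: ifP => _; last by rewrite mule0.
  by rewrite -!EFinD -EFinM -mulrBr mulVKf// gt_eqF.
rewrite -(ge0_integral_pushforward mphi (D := setT) lebesgue_measure (f := G)) //.
rewrite [in RHS](eq_measure_integral (m mphi)); last by move=> *; exact: mE.
by rewrite ge0_integral_mscale//= muleA -EFinM mulVf ?gt_eqF// mul1e.
Qed.
Lemma bounded_integrable d (T : measurableType d) (R : realType)
    (mu : probability T R) (g : T -> R) (M : R) :
  measurable_fun setT g -> (forall x, `|g x| <= M) ->
  mu.-integrable setT (EFin \o g).
Proof.
move=> mg gM; apply: measurable_bounded_integrable => //.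
  by rewrite /= probability_setT ltry.
exists M; split; first exact: num_real.
by move=> x Mx y _; exact: le_trans (gM y) (ltW Mx).
Qed.

Lemma sinE_MVT (R : realType) (x : R) : 0 < x ->
  exists2 c : R, 0 < c < x & sin x = cos c * x.
Proof.
move=> x0.
have [c] := @MVT _ sin cos 0 x x0 (fun y _ => is_derive_sin y) (continuous_subspaceT (@continuous_sin R)).
rewrite in_itv/= sin0 !subr0 => cx e; by exists c.
Qed.

Lemma onem_cosE (R : realType) (q : R) : 1 - cos q = 2 * sin (q / 2) ^+ 2.
Proof.
have {1}-> : q = (q / 2) *+ 2 by rewrite -mulr_natr mulfVK.
rewrite cos_mulr2n sin2cos2; ring.
Qed.

Lemma norm_sin_le (R : realType) (x : R) : `|sin x| <= `|x|.
Proof.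
wlog x0 : x / 0 <= x.
  move=> H; have [/H//|/ltW x0] := leP 0 x.
  by rewrite -normrN -sinN -(normrN x) H// oppr_ge0.
move: x0; rewrite le_eqVlt => /predU1P[<-|x0]; first by rewrite sin0.
have [c _ ->] := sinE_MVT x0.
by rewrite normrM ler_piMl// cos_max.
Qed.

Lemma onem_cos_le (R : realType) (q : R) : 1 - cos q <= q ^+ 2 / 2.
Proof.
rewrite onem_cosE -[sin _ ^+ 2]real_normK ?num_real//.
have := norm_sin_le (q / 2); rewrite -(ler_pXn2r (n := 2))// ?nnegrE// real_normK ?num_real//.
by rewrite [X in _ <= X]real_normK ?num_real// expr_div_n; lra.
Qed.

(** By the mean value theorem [sin (q / 2) = cos c * (q / 2)] with [c] between
    [0] and [q / 2], where the cosine is at least [cos 1]. *)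
Lemma onem_cos_ge (R : realType) (q : R) : `|q| <= 1 ->
  cos 1 ^+ 2 / 2 * q ^+ 2 <= 1 - cos q.
Proof.
wlog q0 : q / 0 <= q.
  move=> H; have [/H//|/ltW q0 q1] := leP 0 q.
  by rewrite -[cos q]cosN -[q ^+ 2]sqrrN H// ?normrN// oppr_ge0.
rewrite ger0_norm// => q1; rewrite onem_cosE.
move: q0; rewrite le_eqVlt => /predU1P[<-|q0].
  by rewrite mul0r sin0 !expr0n/= !mulr0.
have [|c /andP[c0 cq] ->] := @sinE_MVT R (q / 2); first by rewrite divr_gt0.
have c1 : c <= 1 by lra.
have cos1 : cos 1 <= cos c.
  have [->|cne] := eqVneq c 1; first by [].
  have pi2 := @pi_ge2 R.
  by rewrite ltW// ltr_cos ?in_itv/=; [rewrite lt_neqAle cne|lra|lra].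
have c1p := @cos1_gt0 R.
have : cos 1 ^+ 2 <= cos c ^+ 2 by rewrite ler_pXn2r// ?nnegrE; lra.
have : 0 <= q ^+ 2 by exact: sqr_ge0.
rewrite exprMn expr_div_n => h1 h2; nra.
Qed.

(** * Triangle functions and the Fourier transform *)

Lemma measurable_cos (R : realType) : measurable_fun setT (@cos R).
Proof. by apply: continuous_measurable_fun => x; exact: continuous_cos. Qed.

Lemma measurable_sin (R : realType) : measurable_fun setT (@sin R).
Proof. by apply: continuous_measurable_fun => x; exact: continuous_sin. Qed.

(** Up to a factor, [|x|] is the superposition of the functions
    [1 - cos (x xi)] with weight [1 / xi ^ 2]; the Fejer weight is the case
    [x = 1]. *)
Definition fejer (R : realType) (xi : R) : R := (1 - cos xi) * (xi ^+ 2)^-1.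

Lemma fejer_ge0 (R : realType) (xi : R) : 0 <= fejer xi.
Proof. by rewrite divr_ge0 ?sqr_ge0// subr_ge0 cos_le1. Qed.

Lemma fejer_le (R : realType) (xi : R) : fejer xi <= 4 * (oneDsqr xi)^-1.
Proof.
rewrite /fejer; have [->|xi0] := eqVneq xi 0.
  by rewrite cos0 subrr mul0r mulr_ge0// ltW// invr_gt0 oneDsqr_gt0.
have p : 0 < xi ^+ 2 by rewrite exprn_even_gt0.
rewrite ler_pdivrMr// mulrAC ler_pdivlMr ?oneDsqr_gt0//.
have := onem_cos_le xi; have := cos_geN1 xi; rewrite /oneDsqr => h1 h2.
nra.
Qed.

Lemma fejer_ge (R : realType) (x : R) : 0 < x -> x <= 1 ->
  cos 1 ^+ 2 / 2 <= fejer x.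
Proof.
move=> x0 x1; have p : 0 < x ^+ 2 by rewrite exprn_gt0.
by rewrite /fejer ler_pdivlMr// onem_cos_ge// ger0_norm// ltW.
Qed.

Lemma measurable_sqrV (R : realType) : measurable_fun setT (fun x : R => (x ^+ 2)^-1).
Proof.
under eq_fun do rewrite -powR_inv1 ?sqr_ge0//.
apply: (measurableT_comp (measurable_powR _)).
exact: measurable_funX.
Qed.

Lemma measurable_fejer (R : realType) : measurable_fun setT (@fejer R).
Proof.
apply: measurable_funM; last exact: measurable_sqrV.
by apply: measurable_funB => //; exact: measurable_cos.
Qed.

(** Finiteness comes from the comparison with the Cauchy density, positivity from
    the contribution of [0 < xi <= 1]. *)
Lemma integral_fejer (R : realType) :
  exists2 c : R, 0 < c & (\int[lebesgue_measure]_xi (fejer (xi : R))%:E = c%:E)%E.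
Proof.
set I := (X in exists2 _, _ & X = _).
have ltyI : (I < +oo)%E.
  apply: (@le_lt_trans _ _ (\int[lebesgue_measure]_xi (4 * (oneDsqr (xi : R))^-1)%:E)%E).
    apply: ge0_le_integral => //=.
    - by move=> x _; rewrite lee_fin fejer_ge0.
    - by apply/measurable_EFinP; exact: measurable_fejer.
    - apply/measurable_EFinP; apply: measurable_funM => //.
      by apply: continuous_measurable_fun; exact: continuous_oneDsqrV.
    - by move=> x _; rewrite lee_fin fejer_le.
  under eq_integral do rewrite EFinM.
  rewrite ge0_integralZl//=.
  - rewrite ge0_symfun_integralT; first last.
    + by move=> x; rewrite /= /oneDsqr sqrrN.
    + exact: continuous_oneDsqrV.
    + by move=> x; rewrite ltW// invr_gt0 oneDsqr_gt0.
    by rewrite -set_itvcy integral0y_oneDsqr -!EFinM ltry.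
  - apply/measurable_EFinP.
    by apply: continuous_measurable_fun; exact: continuous_oneDsqrV.
have gtI : ((cos 1 ^+ 2 / 2 : R)%:E <= I)%E.
  apply: (@le_trans _ _ (\int[lebesgue_measure]_(xi in `]0%R, 1%R]) (fejer (xi : R))%:E)%E); last first.
    apply: ge0_subset_integral => //=.
    - by apply/measurable_EFinP; exact: measurable_fejer.
    - by move=> x _; rewrite lee_fin fejer_ge0.
  have <- : (\int[lebesgue_measure]_(xi in `]0%R, 1%R]) (cst (cos 1 ^+ 2 / 2 : R)%:E (xi : R)) =
    (cos 1 ^+ 2 / 2)%:E)%E.
    by rewrite integral_cst//= lebesgue_measure_itv/= lte_fin ltr01 oppr0 adde0 mule1.
  apply: ge0_le_integral => //=.
  - by move=> x _; rewrite lee_fin divr_ge0 ?sqr_ge0.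
  - by apply/measurable_EFinP/measurable_funTS; exact: measurable_fejer.
  - move=> x; rewrite in_itv/= => /andP[x0 x1]; rewrite lee_fin.
    exact: fejer_ge.
have c0 : 0 < cos 1 ^+ 2 / 2 :> R.
  by rewrite divr_gt0// exprn_gt0// cos1_gt0.
case: I ltyI gtI => [c _|//|//]; rewrite lee_fin => cc.
by exists c => //; exact: lt_le_trans cc.
Qed.

Definition fejer_mass (R : realType) : R := \int[lebesgue_measure]_xi fejer (xi : R).

Lemma fejer_mass_gt0 (R : realType) : 0 < fejer_mass R.
Proof.
rewrite /fejer_mass /Rintegral; have [c c0 cE] := integral_fejer R.
by rewrite cE.
Qed.

Lemma fejer_massE (R : realType) :
  (\int[lebesgue_measure]_xi (fejer (xi : R))%:E = (fejer_mass R)%:E)%E.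
Proof. by rewrite /fejer_mass /Rintegral; have [c c0 ->] := integral_fejer R. Qed.

Definition abs_density (R : realType) (b xi : R) : R := (1 - cos (b * xi)) * (xi ^+ 2)^-1.

Lemma abs_density_ge0 (R : realType) (b xi : R) : 0 <= abs_density b xi.
Proof. by rewrite divr_ge0 ?sqr_ge0// subr_ge0 cos_le1. Qed.

Lemma measurable_abs_density (R : realType) (b : R) : measurable_fun setT (abs_density b).
Proof.
apply: measurable_funM; last exact: measurable_sqrV.
apply: measurable_funB => //; apply: measurableT_comp; first exact: measurable_cos.
exact: measurable_funM.
Qed.

(** Dilating the variable by [b] turns this integrand into the Fejer weight. *)
Lemma ge0_integral_abs_density (R : realType) (b : R) :
  (\int[lebesgue_measure]_xi (abs_density b xi)%:E = (`|b| * fejer_mass R)%:E)%E.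
Proof.
wlog b0 : b / 0 <= b.
  move=> H; have [/H//|/ltW b0] := leP 0 b.
  rewrite -normrN -H ?oppr_ge0//; apply: eq_integral => xi _.
  by rewrite /abs_density mulNr cosN.
move: b0; rewrite le_eqVlt => /predU1P[<-|b0].
  rewrite normr0 mul0r; apply: integral0_eq => xi _.
  by rewrite /abs_density mul0r cos0 subrr mul0r.
rewrite gtr0_norm// EFinM -fejer_massE.
transitivity (\int[lebesgue_measure]_xi ((b ^+ 2)%:E * (fejer (b * (xi : R)))%:E))%E.
  apply: eq_integral => xi _; rewrite -EFinM /abs_density /fejer exprMn [in RHS]invfM.
  by rewrite [in RHS]mulrCA mulVKf// gt_eqF// exprn_gt0.
rewrite ge0_integralZl//=; last 3 first.
- apply/measurable_EFinP; apply: (measurableT_comp (@measurable_fejer R)).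
  exact: measurable_funM.
- by move=> xi _; rewrite lee_fin fejer_ge0.
- by rewrite lee_fin exprn_ge0// ltW.
rewrite (@ge0_integral_dilation _ b (fun y => (fejer y)%:E))//; last 2 first.
- by apply/measurable_EFinP; exact: measurable_fejer.
- by move=> x; rewrite lee_fin fejer_ge0.
by rewrite muleA -EFinM expr2 mulfK// gt_eqF.
Qed.

Lemma integrable_abs_density (R : realType) (b : R) :
  lebesgue_measure.-integrable setT (EFin \o abs_density b).
Proof.
apply/integrableP; split; first by apply/measurable_EFinP; exact: measurable_abs_density.
under eq_integral do rewrite /= ger0_norm ?abs_density_ge0//.
by rewrite ge0_integral_abs_density ltry.
Qed.

Lemma integral_abs_density (R : realType) (b : R) :
  \int[lebesgue_measure]_xi (abs_density b xi) = `|b| * fejer_mass R.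
Proof. by rewrite /Rintegral ge0_integral_abs_density. Qed.

(** The triangle function of half-width [a]. It combines three absolute values, so
    its cosine transform is explicit; and a difference quotient in [a] turns it
    into the indicator of an interval, up to a limit. *)
Definition hat (R : realType) (a x : R) : R := Num.max 0 (a - `|x|).

Lemma hatE (R : realType) (a x : R) : 0 <= a ->
  hat a x = `|a + x| / 2 + `|a - x| / 2 - `|x|.
Proof.
move=> a0; rewrite /hat; case: (lerP 0 (a - `|x|)) => h.
  have /andP[h1 h2] : - a <= x <= a by rewrite -ler_norml; lra.
  rewrite (@ger0_norm _ (a + x)); last lra.
  by rewrite (@ger0_norm _ (a - x)); lra.
case: (lerP 0 x) => x0.
  move: h; rewrite (ger0_norm x0) => h.
  rewrite (@ger0_norm _ (a + x)); last lra.
  by rewrite (@ltr0_norm _ (a - x)); lra.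
move: h; rewrite (ltr0_norm x0) => h.
rewrite (@ltr0_norm _ (a + x)); last lra.
by rewrite (@ger0_norm _ (a - x)); lra.
Qed.

(** The product formula for cosines mirrors [hatE]. *)
Lemma hat_density (R : realType) (a x xi : R) :
  abs_density a xi * cos (xi * x) =
  2^-1 * abs_density (a + x) xi + 2^-1 * abs_density (a - x) xi - abs_density x xi.
Proof.
rewrite /abs_density [(a + x) * xi]mulrDl [(a - x) * xi]mulrBl [xi * x]mulrC cosD cosB.
set v := (_ ^+ 2)^-1.
set C := cos (a * xi); set S := sin (a * xi); set c := cos (xi * x); set s := sin (xi * x).
by field.
Qed.

Lemma integrable_hat_density (R : realType) (a x : R) :
  lebesgue_measure.-integrable setT (EFin \o (fun xi => abs_density a xi * cos (xi * x))).
Proof.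
under eq_fun do rewrite hat_density.
have H (b : R) := integrable_abs_density b.
have H2 (b : R) := integrableZl measurableT (2^-1) (H b).
exact: (integrableB measurableT (integrableD measurableT (H2 _) (H2 _)) (H _)).
Qed.

Lemma integral_hat_density (R : realType) (a x : R) : 0 <= a ->
  \int[lebesgue_measure]_xi (abs_density a xi * cos (xi * x)) = hat a x * fejer_mass R.
Proof.
move=> a0; under eq_Rintegral do rewrite hat_density.
have H (b : R) := integrable_abs_density b.
have H2 (b : R) := integrableZl measurableT (2^-1) (H b).
rewrite RintegralB//=; last exact: (integrableD measurableT (H2 _) (H2 _)).
rewrite RintegralD//; [|exact: H2|exact: H2].
rewrite !RintegralZl// !integral_abs_density hatE//; ring.
Qed.

Lemma measurable_cosM (R : realType) (xi : R) : measurable_fun setT (fun x : R => cos (xi * x)).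
Proof. by apply: (measurableT_comp (@measurable_cos R)); exact: measurable_funM. Qed.

Lemma measurable_sinM (R : realType) (xi : R) : measurable_fun setT (fun x : R => sin (xi * x)).
Proof. by apply: (measurableT_comp (@measurable_sin R)); exact: measurable_funM. Qed.

Lemma integrable_cosM (R : realType) (mu : probability (measurableTypeR R) R) (xi : R) :
  mu.-integrable setT (EFin \o (fun x : R => cos (xi * x))).
Proof.
apply: (@bounded_integrable _ _ _ _ _ 1) => [|x]; first exact: measurable_cosM.
exact: cos_max.
Qed.

Lemma integrable_sinM (R : realType) (mu : probability (measurableTypeR R) R) (xi : R) :
  mu.-integrable setT (EFin \o (fun x : R => sin (xi * x))).
Proof.
apply: (@bounded_integrable _ _ _ _ _ 1) => [|x]; first exact: measurable_sinM.
exact: sin_max.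
Qed.

Lemma Rintegral_cosB (R : realType) (mu : probability (measurableTypeR R) R) (xi x0 : R) :
  \int[mu]_x cos (xi * ((x : R) - x0)) =
  cos (xi * x0) * \int[mu]_x cos (xi * x) + sin (xi * x0) * \int[mu]_x sin (xi * x).
Proof.
under eq_Rintegral => x _ do rewrite mulrBr cosB mulrC [sin _ * _]mulrC.
rewrite RintegralD//.
- by rewrite !RintegralZl//; [exact: integrable_sinM|exact: integrable_cosM].
- by apply: integrable_scale => //; exact: integrable_cosM.
- by apply: integrable_scale => //; exact: integrable_sinM.
Qed.

Lemma hat_ge0 (R : realType) (a x : R) : 0 <= hat a x.
Proof. by rewrite /hat le_max lexx. Qed.

Lemma hat_le (R : realType) (a x : R) : 0 <= a -> hat a x <= a.
Proof. by move=> a0; rewrite /hat ge_max a0 gerBl normr_ge0. Qed.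

Lemma measurable_hat (R : realType) (a x0 : R) : measurable_fun setT (fun x : R => hat a (x - x0)).
Proof.
apply: measurable_maxr => //; apply: measurable_funB => //.
by apply: measurableT_comp => //; exact: measurable_funB.
Qed.

Lemma integrable_hat (R : realType) (mu : probability (measurableTypeR R) R) (a x0 : R) : 0 <= a ->
  mu.-integrable setT (EFin \o (fun x : R => hat a (x - x0))).
Proof.
move=> a0; apply: (@bounded_integrable _ _ _ _ _ a) => [|x]; first exact: measurable_hat.
by rewrite ger0_norm ?hat_ge0// hat_le.
Qed.

(** By Fubini's theorem, the mass that a probability puts around a point can be
    read off its Fourier transform. Both the uniqueness of the measures of the
    semigroup and all the estimates of their tails come from this identity. *)
Lemma hat_fourier (R : realType) (mu : probability (measurableTypeR R) R) (a x0 : R) : 0 <= a ->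
  fejer_mass R * \int[mu]_x hat a ((x : R) - x0) =
  \int[lebesgue_measure]_xi (abs_density a xi *
    (cos (xi * x0) * \int[mu]_x cos (xi * x) + sin (xi * x0) * \int[mu]_x sin (xi * x))).
Proof.
move=> a0.
pose f (p : measurableTypeR R * measurableTypeR R) : \bar R :=
  (abs_density a p.2 * cos (p.2 * (p.1 - x0)))%:E.
have mf : measurable_fun setT f.
  apply/measurable_EFinP; apply: measurable_funM.
    by apply: measurableT_comp => //; exact: measurable_abs_density.
  apply: (measurableT_comp (@measurable_cos R)); apply: measurable_funM => //.
  exact: measurable_funB.
have intf : (mu \x lebesgue_measure)%E.-integrable setT f.
  apply/integrable12ltyP => //.
  apply: (@le_lt_trans _ _ (\int[mu]_x (cst (a * fejer_mass R)%:E x))%E).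
    apply: ge0_le_integral => //=.
    - by move=> x _; apply: integral_ge0.
    - apply: (measurable_fun_fubini_tonelli_F (fun p => `|f p|%E)) => //.
      exact: measurableT_comp.
    move=> x _; rewrite -[X in (_ <= (X * _)%:E)%E](ger0_norm a0) -ge0_integral_abs_density.
    apply: ge0_le_integral => //=.
    - apply/measurable_EFinP; apply: measurableT_comp => //; apply/measurable_EFinP.
      exact: measurable_int (integrable_hat_density a (x - x0)).
    - by apply/measurable_EFinP; exact: measurable_abs_density.
    - move=> xi _; rewrite lee_fin normrM ger0_norm ?abs_density_ge0// ler_piMr ?abs_density_ge0//.
      exact: cos_max.
  by rewrite integral_cst//= probability_setT mule1 ltry.
have := Fubini intf.
rewrite (_ : (\int[mu]_x _)%E = \int[mu]_x (hat a ((x : R) - x0) * fejer_mass R)%:E)%E; last first.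
  apply: eq_integral => x _; rewrite /f/= -integral_hat_density// /Rintegral fineK//.
  by apply: integrable_fin_num => //; exact: integrable_hat_density.
rewrite (_ : (\int[lebesgue_measure]_y _)%E = \int[lebesgue_measure]_xi (abs_density a xi *
    (cos (xi * x0) * \int[mu]_x cos (xi * x) + sin (xi * x0) * \int[mu]_x sin (xi * x)))%:E)%E; last first.
  apply: eq_integral => xi _; rewrite /f/= -Rintegral_cosB.
  rewrite -RintegralZl//; last first.
    apply: (@bounded_integrable _ _ _ _ _ 1) => [|x]; last exact: cos_max.
    apply: (measurableT_comp (@measurable_cos R)); apply: measurable_funM => //.
    exact: measurable_funB.
  rewrite /Rintegral fineK//; apply: integrable_fin_num => //.
  apply: (@bounded_integrable _ _ _ _ _ (abs_density a xi)).
    apply: measurable_funM => //.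
    apply: (measurableT_comp (@measurable_cos R)); apply: measurable_funM => //.
    exact: measurable_funB.
  move=> x; rewrite normrM ger0_norm ?abs_density_ge0// ler_piMr ?abs_density_ge0//.
  exact: cos_max.
move=> /(congr1 fine) e.
by rewrite [RHS]/Rintegral -e mulrC -RintegralZr//; exact: integrable_hat.
Qed.

(** * Probabilities are determined by their Fourier transforms *)

Lemma hat_slope_bounds (R : realType) (a e x : R) : 0 <= a -> 0 < e ->
  0 <= e^-1 * (hat (a + e) x - hat a x) <= 1.
Proof.
move=> a0 e0; rewrite mulrC ler_pdivrMr// mul1r pmulr_lge0 ?invr_gt0// /hat.
by case: (lerP 0 (a + e - `|x|)) => h1; case: (lerP 0 (a - `|x|)) => h2; lra.
Qed.

(** The difference quotient of the triangles is a trapezoid of height one, equal to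
    one on the interval and supported in its [1 / (n + 1)]-neighbourhood. *)
Lemma hat_slope_cvg (R : realType) (a x x0 : R) : 0 <= a ->
  (n.+1%:R * (hat (a + n.+1%:R^-1) (x - x0) - hat a (x - x0))) @[n --> \oo] -->
  (\1_(`[x0 - a, x0 + a]) x : R).
Proof.
move=> a0; rewrite indicE mem_setE in_itv/= -ler_distlC distrC.
have [h|h] := leP `|x - x0| a.
  apply: cvg_near_cst; apply: nearW => n; apply/eqP.
  rewrite /hat !max_r ?subr_ge0//; last by rewrite (le_trans h)// lerDl.
  rewrite opprB addrA subrK [a + _]addrC addrK divff// pnatr_eq0//.
apply: cvg_near_cst; near=> n; apply/eqP.
have : n.+1%:R^-1 <= `|x - x0| - a.
  rewrite ltW//; near: n.
  have d0 : 0 < `|x - x0| - a by rewrite subr_gt0.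
  exact: (near_infty_natSinv_lt (PosNum d0)).
move=> hn; rewrite /hat !max_l ?subrr ?mulr0//; first by rewrite subr_le0 ltW.
by rewrite subr_le0 -lerBrDl.
Unshelve. all: by end_near. Qed.

Lemma hat_slope_integral_cvg (R : realType) (mu : probability (measurableTypeR R) R) (a x0 : R) :
  0 <= a ->
  (n.+1%:R * (\int[mu]_x hat (a + n.+1%:R^-1) ((x : R) - x0) - \int[mu]_x hat a ((x : R) - x0)))
    @[n --> \oo] --> fine (mu [set` `[x0 - a, x0 + a]]).
Proof.
move=> a0.
have n0 n : 0 < n.+1%:R^-1 :> R by [].
pose f n (x : measurableTypeR R) := (n.+1%:R * (hat (a + n.+1%:R^-1) (x - x0) - hat a (x - x0)))%:E.
have ae0 n : 0 <= a + n.+1%:R^-1 by rewrite addr_ge0.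
have iE n : (\int[mu]_x f n x)%E = (n.+1%:R * (\int[mu]_x hat (a + n.+1%:R^-1) ((x : R) - x0)
    - \int[mu]_x hat a ((x : R) - x0)))%:E.
  have i1 := integrable_hat mu x0 (ae0 n).
  have i2 := integrable_hat mu x0 a0.
  rewrite -RintegralB// -RintegralZl//; last exact: integrable_sub.
  rewrite /Rintegral fineK//; apply: integrable_fin_num => //.
  by apply: integrable_scale => //; exact: integrable_sub.
pose g (x : measurableTypeR R) : \bar R := (\1_(`[x0 - a, x0 + a]) (x : R) : R)%:E.
have mf n : measurable_fun setT (f n).
  apply/measurable_EFinP; apply: measurable_funM => //.
  by apply: measurable_funB; exact: measurable_hat.
have mg : measurable_fun setT g by apply/measurable_EFinP; exact: measurable_indic.
have fg : \forall x \ae mu, setT x -> f n x @[n --> \oo] --> g x.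
  apply: aeW => x _; apply: cvg_EFin; first exact: nearW.
  exact: hat_slope_cvg.
have f1 : \forall x \ae mu, forall n, setT x -> (`|f n x| <= cst 1%E x)%E.
  apply: aeW => x n _; rewrite /f/= lee_fin.
  have /andP[h1 h2] := hat_slope_bounds (x - x0) a0 (n0 n).
  by rewrite invrK in h1 h2; rewrite ger0_norm.
have i1 : mu.-integrable setT (cst 1%E) by exact: finite_measure_integrable_cst.
have [_ _] := dominated_convergence measurableT mf mg fg i1 f1.
rewrite integral_indic//= setIT => H.
have Hf : fine (\int[mu]_x f n x)%E @[n --> \oo] --> fine (mu [set` `[x0 - a, x0 + a]]).
  by apply: fine_cvg; rewrite fineK//; apply: fin_num_measure.
by apply: cvg_trans Hf; apply: near_eq_cvg; apply: nearW => n; rewrite iE.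
Qed.

Lemma eq_probability_rays (R : realType) (mu nu : probability (measurableTypeR R) R) :
  (forall x : R, mu [set` `[x, +oo[] = nu [set` `[x, +oo[]) ->
  forall A : set (measurableTypeR R), measurable A -> mu A = nu A.
Proof.
move=> e A mA.
apply: (@measure_unique _ R (measurableTypeR R) (@RGenCInfty.G R)
  (fun n => [set` `[- n%:R, +oo[]) _ _ _ _ mu nu) => //.
- exact: RGenCInfty.measurableE.
- move=> _ _ [x ->] [y ->]; exists (Num.max x y).
  by apply/seteqP; split => z /=; rewrite !in_itv/= !andbT ge_max => /andP.
- by move=> n; exists (- n%:R).
- apply/seteqP; split => // x _; exists (Num.truncn `|x|).+1 => //=.
  rewrite in_itv/= andbT lerNl (le_trans (ler_norm _))// normrN.
  exact/ltW/truncnS_gt.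
- by move=> B [x ->]; exact: e.
- by move=> n; rewrite -ge0_fin_numE// fin_num_measure.
Qed.

Lemma ray_bigcup (R : realType) (x : R) :
  [set` `[x, +oo[] = \bigcup_n [set` `[x + n%:R - n%:R, x + n%:R + n%:R]].
Proof.
apply/seteqP; split => y; rewrite /= in_itv/= andbT; [move=> xy|move=> [n _ /=]].
  exists (Num.truncn (y - x)).+1 => //=; rewrite in_itv/= addrK xy/=.
  rewrite -addrA -lerBlDl (le_trans (ltW (truncnS_gt _)))// lerDl ler0n//.
by rewrite in_itv/= addrK => /andP[].
Qed.

Lemma measure_ray_cvg (R : realType) (mu : probability (measurableTypeR R) R) (x : R) :
  (mu [set` `[x + n%:R - n%:R, x + n%:R + n%:R]]) @[n --> \oo] --> mu [set` `[x, +oo[].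
Proof.
rewrite ray_bigcup; apply: nondecreasing_cvg_mu => [n||] //.
  by apply: bigcup_measurable => n _.
move=> m n mn; apply/subsetPset => y /=; rewrite !in_itv/= !addrK => /andP[-> /= h].
by rewrite (le_trans h)// lerD// ?lerD2l ler_nat.
Qed.

(** The transform determines the integrals of the triangle functions, hence the
    measures of compact intervals by differentiation in the width, hence those of
    rays, which generate the Borel sets. *)
Lemma eq_probability_fourier (R : realType) (mu nu : probability (measurableTypeR R) R) :
  (forall xi : R, \int[mu]_x cos (xi * x) = \int[nu]_x cos (xi * x)) ->
  (forall xi : R, \int[mu]_x sin (xi * x) = \int[nu]_x sin (xi * x)) ->
  forall A : set (measurableTypeR R), measurable A -> mu A = nu A.
Proof.
move=> ec es; apply: eq_probability_rays => x.
have hatE (a x0 : R) : 0 <= a -> \int[mu]_x hat a ((x : R) - x0) = \int[nu]_x hat a ((x : R) - x0).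
  move=> a0; apply: (mulfI (lt0r_neq0 (fejer_mass_gt0 R))).
  by rewrite !hat_fourier//; apply: eq_Rintegral => xi _; rewrite ec es.
have itvE (a x0 : R) : 0 <= a -> mu [set` `[x0 - a, x0 + a]] = nu [set` `[x0 - a, x0 + a]].
  move=> a0; rewrite -[LHS]fineK ?fin_num_measure// -[RHS]fineK ?fin_num_measure//.
  congr EFin; have /cvg_lim <- // := @hat_slope_integral_cvg R mu a x0 a0.
  have /cvg_lim <- // := @hat_slope_integral_cvg R nu a x0 a0.
  congr (limn _); apply/funext => n.
  by rewrite !hatE// addr_ge0.
have /cvg_lim <- // := @measure_ray_cvg R mu x.
have /cvg_lim <- // := @measure_ray_cvg R nu x.
by congr (limn _); apply/funext => n; rewrite itvE.
Qed.

Lemma measurable_fun_rays_probability d (X : measurableType d) (R : realType)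
    (kap : X -> probability (measurableTypeR R) R) :
  (forall x : R, measurable_fun setT (fun t => kap t [set` `[x, +oo[])) ->
  forall A : set (measurableTypeR R), measurable A -> measurable_fun setT (fun t => kap t A).
Proof.
move=> mrays.
pose H := [set A : set (measurableTypeR R) | measurable A /\ measurable_fun setT (fun t => kap t A)].
suff: <<s setT, @RGenCInfty.G R >> `<=` H.
  by move=> GH A; rewrite RGenCInfty.measurableE => /GH[].
apply: lambda_system_subset => //.
- move=> _ _ [x ->] [y ->]; exists (Num.max x y).
  by apply/seteqP; split => z /=; rewrite !in_itv/= !andbT ge_max => /andP.
- split => //.
  + split => //; under eq_fun do rewrite probability_setT.
    exact: measurable_cst.
  + move=> A B BA [mA fA] [mB fB]; split; first exact: measurableD.
    rewrite (_ : (fun t => _) = (fun t => kap t A - kap t B)%E); first exact: emeasurable_funB.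
    apply/funext => t; rewrite measureD// ?setIidr//.
    by rewrite -ge0_fin_numE// fin_num_measure.
  + move=> F ndF HF; have mF n : measurable (F n) by have [] := HF n.
    split; first exact: bigcupT_measurable.
    apply: (emeasurable_fun_cvg (fun n t => kap t (F n))) => [n|t _]; first by have [] := HF n.
    by apply: nondecreasing_cvg_mu => //; exact: bigcupT_measurable.
- move=> _ [x ->]; split; last exact: mrays.
  exact: measurable_itv.
Qed.

(** The identity [hat_fourier] expresses the left-hand side as a parameter integral
    of the transform. Adding [1] to the transform makes the integrand nonnegative,
    so that Tonelli's theorem gives the measurability. *)
Lemma measurable_hat_fourier d (X : measurableType d) (R : realType)
    (kap : X -> probability (measurableTypeR R) R) (a x0 : R) : 0 <= a ->
  measurable_fun setT (fun p : X * R => \int[kap p.1]_y cos (p.2 * y)) ->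
  measurable_fun setT (fun p : X * R => \int[kap p.1]_y sin (p.2 * y)) ->
  measurable_fun setT (fun t => \int[kap t]_y hat a ((y : R) - x0)).
Proof.
move=> a0 mc ms.
have c0 := fejer_mass_gt0 R.
pose g (p : X * measurableTypeR R) : R := cos (p.2 * x0) * \int[kap p.1]_y cos (p.2 * y)
  + sin (p.2 * x0) * \int[kap p.1]_y sin (p.2 * y).
have mg : measurable_fun setT g.
  apply: measurable_funD; apply: measurable_funM => //.
    by apply: (measurableT_comp (@measurable_cos R)); exact: measurable_funM.
  by apply: (measurableT_comp (@measurable_sin R)); exact: measurable_funM.
have gle p : `|g p| <= 1.
  rewrite /g -Rintegral_cosB.
  have i1 : (kap p.1).-integrable setT (EFin \o (fun y : R => cos (p.2 * (y - x0)))).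
    apply: (@bounded_integrable _ _ _ _ _ 1) => [|x]; last exact: cos_max.
    apply: (measurableT_comp (@measurable_cos R)); apply: measurable_funM => //.
    exact: measurable_funB.
  apply: (le_trans (le_normr_Rintegral _ i1)) => //.
  rewrite -[leRHS](_ : \int[kap p.1]_x cst 1 x = 1); last first.
    by rewrite Rintegral_cst//= probability_setT/= mulr1.
  apply: le_Rintegral => //.
  - exact: integrable_norm.
  - by apply: (@bounded_integrable _ _ _ _ _ 1) => // x; rewrite normr1.
  - by move=> x _; exact: cos_max.
pose G (p : X * measurableTypeR R) : \bar R := (abs_density a p.2 * (1 + g p))%:E.
have mG : measurable_fun setT G.
  apply/measurable_EFinP; apply: measurable_funM; last exact: measurable_funD.
  by apply: measurableT_comp => //; exact: measurable_abs_density.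
have G0 p : (0 <= G p)%E.
  rewrite lee_fin mulr_ge0 ?abs_density_ge0//.
  by have := gle p; rewrite ler_norml; lra.
rewrite (_ : (fun t => _) = (fun t => (fejer_mass R)^-1 *
    (fine (\int[lebesgue_measure]_xi G (t, xi))%E - a * fejer_mass R))).
  apply: measurable_funM => //; apply: measurable_funB => //.
  apply: (measurableT_comp (fine_measurable _)) => //.
  exact: (measurable_fun_fubini_tonelli_F G).
apply/funext => t; apply: (mulfI (lt0r_neq0 c0)); rewrite mulVKf ?gt_eqF// hat_fourier//.
rewrite -[X in _ - X * _](ger0_norm a0) -integral_abs_density.
rewrite -[fine _]/(\int[lebesgue_measure]_xi (abs_density a xi * (1 + g (t, xi)))).
rewrite -RintegralB//.
- by apply: eq_Rintegral => xi _; rewrite [_ * (1 + _)]mulrDr mulr1 addrAC subrr add0r.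
- apply: (dominated_integrable measurableT
    (integrable_scale 2 measurableT (integrable_abs_density a))) => [|xi _].
    apply: measurable_funM; first exact: measurable_abs_density.
    by apply: measurable_funD => //; exact: (measurableT_comp mg).
  rewrite normrM ger0_norm ?abs_density_ge0// mulrC.
  rewrite ler_wpM2r ?abs_density_ge0// (le_trans (ler_normD _ _))// normr1.
  by rewrite -[2]/(1 + 1) lerD2l.
- exact: integrable_abs_density.
Qed.

(** The uniqueness proof is constructive enough to express the measure of an interval
    as a limit of functions of the transform, so measurability passes from the
    transform to the measures. This makes the time integral in Duhamel's formula
    accessible to Tonelli's theorem. *)
Lemma measurable_fun_fourier_probability d (X : measurableType d) (R : realType)
    (kap : X -> probability (measurableTypeR R) R) :
  measurable_fun setT (fun p : X * R => \int[kap p.1]_y cos (p.2 * y)) ->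
  measurable_fun setT (fun p : X * R => \int[kap p.1]_y sin (p.2 * y)) ->
  forall A : set (measurableTypeR R), measurable A -> measurable_fun setT (fun t => kap t A).
Proof.
move=> mc ms; apply: measurable_fun_rays_probability => x.
apply: (emeasurable_fun_cvg (fun n t => kap t [set` `[x + n%:R - n%:R, x + n%:R + n%:R]]))
  => [n|t _]; last exact: measure_ray_cvg.
rewrite (_ : (fun t => _) =
    EFin \o (fun t => fine (kap t [set` `[x + n%:R - n%:R, x + n%:R + n%:R]]))); last first.
  by apply/funext => t; rewrite /= fineK// fin_num_measure.
apply/measurable_EFinP.
apply: measurable_fun_cvg => [m|t _]; last by apply: hat_slope_integral_cvg.
by apply: measurable_funM => //; apply: measurable_funB; apply: measurable_hat_fourier => //;
  rewrite addr_ge0.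
Qed.

(** * The convolution semigroup *)

Lemma semigroup_cos (R : realType) (J : R -> R) (mu : R -> probability (measurableTypeR R) R)
    (t xi : R) : semigroup_measures J mu -> 0 <= t ->
  \int[mu t]_y cos (xi * y) = expR (t * symbol J xi).
Proof. by move=> hmu t0; have [] := hmu t xi t0. Qed.

Lemma semigroup_sin (R : realType) (J : R -> R) (mu : R -> probability (measurableTypeR R) R)
    (t xi : R) : semigroup_measures J mu -> 0 <= t -> \int[mu t]_y sin (xi * y) = 0.
Proof. by move=> hmu t0; have [_ /eqP] := hmu t xi t0; rewrite oppr_eq0 => /eqP. Qed.

(** The transform is real, so that the reflected measure has the same one. *)
Lemma semigroup_sym (R : realType) (J : R -> R) (mu : R -> probability (measurableTypeR R) R)
    (t : R) (g : R -> \bar R) : semigroup_measures J mu -> 0 <= t ->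
  measurable_fun setT g -> (forall y, (0 <= g y)%E) ->
  (\int[mu t]_y g (- y)%R = \int[mu t]_y g y)%E.
Proof.
move=> hmu t0 mg g0.
pose opp (y : measurableTypeR R) : measurableTypeR R := - y.
have mphi : measurable_fun setT opp by exact: measurable_funN.
pose H := isMeasurableFun.Build _ _ _ _ opp mphi.
pose phi : {mfun measurableTypeR R >-> measurableTypeR R} := HB.pack opp H.
have reflect (h : R -> R) : measurable_fun setT h -> (forall x, `|h x| <= 1) ->
    \int[distribution (mu t) phi]_y h y = \int[mu t]_y h (- y).
  move=> mh h1; rewrite /Rintegral integral_distribution//; first exact/measurable_EFinP.
  apply: (@bounded_integrable _ _ _ (mu t) (h \o opp) 1) => [|x]; last exact: h1.
  exact: (measurableT_comp mh mphi).
have e A : measurable A -> distribution (mu t) phi A = mu t A.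
  apply: eq_probability_fourier => xi.
    rewrite reflect; [|exact: measurable_cosM|by move=> x; exact: cos_max].
    by apply: eq_Rintegral => y _; rewrite mulrN cosN.
  rewrite reflect; [|exact: measurable_sinM|by move=> x; exact: sin_max].
  under eq_Rintegral => y _ do rewrite mulrN sinN -mulN1r.
  by rewrite RintegralZl ?(semigroup_sin _ hmu t0) ?mulr0//; exact: integrable_sinM.
rewrite -(ge0_integral_distribution phi (f := g))//.
by apply: eq_measure_integral => A mA _; exact: e.
Qed.

(** The transforms multiply, so that the convolution of the measures at times [t]
    and [s] is the measure at time [t + s]. *)
Lemma semigroup_conv (R : realType) (J : R -> R) (mu : R -> probability (measurableTypeR R) R)
    (t s : R) (g : R -> \bar R) : semigroup_measures J mu -> 0 <= t -> 0 <= s ->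
  measurable_fun setT g -> (forall y, (0 <= g y)%E) ->
  (\int[mu (t + s)%R]_y g y = \int[mu t]_x \int[mu s]_y g (x + y)%R)%E.
Proof.
move=> hmu t0 s0 mg g0.
have ts0 : 0 <= t + s by rewrite addr_ge0.
pose T2 := (measurableTypeR R * measurableTypeR R)%type.
pose add (p : T2) : measurableTypeR R := p.1 + p.2.
have mphi : measurable_fun setT add by exact: measurable_funD.
pose H := isMeasurableFun.Build _ _ _ _ add mphi.
pose phi : {mfun T2 >-> measurableTypeR R} := HB.pack add H.
have bint (h : R -> R) : measurable_fun setT h -> (forall x, `|h x| <= 1) ->
    ((mu t \x mu s)%E : {measure set _ -> \bar R}).-integrable setT
      (EFin \o (fun p : T2 => h (p.1 + p.2))).
  move=> mh h1; apply: (@bounded_integrable _ _ _ (mu t \x mu s)%E _ 1) => [|x]; last exact: h1.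
  exact: (measurableT_comp mh mphi).
have fub (h : R -> R) : measurable_fun setT h -> (forall x, `|h x| <= 1) ->
    \int[distribution (mu t \x mu s)%E phi]_z h z = \int[mu t]_x \int[mu s]_y h (x + y).
  move=> mh h1; rewrite /Rintegral integral_distribution.
  - rewrite -[X in fine X](integral12_prod_meas1 (bint _ mh h1)).
    congr fine; apply: eq_integral => x _; rewrite /fubini_F/= fineK//.
    apply: integrable_fin_num => //.
    apply: (@bounded_integrable _ _ _ (mu s) (fun y => h (x + y)) 1) => [|y]; last exact: h1.
    by apply: (measurableT_comp mh); exact: measurable_funD.
  - exact/measurable_EFinP.
  - exact: bint.
have e A : measurable A -> distribution (mu t \x mu s)%E phi A = mu (t + s) A.
  apply: eq_probability_fourier => xi; rewrite fub.
  - rewrite (semigroup_cos _ hmu ts0) mulrDl expRD.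
    under eq_Rintegral => x _.
      under eq_Rintegral => y _ do rewrite mulrDr cosD.
      rewrite RintegralB//; [|by apply: integrable_scale => //; exact: integrable_cosM
        |by apply: integrable_scale => //; exact: integrable_sinM].
      rewrite !RintegralZl//; [|exact: integrable_sinM|exact: integrable_cosM].
      rewrite (semigroup_sin _ hmu s0) (semigroup_cos _ hmu s0) mulr0 subr0.
      over.
    rewrite RintegralZr//; last exact: integrable_cosM.
    by rewrite (semigroup_cos _ hmu t0).
  - exact: measurable_cosM.
  - by move=> x; exact: cos_max.
  - rewrite (semigroup_sin _ hmu ts0).
    under eq_Rintegral => x _.
      under eq_Rintegral => y _ do rewrite mulrDr sinD.
      rewrite RintegralD//; [|by apply: integrable_scale => //; exact: integrable_cosM
        |by apply: integrable_scale => //; exact: integrable_sinM].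
      rewrite !RintegralZl//; [|exact: integrable_sinM|exact: integrable_cosM].
      rewrite (semigroup_sin _ hmu s0) (semigroup_cos _ hmu s0) mulr0 addr0.
      over.
    rewrite RintegralZr//; last exact: integrable_sinM.
    by rewrite (semigroup_sin _ hmu t0) mul0r.
  - exact: measurable_sinM.
  - by move=> x; exact: sin_max.
transitivity (\int[distribution (mu t \x mu s)%E phi]_y g y)%E.
  by apply: eq_measure_integral => A mA _; exact/esym/e.
rewrite ge0_integral_distribution//.
have mgphi : measurable_fun setT (fun p : T2 => g (p.1 + p.2)%R).
  by apply: measurableT_comp.
exact: (fubini_tonelli1 _ mgphi (fun p => g0 _)).
Qed.

(** * The symbol at low frequencies *)

Lemma powR_tail_derive (R : realType) (a x : R) : 0 < a -> 0 < x ->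
  is_derive x 1 (fun y : R => - (a^-1 * y `^ (- a))) (x `^ (- a - 1)).
Proof.
move=> a0 x0.
have dp : derivable (fun y : R => y `^ (- a)) x 1 by apply: derivable_powR; rewrite in_itv/= x0.
have vp : 'D_1 (fun y : R => y `^ (- a)) x = - a * x `^ (- a - 1).
  rewrite -derive1E; apply: powR_derive1; by rewrite in_itv/= x0.
have dd : is_derive x 1 (fun y : R => y `^ (- a)) (- a * x `^ (- a - 1)).
  by rewrite -vp; exact: DeriveDef.
have := is_deriveN (is_deriveZ a^-1 dd).
by rewrite /GRing.scale/= mulrA mulrN mulVf ?gt_eqF// mulN1r opprK.
Qed.

Lemma cvgy_powRN (R : realType) (a : R) : 0 < a -> (y : R) `^ (- a) @[y --> +oo] --> 0.
Proof.
move=> a0; apply/cvgrPdist_le => e e0; near=> y.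
rewrite sub0r normrN ger0_norm ?powR_ge0// powRN.
have ye : e^-1 `^ a^-1 <= y by near: y; exact: nbhs_pinfty_ge.
have e1 : 0 < e^-1 by rewrite invr_gt0.
have ya : e^-1 <= y `^ a.
  rewrite -[leLHS](powRr1 (ltW e1)) -(mulVf (lt0r_neq0 a0)) powRrM.
  by apply: ge0_ler_powR; rewrite ?nnegrE ?powR_ge0// ?(le_trans _ ye) ?powR_ge0// ltW.
by rewrite -[leRHS]invrK lef_pV2// posrE// (lt_le_trans e1).
Unshelve. all: by end_near. Qed.

Lemma integral_powR_ray (R : realType) (a : R) : 0 < a ->
  (\int[lebesgue_measure]_(x in `[1%R, +oo[) ((x : R) `^ (- a - 1))%:E = (a^-1)%:E)%E.
Proof.
move=> a0.
pose F (y : R) := - (a^-1 * y `^ (- a)).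
have dF (x : R) : 0 < x -> is_derive x 1 F (x `^ (- a - 1)) by exact: powR_tail_derive.
have dF1 (x : R) : 0 < x -> derivable F x 1 by move=> x0; apply: @ex_derive; exact: dF.
rewrite (@ge0_continuous_FTC2y R (fun x => x `^ (- a - 1)) F 1 0).
- by rewrite sub0e /F powR1 mulr1 EFinN oppeK.
- by move=> x _; exact: powR_ge0.
- apply: derivable_within_continuous => x; rewrite in_itv/= andbT => x1.
  by apply: derivable_powR; rewrite in_itv/= (lt_le_trans ltr01 x1).
- rewrite [X in _ --> X](_ : 0 = - (a^-1 * 0)); last by rewrite mulr0 oppr0.
  exact: (cvgN (cvgM (cvg_cst _) (cvgy_powRN a0))).
- by move=> x x1; exact: dF1 (lt_trans ltr01 x1).
- apply: cvg_at_right_filter; apply/differentiable_continuous/derivable1_diffP.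
  exact: dF1.
- move=> x; rewrite in_itv/= andbT => x1; rewrite derive1E.
  by have [_ ->] := dF x (lt_trans ltr01 x1).
Qed.

Lemma ge0_integral_even_le (R : realType) (h : R -> \bar R) : measurable_fun setT h ->
  (forall y, (0 <= h y)%E) -> (forall y, h (- y) = h y) ->
  (\int[lebesgue_measure]_y h y <= 2%:E * \int[lebesgue_measure]_(y in `[0%R, +oo[) h y)%E.
Proof.
move=> mh h0 he.
have -> : (\int[lebesgue_measure]_y h y = \int[lebesgue_measure]_(y in `]-oo, 0%R]) h y +
    \int[lebesgue_measure]_(y in `]0%R, +oo[) h y)%E.
  rewrite -ge0_integral_setU//=.
  - by rewrite (itv_setU_setT false (0 : R)).
  - by rewrite (itv_setU_setT false (0 : R)).
  - apply/disj_setPS => y []/=; rewrite !in_itv/= andbT => y0.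
    by rewrite ltNge y0.
rewrite mule_natl mule2n; apply: leeD.
  rewrite (@ge0_integration_by_substitution0 R h)//.
  by under [leRHS]eq_integral do rewrite he.
apply: ge0_subset_integral => //=; first exact: measurable_funTS.
by move=> y /=; rewrite !in_itv/= !andbT => /ltW.
Qed.

(** Its integral is, up to sign, the symbol of a symmetric stable process of index
    [a] at the frequency one. *)
Definition stable_density (R : realType) (a y : R) : R := (1 - cos y) * `|y| `^ (- a - 1).

Lemma stable_density_ge0 (R : realType) (a y : R) : 0 <= stable_density a y.
Proof. by rewrite mulr_ge0 ?powR_ge0// subr_ge0 cos_le1. Qed.

Lemma measurable_stable_density (R : realType) (a : R) : measurable_fun setT (stable_density a).
Proof.
apply: measurable_funM.
  by apply: measurable_funB => //; exact: measurable_cos.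
by apply: (measurableT_comp (measurable_powR _)); exact: normr_measurable.
Qed.

Lemma stable_density_le1 (R : realType) (a y : R) : 0 < a < 1 -> 0 <= y -> y <= 1 ->
  stable_density a y <= 1.
Proof.
move=> /andP[a0 a1] y0 y1; rewrite /stable_density ger0_norm//.
move: y0; rewrite le_eqVlt => /predU1P[<-|y0]; first by rewrite cos0 subrr mul0r.
apply: (@le_trans _ _ (y ^+ 2 / 2 * y `^ (- a - 1))).
  by rewrite ler_wpM2r ?powR_ge0// onem_cos_le.
rewrite mulrAC -powR_mulrn ?(ltW y0)// -powRD; last by rewrite (gt_eqF y0) implybT.
rewrite ler_pdivrMr// mul1r (@le_trans _ _ 1)// ?ler1n//.
rewrite [leRHS](_ : _ = 1 `^ (2 + (- a - 1))); last by rewrite powR1.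
apply: ge0_ler_powR; rewrite ?nnegrE ?(ltW y0)//; lra.
Qed.

(** The integrand is of order [y^(1 - a)] near zero and at most [2 y^(- a - 1)] at
    infinity. *)
Lemma integral_stable_density (R : realType) (a : R) : 0 < a < 1 ->
  (\int[lebesgue_measure]_y (stable_density a y)%:E <= (2 * (1 + 2 * a^-1))%:E)%E.
Proof.
move=> a01; have /andP[a0 a1] := a01.
have mh : measurable_fun setT (fun y : R => (stable_density a y)%:E).
  by apply/measurable_EFinP; exact: measurable_stable_density.
have h0 y : (0 <= (stable_density a y)%:E)%E by rewrite lee_fin stable_density_ge0.
apply: (le_trans (ge0_integral_even_le mh h0 _)).
  by move=> y; rewrite /stable_density cosN normrN.
rewrite EFinM; apply: lee_wpmul2l => //.
rewrite (@itv_bndbnd_setU _ _ _ (BRight (1 : R))) ?bnd_simp//.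
rewrite ge0_integral_setU//=; last 2 first.
- exact: measurable_funTS.
- apply/disj_setPS => y []/=; rewrite !in_itv/= andbT => /andP[_ y0].
  by rewrite ltNge y0.
rewrite EFinD; apply: leeD.
  apply: (@le_trans _ _ (\int[lebesgue_measure]_(y in `[0%R, 1%R]) cst 1%E (y : R))%E); last first.
    by rewrite integral_cst//= lebesgue_measure_itv/= lte_fin ltr01 oppr0 adde0 mule1.
  apply: ge0_le_integral => //=; first exact: measurable_funTS.
  move=> y; rewrite in_itv/= lee_fin => /andP[y0 y1]; exact: (stable_density_le1 a01).
apply: (@le_trans _ _ (\int[lebesgue_measure]_(y in `[1%R, +oo[) (2%:E * ((y : R) `^ (- a - 1))%:E))%E).
  rewrite -[leRHS]integral_itv_obnd_cbnd; last first.
    apply: measurable_funTS; apply: measurable_funeM.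
    by apply/measurable_EFinP; exact: measurable_powR.
  apply: ge0_le_integral => //=; first exact: measurable_funTS.
  - apply: measurable_funTS; apply: measurable_funeM.
    by apply/measurable_EFinP; exact: measurable_powR.
  - move=> y; rewrite in_itv/= andbT => y1; rewrite -EFinM lee_fin.
    rewrite /stable_density ger0_norm ?(le_trans _ (ltW y1))// ler_wpM2r ?powR_ge0//.
    by have := cos_geN1 y; lra.
rewrite ge0_integralZl//=.
- by rewrite integral_powR_ray// -EFinM.
- by apply: measurable_funTS; apply/measurable_EFinP; exact: measurable_powR.
- by move=> y _; rewrite lee_fin powR_ge0.
Qed.

Lemma symbolE (R : realType) (J : R -> R) (xi : R) : (forall z, 0 <= J z) ->
  symbol J xi = - fine (\int[lebesgue_measure]_y ((1 - cos (xi * y)) * J y)%:E)%E.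
Proof.
move=> J0; rewrite /symbol /Rintegral -fineN -integral_ge0N; last first.
  by move=> y _; rewrite lee_fin mulr_ge0 ?J0// subr_ge0 cos_le1.
by congr fine; apply: eq_integral => y _; rewrite -EFinN -mulNr opprB.
Qed.

Lemma measurable_levy_density (R : realType) (J : R -> R) : measurable_fun setT J ->
  measurable_fun setT (fun p : R * R => (1 - cos (p.1 * p.2)) * J p.2).
Proof.
move=> mJ; apply: measurable_funM; last exact: measurableT_comp.
apply: measurable_funB => //; apply: (measurableT_comp (@measurable_cos R)).
exact: measurable_funM.
Qed.

Lemma measurable_symbol (R : realType) (J : R -> R) : measurable_fun setT J ->
  (forall z, 0 <= J z) -> measurable_fun setT (symbol J).
Proof.
move=> mJ J0.
rewrite (_ : symbol J = fun xi => - fine (\int[lebesgue_measure]_y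
    ((1 - cos (xi * y)) * J y)%:E)%E); last by apply/funext => xi; exact: symbolE.
apply: measurable_funN; apply: (measurableT_comp (fine_measurable _)) => //.
pose k (p : R * measurableTypeR R) : \bar R := ((1 - cos (p.1 * p.2)) * J p.2)%:E.
have mk : measurable_fun setT k by apply/measurable_EFinP; exact: measurable_levy_density.
have k0 p : (0 <= k p)%E by rewrite lee_fin mulr_ge0 ?J0// subr_ge0 cos_le1.
exact: (measurable_fun_fubini_tonelli_F k mk k0).
Qed.

(** This scaling is what produces the power [xi^(2s)] in the bounds on the symbol. *)
Lemma stable_density_dilation (R : realType) (a xi y : R) : 0 < xi ->
  xi `^ (a + 1) * stable_density a (xi * y) = (1 - cos (xi * y)) * `|y| `^ (- a - 1).
Proof.
move=> xi0; rewrite /stable_density mulrCA; congr (_ * _).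
rewrite normrM (gtr0_norm xi0) powRM ?(ltW xi0)// mulrA -opprD powRN divff ?mul1r//.
by rewrite gt_eqF// powR_gt0.
Qed.

(** The short jumps contribute at most a multiple of [xi ^ 2], since they have a
    finite second moment; the long ones are dominated by a stable kernel. *)
Lemma levy_integral_le (R : realType) (s : R) (J : R -> R) : 0 < s < 1 / 2 -> kernel_hyp s J ->
  exists2 C : R, 0 < C & forall xi : R, 0 < xi -> xi <= 1 ->
    (\int[lebesgue_measure]_y ((1 - cos (xi * y)) * J y)%:E <= (C * xi `^ (2 * s))%:E)%E.
Proof.
move=> /andP[s0 s12] [mJ Jge0 _ [J0 [J1 [R0 [[J0p J1p R0p] [hJ1 hJ0 _]]]]]].
have a01 : 0 < 2 * s < 1 by lra.
set c := 2 * (1 + 2 * (2 * s)^-1).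
have c0 : 0 < c by rewrite mulr_gt0// addr_gt0// mulr_gt0// invr_gt0; lra.
exists (J1 + J0 * c) => [|xi xi0 xi1]; first by rewrite addr_gt0// mulr_gt0.
pose A : set R := [set z : R | `|z| <= 1].
have mA : measurable A.
  rewrite (_ : A = [set` `[-1, 1]]); first exact: measurable_itv.
  by apply/seteqP; split => z; rewrite /A/= in_itv/= ler_norml.
have mf : measurable_fun setT (fun y : R => ((1 - cos (xi * y)) * J y)%:E).
  apply/measurable_EFinP; apply: measurable_funM => //.
  by apply: measurable_funB => //; exact: measurable_cosM.
have f0 (y : R) : (0 <= ((1 - cos (xi * y)) * J y)%:E)%E.
  by rewrite lee_fin mulr_ge0 ?Jge0// subr_ge0 cos_le1.
have -> : (\int[lebesgue_measure]_y ((1 - cos (xi * y)) * J y)%:E =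
    \int[lebesgue_measure]_(y in A) ((1 - cos (xi * y)) * J y)%:E +
    \int[lebesgue_measure]_(y in ~` A) ((1 - cos (xi * y)) * J y)%:E)%E.
  rewrite -ge0_integral_setU//= ?setUv//; first exact: measurableC.
  exact/disj_setPCl.
have x2s : xi ^+ 2 <= xi `^ (2 * s).
  by rewrite -powR_mulrn ?(ltW xi0)//; apply: ger_powR; rewrite ?xi0//; lra.
rewrite mulrDl EFinD; apply: leeD.
  apply: (@le_trans _ _ (\int[lebesgue_measure]_(y in A) ((xi ^+ 2 / 2)%:E * (J y * `|y| ^+ 2)%:E))%E).
    apply: ge0_le_integral => //=.
    - exact: measurable_funTS.
    - apply: measurable_funTS; apply: measurable_funeM; apply/measurable_EFinP.
      by apply: measurable_funM => //; apply: measurable_funX; exact: normr_measurable.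
    - move=> y _; rewrite -EFinM lee_fin mulrCA mulrC ler_wpM2l ?Jge0//.
      by rewrite real_normK ?num_real// mulrAC -exprMn onem_cos_le.
  rewrite ge0_integralZl//=.
  - apply: (@le_trans _ _ ((xi ^+ 2 / 2)%:E * (2 * J1)%:E)%E).
      by apply: lee_wpmul2l => //; rewrite lee_fin divr_ge0// sqr_ge0.
    rewrite -EFinM lee_fin mulrA mulfVK// mulrC ler_wpM2l ?(ltW J1p)//.
  - apply: measurable_funTS; apply/measurable_EFinP.
    by apply: measurable_funM => //; apply: measurable_funX; exact: normr_measurable.
  - by move=> y _; rewrite lee_fin mulr_ge0 ?Jge0// exprn_ge0.
  - by rewrite lee_fin divr_ge0// sqr_ge0.
have ms : measurable_fun setT (fun y : R => (stable_density (2 * s) y)%:E).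
  by apply/measurable_EFinP; exact: measurable_stable_density.
have msx : measurable_fun setT (fun y : R => ((J0 * xi `^ (2 * s + 1))%:E *
      (stable_density (2 * s) (xi * y))%:E)%E).
  by apply: measurable_funeM; apply: (measurableT_comp ms); exact: measurable_funM.
have sx0 (y : R) : (0 <= (J0 * xi `^ (2 * s + 1))%:E * (stable_density (2 * s) (xi * y))%:E)%E.
  by rewrite -EFinM lee_fin mulr_ge0 ?stable_density_ge0// mulr_ge0 ?powR_ge0// ltW.
apply: (@le_trans _ _ (\int[lebesgue_measure]_y ((J0 * xi `^ (2 * s + 1))%:E *
      (stable_density (2 * s) (xi * (y : R)))%:E))%E).
  apply: (@le_trans _ _ (\int[lebesgue_measure]_(y in ~` A) ((J0 * xi `^ (2 * s + 1))%:E *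
      (stable_density (2 * s) (xi * (y : R)))%:E))%E).
    apply: ge0_le_integral => //=; [exact: measurableC|exact: measurable_funTS|exact: measurable_funTS|].
    move=> y /negP; rewrite -ltNge => y1; rewrite -EFinM lee_fin.
    rewrite -mulrA stable_density_dilation// mulrCA ler_wpM2l ?subr_ge0 ?cos_le1//.
    rewrite (le_trans (hJ0 y (ltW y1)))// -powRN [1 + 2 * s]addrC opprD//.
  by apply: ge0_subset_integral => //=; exact: measurableC.
rewrite ge0_integralZl//=; last 3 first.
- by apply: (measurableT_comp ms); exact: measurable_funM.
- by move=> y _; rewrite lee_fin stable_density_ge0.
- by rewrite lee_fin mulr_ge0 ?powR_ge0// ltW.
rewrite (@ge0_integral_dilation _ xi (fun y => (stable_density (2 * s) y)%:E))//; last first.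
  by move=> y; rewrite lee_fin stable_density_ge0.
have -> : J0 * c * xi `^ (2 * s) = J0 * xi `^ (2 * s + 1) * xi^-1 * c.
  rewrite powRD; last by rewrite (gt_eqF xi0) implybT.
  by rewrite powRr1 ?(ltW xi0)// mulrA mulfK ?gt_eqF// mulrAC.
rewrite muleA -EFinM [leRHS]EFinM; apply: lee_wpmul2l; last exact: integral_stable_density.
by rewrite lee_fin mulr_ge0 ?invr_ge0 ?mulr_ge0 ?powR_ge0// ltW.
Qed.

Lemma levy_density_ge_annulus (R : realType) (s : R) (J : R -> R) (J0 R0 xi y : R) :
  0 < s -> (forall z, 0 <= J z) -> 0 < J0 -> 0 < R0 -> 0 < xi -> 2 * R0 <= xi^-1 ->
  (forall z : R, R0 <= `|z| -> J0^-1 / `|z| `^ (1 + 2 * s) <= J z) ->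
  xi^-1 / 2 <= y -> y <= xi^-1 ->
  cos 1 ^+ 2 / 2 / 4 * (J0^-1 * xi^-1 `^ (- (1 + 2 * s))) <= (1 - cos (xi * y)) * J y.
Proof.
move=> s0 Jge0 J0p R0p xi0 rR hJ0 y1 y2.
set r := xi^-1 in rR y1 y2 *; have r0 : 0 < r by rewrite invr_gt0.
have y0 : 0 < y by rewrite (lt_le_trans _ y1)// divr_gt0.
have q1 : 2^-1 <= xi * y by rewrite -(ler_pdivrMl _ _ xi0) -/r.
have q2 : xi * y <= 1 by rewrite -ler_pdivlMl// -/r mulr1.
have q0 : 0 < xi * y by rewrite mulr_gt0.
apply: ler_pM.
- by rewrite !divr_ge0// sqr_ge0.
- by rewrite mulr_ge0 ?powR_ge0// invr_ge0 ltW.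
- apply: (le_trans _ (onem_cos_ge _)); last by rewrite gtr0_norm.
  rewrite ler_wpM2l ?divr_ge0 ?sqr_ge0//.
  by rewrite (_ : 4^-1 = 2^-1 ^+ 2) ?ler_pXn2r ?nnegrE ?(ltW q0)//; field.
- apply: (le_trans _ (hJ0 y _)); last by rewrite gtr0_norm//; lra.
  rewrite -powRN gtr0_norm// ler_wpM2l ?invr_ge0 ?(ltW J0p)// !powRN lef_pV2 ?posrE ?powR_gt0//.
  by apply: ge0_ler_powR; rewrite ?nnegrE ?(ltW r0) ?(ltW y0)//; lra.
Qed.

(** It suffices to integrate over [1 / (2 xi) <= y <= 1 / xi], where [1 - cos (xi y)]
    is bounded below, and where the lower bound on the kernel is available as soon
    as [xi] is small. *)
Lemma levy_integral_ge (R : realType) (s : R) (J : R -> R) : 0 < s < 1 / 2 -> kernel_hyp s J ->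
  exists c X : R, [/\ 0 < c, 0 < X & forall xi : R, 0 < xi -> xi <= X ->
    ((c * xi `^ (2 * s))%:E <= \int[lebesgue_measure]_y ((1 - cos (xi * y)) * J y)%:E)%E].
Proof.
move=> /andP[s0 s12] [mJ Jge0 _ [J0 [J1 [R0 [[J0p J1p R0p] [_ _ hJ0]]]]]].
set k := cos 1 ^+ 2 / 2 : R.
have k0 : 0 < k by rewrite divr_gt0// exprn_gt0// cos1_gt0.
have R0gt : 0 < R0 by rewrite (lt_le_trans ltr01).
exists (k / 8 / J0), (2 * R0)^-1; split.
- by rewrite divr_gt0// divr_gt0.
- by rewrite invr_gt0 mulr_gt0.
move=> xi xi0 xiX.
set r := xi^-1; have r0 : 0 < r by rewrite invr_gt0.
have rR : 2 * R0 <= r by rewrite -[leLHS]invrK lef_pV2// posrE// invr_gt0 mulr_gt0.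
have mf : measurable_fun setT (fun y : R => ((1 - cos (xi * y)) * J y)%:E).
  apply/measurable_EFinP; apply: measurable_funM => //.
  by apply: measurable_funB => //; exact: measurable_cosM.
have f0 (y : R) : (0 <= ((1 - cos (xi * y)) * J y)%:E)%E.
  by rewrite lee_fin mulr_ge0 ?Jge0// subr_ge0 cos_le1.
apply: (@le_trans _ _ (\int[lebesgue_measure]_(y in `[(r / 2)%R, r]) ((1 - cos (xi * (y : R))) * J y)%:E)%E); last first.
  by apply: ge0_subset_integral => //=.
pose m := k / 4 * (J0^-1 * r `^ (- (1 + 2 * s))).
have -> : (k / 8 / J0 * xi `^ (2 * s))%:E =
    (\int[lebesgue_measure]_(y in `[(r / 2)%R, r]) cst m%:E (y : R))%E.
  rewrite integral_cst//= lebesgue_measure_itv/= lte_fin ifT; last lra.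
  rewrite -EFinD -EFinM; congr EFin.
  rewrite /m opprD powRD; last by rewrite (gt_eqF r0) implybT.
  rewrite powR_inv1 ?(ltW r0)// -[xi]invrK -/r -[r^-1]powR_inv1 ?(ltW r0)// -powRrM mulN1r.
  by rewrite powR_inv1 ?(ltW r0)//; field; rewrite !gt_eqF.
apply: ge0_le_integral => //=.
- move=> y _; rewrite lee_fin ltW//; apply: mulr_gt0; first exact: divr_gt0.
  by apply: mulr_gt0; [rewrite invr_gt0|exact: powR_gt0].
- exact: measurable_funTS.
- move=> y; rewrite in_itv/= => /andP[y1 y2]; rewrite lee_fin.
  exact: (@levy_density_ge_annulus _ s _ J0 R0).
Qed.

Lemma symbol_bounds (R : realType) (s : R) (J : R -> R) : 0 < s < 1 / 2 -> kernel_hyp s J ->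
  exists C c X : R, [/\ 0 < C, 0 < c & 0 < X] /\
   [/\ forall xi : R, symbol J xi <= 0,
      forall xi : R, 0 < xi -> xi <= 1 -> - symbol J xi <= C * xi `^ (2 * s) &
      forall xi : R, 0 < xi -> xi <= X -> c * xi `^ (2 * s) <= - symbol J xi].
Proof.
move=> hs hJ; have [mJ J0 _ _] := hJ.
have [C C0 hC] := levy_integral_le hs hJ.
have [c [X [c0 X0 hc]]] := levy_integral_ge hs hJ.
have f0 (xi : R) : (0 <= \int[lebesgue_measure]_y ((1 - cos (xi * y)) * J y)%:E)%E.
  by apply: integral_ge0 => y _; rewrite lee_fin mulr_ge0 ?J0// subr_ge0 cos_le1.
exists C, c, (Num.min X 1); split; first by split=> //; rewrite lt_min X0/=.
split=> [xi|xi xi0 xi1|xi xi0]; rewrite symbolE ?opprK//.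
- by rewrite oppr_le0 fine_ge0.
- rewrite -lee_fin fineK; first exact: hC.
  by rewrite ge0_fin_numE// (le_lt_trans (hC _ xi0 xi1)) ?ltry.
- rewrite le_min => /andP[xiX xi1]; rewrite -lee_fin fineK; first exact: hc.
  by rewrite ge0_fin_numE// (le_lt_trans (hC _ xi0 xi1)) ?ltry.
Qed.

(** * Jumps of the process: truncated moments and tails *)

(** The truncated first moment controls at once the probability of a jump longer
    than [a] and the oscillation of Lipschitz functions under shorter jumps; and
    [a * trunc a] is [a] minus a triangle function, hence explicit on the Fourier
    side. *)
Definition trunc (R : realType) (a z : R) : R := Num.min 1 (`|z| / a).

Lemma trunc_ge0 (R : realType) (a z : R) : 0 < a -> 0 <= trunc a z.
Proof. by move=> a0; rewrite /trunc le_min ler01 divr_ge0// ltW. Qed.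

Lemma trunc_le1 (R : realType) (a z : R) : trunc a z <= 1.
Proof. by rewrite /trunc ge_min lexx. Qed.

Lemma trunc_hat (R : realType) (a z : R) : 0 < a -> a * trunc a z = a - hat a z.
Proof.
move=> a0; rewrite /trunc /hat minr_pMr ?ltW// mulr1 mulrC divfK ?gt_eqF//.
by case: (lerP a `|z|) => h; [rewrite max_l ?subr0|rewrite max_r ?opprB ?subrKC]; lra.
Qed.

Lemma measurable_trunc (R : realType) (a : R) : measurable_fun setT (@trunc R a).
Proof.
by apply: measurable_minr => //; apply: measurable_funM => //; exact: normr_measurable.
Qed.

Lemma integrable_trunc (R : realType) (mu : probability (measurableTypeR R) R) (a : R) : 0 < a ->
  mu.-integrable setT (EFin \o (fun z : R => trunc a z)).
Proof.
move=> a0; apply: (@bounded_integrable _ _ _ _ _ 1) => [|x]; first exact: measurable_trunc.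
by rewrite ger0_norm ?trunc_ge0// trunc_le1.
Qed.

Lemma norm_integral_cos_le1 (R : realType) (mu : probability (measurableTypeR R) R) (xi : R) :
  `|\int[mu]_x cos (xi * x)| <= 1.
Proof.
apply: (le_trans (le_normr_Rintegral _ (integrable_cosM mu xi))) => //.
rewrite -[leRHS](_ : \int[mu]_x cst 1 x = 1); last first.
  by rewrite Rintegral_cst//= probability_setT/= mulr1.
apply: le_Rintegral => //.
- exact: integrable_norm (integrable_cosM mu xi).
- by apply: (@bounded_integrable _ _ _ _ _ 1) => // x; rewrite normr1.
- by move=> x _; exact: cos_max.
Qed.

Lemma fourier_trunc_eq (R : realType) (mu : probability (measurableTypeR R) R) (a : R) :
  measurable_fun setT (fun xi : R => \int[mu]_x cos (xi * x)) -> 0 < a ->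
  fejer_mass R * (a * \int[mu]_z trunc a z) =
  \int[lebesgue_measure]_xi (abs_density a xi * (1 - \int[mu]_x cos (xi * x))).
Proof.
move=> mphi a0; have := hat_fourier mu 0 (ltW a0).
under [X in _ = X -> _]eq_Rintegral => xi _ do rewrite mulr0 cos0 sin0 mul1r mul0r addr0.
under eq_Rintegral do rewrite subr0.
move=> h; under [RHS]eq_Rintegral => xi _ do rewrite mulrBr mulr1.
have ih := integrable_hat mu 0 (ltW a0).
have {}ih : mu.-integrable setT (EFin \o hat a).
  by apply: eq_integrable ih => // x _ /=; rewrite subr0.
rewrite RintegralB//; last 2 first.
- exact: integrable_abs_density.
- apply: (dominated_integrable measurableT (integrable_abs_density a)).
    by apply: measurable_funM => //; exact: measurable_abs_density.
  move=> xi _; rewrite normrM ger0_norm ?abs_density_ge0// ler_piMr ?abs_density_ge0//.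
  exact: norm_integral_cos_le1.
rewrite -h integral_abs_density gtr0_norm// mulrC [RHS]addrC -RintegralZl//; last exact: integrable_trunc.
under eq_Rintegral do rewrite trunc_hat//.
rewrite RintegralB//; last exact: finite_measure_integrable_cst.
by rewrite Rintegral_cst//= probability_setT/= mulr1; ring.
Qed.

Lemma abs_density_powR (R : realType) (a b xi : R) : 0 < a -> b < 1 ->
  abs_density a xi * `|xi| `^ b = a `^ (2 - b) * stable_density (1 - b) (a * xi).
Proof.
move=> a0 b1; rewrite /abs_density /stable_density [in RHS]mulrCA -mulrA; congr (_ * _).
have [->|xi0] := eqVneq xi 0.
  by rewrite expr0n/= invr0 mul0r mulr0 normr0 powR0 ?mulr0//; lra.
have p : 0 < `|xi| by rewrite normr_gt0.
rewrite normrM (gtr0_norm a0) powRM ?(ltW a0) ?(ltW p)// mulrA -powRD; last by rewrite (gt_eqF a0) implybT.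
rewrite (_ : 2 - b + (- (1 - b) - 1) = 0); last lra.
rewrite powRr0 mul1r -real_normK ?num_real// -powR_invn ?(ltW p)// -powRD; last by rewrite (gt_eqF p) implybT.
by congr (_ `^ _); lra.
Qed.

(** The transform differs from [1] by at most a multiple of [|xi|^(2s)], at all
    frequencies; integrated against the weight [(1 - cos (a xi)) / xi ^ 2] of the
    triangle function, this scales as [a^(1 - 2s)]. The weight is then a stable
    density of index [1 - 2s], integrable precisely because [s < 1 / 2]. *)
Lemma truncated_moment (R : realType) (s : R) (J : R -> R)
    (mu : R -> probability (measurableTypeR R) R) : 0 < s < 1 / 2 -> kernel_hyp s J ->
  semigroup_measures J mu ->
  exists2 C : R, 0 < C & forall t a : R, 0 <= t <= 2 -> 0 < a ->
    \int[mu t]_z trunc a z <= C * a `^ (- (2 * s)).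
Proof.
move=> hs hJ hmu; have [mJ J0 _ _] := hJ.
have [C0 [c0 [X [[C0p _ _] [W0 hC _]]]]] := symbol_bounds hs hJ.
have /andP[s0 s12] := hs.
pose C' := 2 * C0 + 1; have C'0 : 0 < C' by rewrite addr_gt0// mulr_gt0.
have cm := fejer_mass_gt0 R.
set cs := 2 * (1 + 2 * (1 - 2 * s)^-1).
have cs0 : 0 < cs by rewrite mulr_gt0// addr_gt0// mulr_gt0// invr_gt0; lra.
exists (C' * cs / fejer_mass R); first by rewrite divr_gt0// mulr_gt0.
move=> t a /andP[t0 t2] a0.
have phiE (xi : R) : \int[mu t]_x cos (xi * x) = expR (t * symbol J xi) by exact: semigroup_cos.
have mphi : measurable_fun setT (fun xi : R => \int[mu t]_x cos (xi * x)).
  under eq_fun do rewrite phiE.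
  apply: (measurableT_comp (@measurable_expR R)); apply: measurable_funM => //.
  exact: measurable_symbol.
have phi_ge0 (xi : R) : 0 <= 1 - \int[mu t]_x cos (xi * x).
  by rewrite phiE subr_ge0 expR_le1 mulr_ge0_le0.
have phi_le (xi : R) : 1 - \int[mu t]_x cos (xi * x) <= C' * `|xi| `^ (2 * s).
  wlog xi0 : xi / 0 <= xi.
    move=> H; have [/H//|/ltW xi0] := leP 0 xi.
    rewrite -normrN (_ : \int[mu t]_x _ = \int[mu t]_x cos (- xi * x)); first by rewrite H ?oppr_ge0.
    by apply: eq_Rintegral => x _; rewrite mulNr cosN.
  rewrite ger0_norm// phiE.
  have e1 := expR_ge1Dx (t * symbol J xi).
  move: xi0; rewrite le_eqVlt => /predU1P[<-|xi0].
    rewrite -phiE; under eq_Rintegral do rewrite mul0r cos0.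
    by rewrite Rintegral_cst//= probability_setT/= mulr1 subrr mulr_ge0 ?powR_ge0// ltW.
  have [xi1|xi1] := leP xi 1.
    have h := hC xi xi0 xi1; have p : 0 <= xi `^ (2 * s) by exact: powR_ge0.
    have w := W0 xi.
    have h2 : t * (- symbol J xi) <= 2 * (C0 * xi `^ (2 * s)).
      by apply: ler_pM => //; rewrite oppr_ge0.
    rewrite /C'; lra.
  have x1 : 1 <= xi `^ (2 * s).
    by have := @ler_powR R xi (ltW xi1) 0 (2 * s); rewrite powRr0; apply; lra.
  have := expR_ge0 (t * symbol J xi) => e0.
  have : 1 * 1 <= C' * xi `^ (2 * s) by apply: ler_pM => //; rewrite /C'; lra.
  by lra.
have ptw (xi : R) : abs_density a xi * (1 - \int[mu t]_x cos (xi * x)) <=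
    C' * a `^ (2 - 2 * s) * stable_density (1 - 2 * s) (a * xi).
  rewrite -mulrA -abs_density_powR//; last lra.
  by rewrite mulrCA ler_wpM2l ?abs_density_ge0.
have key : fejer_mass R * (a * \int[mu t]_z trunc a z) <= C' * (a `^ (1 - 2 * s) * cs).
  rewrite fourier_trunc_eq//.
  have bound : (\int[lebesgue_measure]_xi (abs_density a xi * (1 - \int[mu t]_x cos (xi * x)))%:E <=
      (C' * (a `^ (1 - 2 * s) * cs))%:E)%E.
    apply: (@le_trans _ _ (\int[lebesgue_measure]_xi ((C' * a `^ (2 - 2 * s))%:E *
        (stable_density (1 - 2 * s) (a * (xi : R)))%:E))%E).
      apply: ge0_le_integral => //=.
      - by move=> xi _; rewrite lee_fin mulr_ge0 ?abs_density_ge0.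
      - apply/measurable_EFinP; apply: measurable_funM; first exact: measurable_abs_density.
        exact: measurable_funB.
      - apply: measurable_funeM; apply/measurable_EFinP.
        by apply: (measurableT_comp (@measurable_stable_density R _)); exact: measurable_funM.
      - by move=> xi _; rewrite -EFinM lee_fin; exact: ptw.
    rewrite ge0_integralZl//=; last 3 first.
    - apply/measurable_EFinP.
      by apply: (measurableT_comp (@measurable_stable_density R _)); exact: measurable_funM.
    - by move=> y _; rewrite lee_fin stable_density_ge0.
    - by rewrite lee_fin mulr_ge0 ?powR_ge0// ltW.
    rewrite (@ge0_integral_dilation _ a (fun y => (stable_density (1 - 2 * s) y)%:E))//; last 2 first.
    - by apply/measurable_EFinP; exact: measurable_stable_density.
    - by move=> y; rewrite lee_fin stable_density_ge0.
    rewrite muleA -EFinM -mulrA.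
    rewrite (_ : a `^ (2 - 2 * s) / a = a `^ (1 - 2 * s)); last first.
      rewrite -[a^-1]powR_inv1 ?(ltW a0)// -powRD; last by rewrite (gt_eqF a0) implybT.
      by congr (_ `^ _); lra.
    rewrite mulrA [leRHS]EFinM; apply: lee_wpmul2l; last by apply: integral_stable_density; lra.
    by rewrite lee_fin mulr_ge0 ?powR_ge0// ltW.
  rewrite -lee_fin /Rintegral fineK//; rewrite ge0_fin_numE ?(le_lt_trans bound) ?ltry//.
  apply: integral_ge0 => xi _; rewrite lee_fin.
  by apply: mulr_ge0; [exact: abs_density_ge0|exact: phi_ge0].
have -> : C' * cs / fejer_mass R * a `^ (- (2 * s)) =
    (fejer_mass R * a)^-1 * (C' * (a `^ (1 - 2 * s) * cs)).
  rewrite powRD; last by rewrite (gt_eqF a0) implybT.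
  by rewrite powRr1 ?(ltW a0)//; field; rewrite !gt_eqF.
by rewrite ler_pdivlMl ?mulr_gt0// -mulrA.
Qed.

Definition far (R : realType) (r z : R) : R := if r <= `|z| then 1 else 0.

Lemma measurable_far (R : realType) (r : R) : measurable_fun setT (@far R r).
Proof.
by apply: measurable_fun_ifT => //; apply: measurable_fun_ler.
Qed.

Lemma far_ge0 (R : realType) (r z : R) : 0 <= far r z.
Proof. by rewrite /far; case: ifP. Qed.

Lemma integrable_far (R : realType) (mu : probability (measurableTypeR R) R) (r : R) :
  mu.-integrable setT (EFin \o (fun z : R => far r z)).
Proof.
apply: (@bounded_integrable _ _ _ _ _ 1) => [|x]; first exact: measurable_far.
by rewrite ger0_norm ?far_ge0// /far; case: ifP.
Qed.

Lemma onem_cos_far (R : realType) (r xi z : R) : 0 < r ->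
  1 - cos (xi * z) <= 2 * far r z + xi ^+ 2 * r ^+ 2 / 2 * trunc r z.
Proof.
move=> r0; rewrite /far; have [h|h] := leP r `|z|.
  have := cos_geN1 (xi * z); have := trunc_ge0 z r0.
  have : 0 <= xi ^+ 2 * r ^+ 2 / 2 by rewrite divr_ge0// mulr_ge0// sqr_ge0.
  move=> h1 h2 h3; have := mulr_ge0 h1 h2; rewrite /=; lra.
rewrite mulr0 add0r (le_trans (onem_cos_le _))//.
rewrite /trunc min_r ?ler_pdivrMr ?mul1r ?(ltW h)//.
rewrite exprMn -[z ^+ 2]real_normK ?num_real//.
rewrite (_ : _ * (`|z| / r) = xi ^+ 2 / 2 * (r * `|z|)); last by field; rewrite gt_eqF.
rewrite (_ : _ * 2 = xi ^+ 2 * (r * `|z|)); last by field.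
by rewrite ler_wpM2l ?sqr_ge0// expr2 ler_wpM2r// ltW.
Qed.

Lemma onem_expRN_ge (R : realType) (q : R) : 0 <= q -> q <= 1 -> q / 2 <= 1 - expR (- q).
Proof.
move=> q0 q1; have h := expR_ge1Dx q.
have p : 0 < 1 + q by lra.
have : expR (- q) <= (1 + q)^-1 by rewrite expRN lef_pV2// posrE ?expR_gt0.
have : (1 + q)^-1 <= 1 - q / 2 by rewrite -[leLHS]mul1r ler_pdivrMr//; nra.
lra.
Qed.

(** At the frequency [eta / r] the transform falls short of [1] by a multiple of
    [(eta / r)^(2s)], whereas the jumps shorter than [r] account for at most a
    multiple of [eta ^ 2 * r^(- 2s)]. For small [eta] the difference must come from
    the longer jumps. *)
Lemma far_lower_bound (R : realType) (s : R) (J : R -> R)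
    (mu : R -> probability (measurableTypeR R) R) : 0 < s < 1 / 2 -> kernel_hyp s J ->
  semigroup_measures J mu ->
  exists c R1 : R, [/\ 0 < c, 0 < R1 & forall t r : R, 1 <= t <= 2 -> R1 <= r ->
    c * r `^ (- (2 * s)) <= \int[mu t]_z far r z].
Proof.
move=> hs hJ hmu.
have [C0 [c0 [X [[_ c0p X0] [W0 _ hc]]]]] := symbol_bounds hs hJ.
have [C C_gt0 hC] := truncated_moment hs hJ hmu.
have /andP[s0 s12] := hs.
(* [c1 <= 1] keeps the exponent [q0] below in the range of [onem_expRN_ge] *)
pose c1 := Num.min c0 1; have c1p : 0 < c1 by rewrite lt_min c0p/=.
pose eta := Num.min 1 (c1 / (2 * C)).
have eta0 : 0 < eta by rewrite lt_min ltr01 divr_gt0// mulr_gt0.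
have eta1 : eta <= 1 by rewrite /eta ge_min lexx.
have etaC : eta <= c1 / (2 * C) by rewrite /eta ge_min lexx orbT.
pose X1 := Num.min X 1; have X10 : 0 < X1 by rewrite lt_min X0/=.
exists (c1 * eta `^ (2 * s) / 8), X1^-1; split.
- by rewrite divr_gt0// mulr_gt0// powR_gt0.
- by rewrite invr_gt0.
move=> t r /andP[t1 t2] rR.
have t0 : 0 <= t by lra.
have r0 : 0 < r by rewrite (lt_le_trans _ rR)// invr_gt0.
pose xi := eta / r; have xi0 : 0 < xi by rewrite divr_gt0.
have xiX1 : xi <= X1.
  rewrite /xi ler_pdivrMr// (le_trans eta1)// -ler_pdivrMl// mulr1//.
have xiX : xi <= X by rewrite (le_trans xiX1)// /X1 ge_min lexx.
have xi1 : xi <= 1 by rewrite (le_trans xiX1)// /X1 ge_min lexx orbT.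
have tr : 0 <= t <= 2 by rewrite t0 t2.
have m := hC t r tr r0.
set q0 := c1 * xi `^ (2 * s).
have q00 : 0 <= q0 by rewrite mulr_ge0 ?powR_ge0// ltW.
have q01 : q0 <= 1.
  rewrite -[leRHS]mulr1 ler_pM ?powR_ge0 ?(ltW c1p)//; first by rewrite /c1 ge_min lexx orbT.
  rewrite [leRHS](_ : _ = xi `^ 0); last by rewrite powRr0.
  by apply: ger_powR; rewrite ?xi0//; lra.
have qW : q0 <= - (t * symbol J xi).
  have h1 := hc xi xi0 xiX.
  have h2 : q0 <= c0 * xi `^ (2 * s) by rewrite ler_wpM2r ?powR_ge0// /c1 ge_min lexx.
  rewrite -mulrN (le_trans h2)// (le_trans h1)// ler_peMl// oppr_ge0//.
have low : q0 / 2 <= 1 - \int[mu t]_z cos (xi * z).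
  rewrite (semigroup_cos _ hmu t0) (le_trans (onem_expRN_ge q00 q01))//.
  by rewrite lerD2l lerN2 ler_expR -[leLHS]opprK lerN2.
have up : 1 - \int[mu t]_z cos (xi * z) <=
    2 * \int[mu t]_z far r z + xi ^+ 2 * r ^+ 2 / 2 * \int[mu t]_z trunc r z.
  have i1 : (mu t).-integrable setT (EFin \o cst 1) by exact: finite_measure_integrable_cst.
  have i2 := integrable_cosM (mu t) xi.
  have i3 := integrable_far (mu t) r.
  have i4 := integrable_trunc (mu t) r0.
  have -> : 1 - \int[mu t]_z cos (xi * z) = \int[mu t]_z (1 - cos (xi * z)).
    by rewrite RintegralB// Rintegral_cst//= probability_setT/= mul1r.
  rewrite -!RintegralZl// -RintegralD//; [|exact: integrable_scale|exact: integrable_scale].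
  apply: le_Rintegral => //.
  - exact: integrable_sub.
  - by apply: integrable_add => //; exact: integrable_scale.
  - by move=> z _; exact: onem_cos_far.
have xr : xi * r = eta by rewrite /xi divfK// gt_eqF.
have xis : xi `^ (2 * s) = eta `^ (2 * s) * r `^ (- (2 * s)).
  by rewrite /xi -powR_inv1 ?(ltW r0)// powRM ?powR_ge0 ?(ltW eta0)// -powRrM mulN1r.
have eta2 : C * eta ^+ 2 <= c1 / 2 * eta `^ (2 * s).
  have h1 : C * eta <= c1 / 2.
    have := ler_wpM2l (ltW C_gt0) etaC.
    by rewrite (_ : C * (c1 / (2 * C)) = c1 / 2)//; field; rewrite gt_eqF.
  have h2 : eta <= eta `^ (2 * s).
    rewrite -[leLHS]powRr1 ?(ltW eta0)//; apply: ger_powR; rewrite ?eta0//; lra.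
  rewrite expr2 mulrA; apply: ler_pM => //; first by rewrite mulr_ge0// ltW.
  exact: ltW.
have rs : 0 <= r `^ (- (2 * s)) by exact: powR_ge0.
have h5 : xi ^+ 2 * r ^+ 2 / 2 * \int[mu t]_z trunc r z <= eta ^+ 2 / 2 * (C * r `^ (- (2 * s))).
  by rewrite -exprMn xr ler_wpM2l// divr_ge0// sqr_ge0.
have h6 := ler_wpM2r rs eta2.
move: low; rewrite /q0 xis; set F := \int[mu t]_z far r z in up *.
move: up h5 h6; set e2s := eta `^ (2 * s); set rp := r `^ (- (2 * s)).
lra.
Qed.

(** * Duhamel's formula between two times *)

(** The measures of the semigroup form a kernel from times to the line, which is what
    Tonelli's theorem requires in Duhamel's formula. *)
Lemma measurable_semigroup_integral (R : realType) (s : R) (J : R -> R)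
    (mu : R -> probability (measurableTypeR R) R) d (X : measurableType d)
    (phi : X -> R) (h : X * measurableTypeR R -> \bar R) :
  kernel_hyp s J -> semigroup_measures J mu ->
  measurable_fun setT phi -> (forall x, 0 <= phi x) ->
  measurable_fun setT h -> (forall p, (0 <= h p)%E) ->
  measurable_fun setT (fun x => \int[mu (phi x)]_z h (x, z))%E.
Proof.
move=> [mJ J0 _ _] hmu mphi phi0 mh h0.
pose kap x : {measure set (measurableTypeR R) -> \bar R} := mu (phi x).
have mkap A : measurable A -> measurable_fun setT (fun x => kap x A).
  apply: measurable_fun_fourier_probability.
    under eq_fun do rewrite (semigroup_cos _ hmu (phi0 _)).
    apply: (measurableT_comp (@measurable_expR R)); apply: measurable_funM.
      exact: measurableT_comp.
    by apply: measurableT_comp => //; exact: measurable_symbol.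
  under eq_fun do rewrite (semigroup_sin _ hmu (phi0 _)).
  exact: measurable_cst.
pose H := isKernel.Build _ _ X (measurableTypeR R) R kap mkap.
pose k0 : R.-ker X ~> measurableTypeR R := HB.pack kap H.
have kT x : k0 x setT = 1%E by exact: probability_setT.
pose H1 := Kernel_isProbability.Build _ _ X (measurableTypeR R) R k0 kT.
pose k : R.-fker X ~> measurableTypeR R := HB.pack (Kernel.sort k0) H1.
exact: (measurable_fun_integral_finite_kernel h k h0 mh).
Qed.

(** The nonlinearity is only controlled on [[0, 1]]; composing it with this projection
    gives a Lipschitz function on the whole line. *)
Definition clamp01 (R : realType) (v : R) : R := Num.max 0 (Num.min v 1).

Lemma clamp01_id (R : realType) (v : R) : 0 <= v <= 1 -> clamp01 v = v.
Proof. by move=> /andP[v0 v1]; rewrite /clamp01 min_l// max_r. Qed.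

Lemma clamp01_itv (R : realType) (v : R) : 0 <= clamp01 v <= 1.
Proof. by rewrite /clamp01 le_max lexx/= ge_max ler01/= ge_min lexx orbT. Qed.

Lemma clamp01_lip (R : realType) (v w : R) : `|clamp01 v - clamp01 w| <= `|v - w|.
Proof.
wlog vw : v w / v <= w.
  by move=> H; case/orP: (le_total v w) => /H//; rewrite distrC [leRHS]distrC.
rewrite -[leRHS]normrN opprB -[leLHS]normrN opprB (@ger0_norm _ (w - v)) ?subr_ge0//.
rewrite ler_norml /clamp01.
have [v1|v1] := leP v 1; have [w1|w1] := leP w 1;
  rewrite ?(max_r (@ler01 R)); have [v0|v0] := leP 0 v; have [w0|w0] := leP 0 w; lra.
Qed.

Lemma ignition_lipschitz (R : realType) (theta : R) (f : R -> R) : ignition theta f ->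
  exists2 K : R, 0 < K & forall x y : R, 0 <= x <= 1 -> 0 <= y <= 1 ->
    `|f x - f y| <= K * `|x - y|.
Proof.
move=> [lf _ _ _].
have [K K0 hK] : exists2 K : R, 0 < K & K.-lipschitz_(`[0%R, 1%R]) f.
  by have [K [K0 hK]] := pinfty_ex_gt0 lf; exists K.
exists K => // x y x01 y01.
by apply: (hK (x, y)); split; rewrite /= in_itv.
Qed.

Lemma ignition_ge0 (R : realType) (theta : R) (f : R -> R) (v : R) : ignition theta f ->
  0 <= v <= 1 -> 0 <= f v.
Proof.
move=> [_ f1 f0 fp] /andP[v0 v1].
have [vt|vt] := leP v theta; first by rewrite f0// v0.
move: v1; rewrite le_eqVlt => /predU1P[->|v1]; first by rewrite f1.
by rewrite ltW// fp// vt.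
Qed.

Lemma lipschitz_continuous (R : realType) (g : R -> R) (K : R) :
  (forall x y, `|g x - g y| <= K * `|x - y|) -> continuous g.
Proof.
move=> gK x; apply/cvgrPdist_le => e e0.
have K0 : 0 < `|K| + 1 by rewrite ltr_wpDl.
near=> y; rewrite (le_trans (gK _ _))//.
rewrite (@le_trans _ _ ((`|K| + 1) * `|x - y|))//.
  by rewrite ler_wpM2r// (le_trans (ler_norm K))// lerDl.
rewrite -ler_pdivlMl//; near: y.
apply: cvgr_dist_le => //; by rewrite mulr_gt0// invr_gt0.
Unshelve. all: by end_near. Qed.

Lemma lipschitz_measurable (R : realType) (g : R -> R) (K : R) :
  (forall x y, `|g x - g y| <= K * `|x - y|) -> measurable_fun setT g.
Proof. by move=> gK; apply: continuous_measurable_fun; exact: lipschitz_continuous gK. Qed.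

(** The reaction term, extended by its initial value to negative times so as
    to be measurable on the whole plane. *)
Definition source (R : realType) (f : R -> R) (u : R -> R -> R) (p : R * R) : R :=
  f (clamp01 (u (Num.max p.1 0) p.2)).

Lemma measurable_source (R : realType) (theta : R) (f : R -> R) (u : R -> R -> R) :
  ignition theta f ->
  measurable_fun [set p : R * R | 0 <= p.1] (fun p : R * R => u p.1 p.2) ->
  measurable_fun setT (source f u).
Proof.
move=> hf mu; have [K K0 hK] := ignition_lipschitz hf.
have mfc : measurable_fun setT (fun v => f (clamp01 v)).
  apply: (@lipschitz_measurable _ _ K) => x y.
  by rewrite (le_trans (hK _ _ (clamp01_itv _) (clamp01_itv _)))// ler_wpM2l ?(ltW K0) ?clamp01_lip.
apply: (measurableT_comp mfc).
have mD : measurable [set p : R * R | 0 <= p.1].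
  rewrite -[X in measurable X]setTI.
  exact: (measurable_fun_ler (measurable_cst _) measurable_fst measurableT (Y := [set true])).
apply: (measurable_comp (f := fun p : R * R => u p.1 p.2) (g := fun p : R * R => (Num.max p.1 0, p.2)) mD) => //.
- by move=> _ [p _ <-] /=; rewrite le_max lexx orbT.
- apply: measurable_fun_pair => //=; exact: measurable_maxr.
Qed.

Lemma source_bounds (R : realType) (theta : R) (f : R -> R) (u : R -> R -> R) :
  ignition theta f -> 0 < theta -> exists2 K : R, 0 < K & forall p, 0 <= source f u p <= K.
Proof.
move=> hf t0; have [K K0 hK] := ignition_lipschitz hf; exists K => // p.
have h := clamp01_itv (u (Num.max p.1 0) p.2).
rewrite /source (ignition_ge0 hf)//=.
have [_ _ f0 _] := hf.
have h0 : 0 <= (0 : R) <= 1 by rewrite lexx ler01.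
have := hK _ 0 h h0; rewrite (f0 0) ?lexx ?(ltW t0)// !subr0 => /(le_trans (ler_norm _)) /le_trans; apply.
by rewrite ler_piMr ?(ltW K0)//; move/andP : h => [h1 h2]; rewrite ger0_norm.
Qed.

Lemma measurable_slab (R : realType) (D : set R)
    (k : measurableTypeR R * measurableTypeR R -> \bar R) : measurable D ->
  measurable_fun setT k -> (forall p, (0 <= k p)%E) ->
  measurable_fun setT (fun z => \int[lebesgue_measure]_(tau in D) k (tau, z))%E.
Proof.
move=> mD mk k0.
pose k' (p : measurableTypeR R * measurableTypeR R) : \bar R := ((\1_D p.1)%:E * k p)%E.
have mk' : measurable_fun setT k'.
  apply: emeasurable_funM => //; apply/measurable_EFinP.
  by apply: measurableT_comp => //; exact: measurable_indic.
have k'0 p : (0 <= k' p)%E by rewrite mule_ge0// lee_fin.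
rewrite (_ : (fun z => _) = (fun z => \int[lebesgue_measure]_tau k' (tau, z))%E).
  exact: (measurable_fun_fubini_tonelli_G k' mk' k'0).
apply/funext => z; rewrite integral_mkcond; apply: eq_integral => tau _.
by rewrite patchE /k'/= indicE; case: ifPn => _; rewrite ?mul1e ?mul0e.
Qed.

Lemma tonelli_slab (R : realType) (nu : probability (measurableTypeR R) R) (D : set R)
    (k : measurableTypeR R * measurableTypeR R -> \bar R) : measurable D ->
  measurable_fun setT k -> (forall p, (0 <= k p)%E) ->
  (\int[nu]_z \int[lebesgue_measure]_(tau in D) k (tau, z) =
   \int[lebesgue_measure]_(tau in D) \int[nu]_z k (tau, z))%E.
Proof.
move=> mD mk k0.
pose k' (p : measurableTypeR R * measurableTypeR R) : \bar R := ((\1_D p.1)%:E * k p)%E.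
have mk' : measurable_fun setT k'.
  apply: emeasurable_funM => //; apply/measurable_EFinP.
  by apply: measurableT_comp => //; exact: measurable_indic.
have k'0 p : (0 <= k' p)%E by rewrite mule_ge0// lee_fin.
transitivity (\int[nu]_z \int[lebesgue_measure]_tau k' (tau, z))%E.
  apply: eq_integral => z _; rewrite integral_mkcond; apply: eq_integral => tau _.
  by rewrite patchE /k'/= indicE; case: ifPn => _; rewrite ?mul1e ?mul0e.
transitivity (\int[lebesgue_measure]_tau \int[nu]_z k' (tau, z))%E; last first.
  rewrite [RHS]integral_mkcond; apply: eq_integral => tau _.
  rewrite patchE; case: ifPn => h.
    by apply: eq_integral => z _; rewrite /k'/= indicE h mul1e.
  by rewrite integral0_eq// => z _; rewrite /k'/= indicE (negbTE h) mul0e.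
exact/esym/(fubini_tonelli k' mk' k'0).
Qed.

Lemma measurable_reflect (R : realType) (g : R -> R) (x : R) : measurable_fun setT g ->
  measurable_fun setT (fun z : R => g (x - z)).
Proof. by move=> mg; apply: (measurableT_comp mg); exact: measurable_funB. Qed.

Lemma integral_bounded_le (R : realType) (nu : probability (measurableTypeR R) R) (g : R -> R) (M : R) :
  measurable_fun setT g -> (forall x, 0 <= g x <= M) ->
  (0 <= \int[nu]_z (g z)%:E <= M%:E)%E.
Proof.
move=> mg gM; apply/andP; split.
  by apply: integral_ge0 => z _; rewrite lee_fin; have /andP[] := gM z.
rewrite -[leRHS](_ : (\int[nu]_z cst M%:E z = M%:E)%E); last first.
  by rewrite integral_cst//= probability_setT mule1.
apply: ge0_le_integral => //=.
- by move=> z _; rewrite lee_fin; have /andP[] := gM z.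
- exact/measurable_EFinP.
- by move=> z _; rewrite lee_fin; have /andP[] := gM z.
Qed.

Lemma semigroupE (R : realType) (mu : R -> probability (measurableTypeR R) R) (t : R) (g : R -> R)
    (M x : R) : measurable_fun setT g -> (forall x, 0 <= g x <= M) ->
  ((semigroup mu t g x)%:E = \int[mu t]_z (g (x - z))%:E)%E.
Proof.
move=> mg gM; rewrite /semigroup /Rintegral fineK//.
have /andP[h0 h1] := @integral_bounded_le R (mu t) (fun z => g (x - z)) M (measurable_reflect x mg) (fun z => gM _).
by rewrite ge0_fin_numE// (le_lt_trans h1)// ltry.
Qed.

(** The contribution of the time [tau] to Duhamel's formula at time [t]. The elapsed
    time is clamped to be nonnegative, which makes this jointly measurable in [tau]
    and [x] over the whole plane. *)
Definition inflow (R : realType) (mu : R -> probability (measurableTypeR R) R) (f : R -> R)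
    (u : R -> R -> R) (t x tau : R) : \bar R :=
  (\int[mu (Num.max (t - tau) 0)%R]_z (source f u (tau, x - z))%:E)%E.

Lemma measurable_inflow (R : realType) (s : R) (J : R -> R)
    (mu : R -> probability (measurableTypeR R) R) (theta : R) (f : R -> R) (u : R -> R -> R) (t : R) :
  kernel_hyp s J -> semigroup_measures J mu -> ignition theta f -> 0 < theta ->
  measurable_fun setT (source f u) ->
  measurable_fun setT (fun p : R * R => inflow mu f u t p.2 p.1).
Proof.
move=> hJ hmu hf th ms.
pose phi (p : R * R) := Num.max (t - p.1) 0.
pose h (q : (R * R) * measurableTypeR R) : \bar R := (source f u (q.1.1, q.1.2 - q.2))%:E.
apply: (measurable_semigroup_integral (phi := phi) (h := h) hJ hmu).
- by apply: measurable_maxr => //; exact: measurable_funB.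
- by move=> p; rewrite le_max lexx orbT.
- apply/measurable_EFinP; apply: (measurableT_comp ms); apply: measurable_fun_pair.
    exact: measurableT_comp.
  by apply: measurable_funB => //; exact: measurableT_comp.
- by move=> q; rewrite lee_fin; have [K K0 hK] := source_bounds u hf th; have /andP[] := hK (q.1.1, q.1.2 - q.2).
Qed.

Lemma measurable_inflow_time (R : realType) (s : R) (J : R -> R)
    (mu : R -> probability (measurableTypeR R) R) (theta : R) (f : R -> R) (u : R -> R -> R) (t x : R) :
  kernel_hyp s J -> semigroup_measures J mu -> ignition theta f -> 0 < theta ->
  measurable_fun setT (source f u) -> measurable_fun setT (inflow mu f u t x).
Proof.
move=> hJ hmu hf th ms.
rewrite (_ : inflow mu f u t x = (fun p : R * R => inflow mu f u t p.2 p.1) \o (fun tau => (tau, x)))//.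
by apply: measurableT_comp; [exact: measurable_inflow hJ hmu hf th ms|exact: measurable_fun_pair].
Qed.

Lemma inflow_bounds (R : realType) (mu : R -> probability (measurableTypeR R) R) (theta : R)
    (f : R -> R) (u : R -> R -> R) :
  ignition theta f -> 0 < theta -> measurable_fun setT (source f u) ->
  exists2 K : R, 0 < K & forall t x tau : R, (0 <= inflow mu f u t x tau <= K%:E)%E.
Proof.
move=> hf th ms; have [K K0 hK] := source_bounds u hf th.
exists K => // t x tau; apply: (@integral_bounded_le _ _ (fun z => source f u (tau, x - z))) => //.
apply: (measurableT_comp ms); apply: measurable_fun_pair => //.
exact: measurable_funB.
Qed.

Lemma sourceE (R : realType) (mu : R -> probability (measurableTypeR R) R) (f u0 : R -> R)
    (u : R -> R -> R) (tau x : R) : mild_solution mu f u0 u -> 0 <= tau ->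
  source f u (tau, x) = f (u tau x).
Proof. by move=> [_ u01 _] t0; rewrite /source /= max_l// clamp01_id ?u01. Qed.

Lemma semigroup_source (R : realType) (mu : R -> probability (measurableTypeR R) R) (theta : R)
    (f u0 : R -> R) (u : R -> R -> R) (t tau x : R) :
  ignition theta f -> 0 < theta -> mild_solution mu f u0 u -> 0 <= tau -> tau <= t ->
  ((semigroup mu (t - tau) (fun y => f (u tau y)) x)%:E = inflow mu f u t x tau)%E.
Proof.
move=> hf th hu t0 tt; have [mu1 _ _] := hu.
have ms := measurable_source hf mu1.
have [K K0 hK] := source_bounds u hf th.
rewrite (_ : (fun y => f (u tau y)) = fun y => source f u (tau, y)); last first.
  by apply/funext => y; rewrite (sourceE _ hu).
rewrite (@semigroupE _ _ _ _ K)//.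
- by rewrite /inflow max_l// subr_ge0.
- by apply: (measurableT_comp ms); exact: measurable_fun_pair.
Qed.

Lemma mild_ereal (R : realType) (s : R) (J : R -> R)
    (mu : R -> probability (measurableTypeR R) R) (theta : R) (f u0 : R -> R)
    (u : R -> R -> R) (t x : R) :
  kernel_hyp s J -> semigroup_measures J mu -> ignition theta f -> 0 < theta ->
  measurable_fun setT u0 -> (forall x, 0 <= u0 x <= 1) -> mild_solution mu f u0 u -> 0 <= t ->
  ((u t x)%:E = \int[mu t]_z (u0 (x - z))%:E +
     \int[lebesgue_measure]_(tau in `[0%R, t]) inflow mu f u t x tau)%E.
Proof.
move=> hJ hmu hf th mu0 u01 hu t0; have [mu1 _ hmild] := hu.
have ms := measurable_source hf mu1.
rewrite (hmild t x t0) EFinD (@semigroupE _ _ _ _ 1 _ mu0 u01); congr (_ + _)%E.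
have [K K0 hK] := inflow_bounds mu hf th ms.
have e : (\int[lebesgue_measure]_(tau in `[0%R, t]) (semigroup mu (t - tau) (fun y => f (u tau y)) x)%:E =
    \int[lebesgue_measure]_(tau in `[0%R, t]) inflow mu f u t x tau)%E.
  apply: eq_integral => tau; rewrite inE/= in_itv/= => /andP[tau0 taut].
  exact: (semigroup_source x hf th hu tau0 taut).
rewrite /Rintegral e fineK// ge0_fin_numE; last first.
  by apply: integral_ge0 => tau _; have /andP[] := hK t x tau.
apply: (@le_lt_trans _ _ (\int[lebesgue_measure]_(tau in `[0%R, t]) cst K%:E (tau : R))%E).
  apply: ge0_le_integral => //=.
  - by move=> tau _; have /andP[] := hK t x tau.
  - by apply: measurable_funTS; exact: (measurable_inflow_time t x hJ hmu hf th ms).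
  - by move=> tau _; have /andP[] := hK t x tau.
by rewrite integral_cst//= lebesgue_measure_itv/=; case: ifP => _; rewrite -?EFinD -?EFinM ?mule0 ltry.
Qed.

(** Convolving for a further time [h] only lengthens the time elapsed since [tau]. *)
Lemma semigroup_inflow (R : realType) (s : R) (J : R -> R)
    (mu : R -> probability (measurableTypeR R) R) (theta : R) (f : R -> R) (u : R -> R -> R)
    (t h x tau : R) :
  kernel_hyp s J -> semigroup_measures J mu -> ignition theta f -> 0 < theta ->
  measurable_fun setT (source f u) -> 0 <= h -> tau <= t ->
  (\int[mu h]_z inflow mu f u t (x - z)%R tau = inflow mu f u (h + t)%R x tau)%E.
Proof.
move=> hJ hmu hf th ms h0 tt.
have [K K0 hK] := source_bounds u hf th.
have d0 : 0 <= t - tau by rewrite subr_ge0.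
rewrite /inflow [X in (_ = \int[mu X]_z _)%E]max_l; last by rewrite -addrA addr_ge0.
rewrite -addrA (semigroup_conv (g := fun w => (source f u (tau, x - w))%:E) hmu h0 d0).
- apply: eq_integral => z _; rewrite max_l//; apply: eq_integral => y _.
  by rewrite opprD addrA.
- apply/measurable_EFinP; apply: (measurableT_comp ms); apply: measurable_fun_pair => //.
  exact: measurable_funB.
- by move=> y; rewrite lee_fin; have /andP[] := hK (tau, x - y).
Qed.

(** Applying the linear flow for the time [t' - t] to Duhamel's formula at time [t]
    yields the formula at time [t'] with the sources after [t] missing, by the
    semigroup property. *)
Lemma mild_restart (R : realType) (s : R) (J : R -> R)
    (mu : R -> probability (measurableTypeR R) R) (theta : R) (f u0 : R -> R)
    (u : R -> R -> R) (t t' x : R) :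
  kernel_hyp s J -> semigroup_measures J mu -> ignition theta f -> 0 < theta ->
  measurable_fun setT u0 -> (forall x, 0 <= u0 x <= 1) -> mild_solution mu f u0 u ->
  0 <= t -> t <= t' ->
  ((u t' x)%:E = \int[mu (t' - t)%R]_z (u t (x - z))%:E +
     \int[lebesgue_measure]_(tau in `]t, t']) inflow mu f u t' x tau)%E.
Proof.
move=> hJ hmu hf th mu0 u01 hu t0 tt'; have [mu1 _ hmild] := hu.
have ms := measurable_source hf mu1.
have [K K0 hK] := inflow_bounds mu hf th ms.
have t'0 : 0 <= t' by exact: le_trans tt'.
have h0 : 0 <= t' - t by rewrite subr_ge0.
have i0 t1 y tau : (0 <= inflow mu f u t1 y tau)%E by have /andP[] := hK t1 y tau.
have mIt := measurable_inflow_time t' x hJ hmu hf th ms.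
pose A (p : measurableTypeR R * measurableTypeR R) : \bar R := (u0 (x - p.1 - p.2))%:E.
have mA : measurable_fun setT A.
  apply/measurable_EFinP; apply: (measurableT_comp mu0).
  by apply: measurable_funB => //; exact: measurable_funB.
have A0 p : (0 <= A p)%E by rewrite lee_fin; have /andP[] := u01 (x - p.1 - p.2).
pose B (p : measurableTypeR R * measurableTypeR R) : \bar R := inflow mu f u t (x - p.2) p.1.
have mB : measurable_fun setT B.
  rewrite (_ : B = (fun p : R * R => inflow mu f u t p.2 p.1) \o (fun p => (p.1, x - p.2)))//.
  apply: measurableT_comp; first exact: measurable_inflow hJ hmu hf th ms.
  by apply: measurable_fun_pair => //; exact: measurable_funB.
have B0 p : (0 <= B p)%E by exact: i0.
have -> : (\int[mu (t' - t)%R]_z (u t (x - z))%:E =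
    \int[mu (t' - t)%R]_z (\int[mu t]_y A (z, y) +
       \int[lebesgue_measure]_(tau in `[0%R, t]) B (tau, z)))%E.
  apply: eq_integral => z _.
  by rewrite (mild_ereal (x - z) hJ hmu hf th mu0 u01 hu t0).
rewrite ge0_integralD//=; last 4 first.
- by move=> z _; exact: integral_ge0.
- exact: (measurable_fun_fubini_tonelli_F A mA A0).
- by move=> z _; exact: integral_ge0.
- exact: measurable_slab.
have -> : (\int[mu (t' - t)%R]_z \int[mu t]_y A (z, y) = \int[mu t']_w (u0 (x - w))%:E)%E.
  rewrite -[in RHS](subrK t t') (semigroup_conv (g := fun w => (u0 (x - w))%:E) hmu h0 t0).
  - by apply: eq_integral => z _; apply: eq_integral => y _; rewrite /A/= opprD addrA.
  - by apply/measurable_EFinP; exact: measurable_reflect.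
  - by move=> y; rewrite lee_fin; have /andP[] := u01 (x - y).
rewrite tonelli_slab// /B/=.
rewrite (mild_ereal x hJ hmu hf th mu0 u01 hu t'0) -[RHS]addeA; congr (_ + _)%E.
have e : (\int[lebesgue_measure]_(tau in `[0%R, t])
      \int[mu (t' - t)%R]_z inflow mu f u t (x - z)%R tau =
    \int[lebesgue_measure]_(tau in `[0%R, t]) inflow mu f u t' x tau)%E.
  apply: eq_integral => tau; rewrite inE/= in_itv/= => /andP[_ taut].
  by rewrite (semigroup_inflow x hJ hmu hf th ms h0 taut) subrK.
have -> : [set` `[0%R, t']] = [set` `[0%R, t]] `|` [set` `]t, t']].
  by rewrite -itv_bndbnd_setU// bnd_simp.
rewrite e; apply: ge0_integral_setU.
- exact: measurable_itv.
- exact: measurable_itv.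
- exact: measurable_funTS.
- by move=> tau _; exact: i0.
- apply/disj_setPS => y []/=; rewrite !in_itv/= => /andP[_ y0] /andP[+ _].
  by rewrite ltNge y0.
Qed.

(** * Bounded functions under the linear flow *)

Definition bounded_measurable (R : realType) (g : R -> R) : Prop :=
  measurable_fun setT g /\ exists M : R, forall x, `|g x| <= M.

Lemma bounded_measurable01 (R : realType) (g : R -> R) : measurable_fun setT g ->
  (forall x, 0 <= g x <= 1) -> bounded_measurable g.
Proof.
move=> mg g01; split => //; exists 1 => x; have /andP[h0 h1] := g01 x.
by rewrite ger0_norm.
Qed.

Lemma bounded_measurableD (R : realType) (g h : R -> R) :
  bounded_measurable g -> bounded_measurable h -> bounded_measurable (fun x => g x + h x).
Proof.
move=> [mg [M gM]] [mh [N hN]]; split; first exact: measurable_funD.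
by exists (M + N) => x; rewrite (le_trans (ler_normD _ _))// lerD.
Qed.

Lemma bounded_measurableZ (R : realType) (c : R) (g : R -> R) :
  bounded_measurable g -> bounded_measurable (fun x => c * g x).
Proof.
move=> [mg [M gM]]; split; first exact: measurable_funM.
by exists (`|c| * M) => x; rewrite normrM ler_wpM2l.
Qed.

Lemma bounded_measurable_cst (R : realType) (c : R) : bounded_measurable (fun _ : R => c).
Proof. by split; [exact: measurable_cst|exists `|c|]. Qed.

Lemma bounded_measurableB (R : realType) (g h : R -> R) :
  bounded_measurable g -> bounded_measurable h -> bounded_measurable (fun x => g x - h x).
Proof.
move=> bg bh; have := bounded_measurableD bg (bounded_measurableZ (-1) bh).
by under eq_fun do rewrite mulN1r.
Qed.

Lemma bounded_measurable_reflect (R : realType) (g : R -> R) (x : R) :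
  bounded_measurable g -> bounded_measurable (fun z => g (x - z)).
Proof.
by move=> [mg [M gM]]; split; [exact: measurable_reflect|exists M => z; exact: gM].
Qed.

Lemma bounded_measurable_integrable (R : realType) (nu : probability (measurableTypeR R) R)
    (g : R -> R) : bounded_measurable g -> nu.-integrable setT (EFin \o g).
Proof. by move=> [mg [M gM]]; exact: (@bounded_integrable _ _ _ nu g M). Qed.

Section semigroup_calculus.
Context {R : realType} (mu : R -> probability (measurableTypeR R) R).
Implicit Types (g h : R -> R) (t x : R).

Lemma semigroup_integrable g t x : bounded_measurable g ->
  (mu t).-integrable setT (EFin \o (fun z : R => g (x - z))).
Proof. by move=> bg; apply: bounded_measurable_integrable; exact: bounded_measurable_reflect. Qed.

Lemma semigroup_le g h t x : bounded_measurable g -> bounded_measurable h ->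
  (forall y, g y <= h y) -> semigroup mu t g x <= semigroup mu t h x.
Proof.
move=> bg bh gh; apply: le_Rintegral => //.
- exact: semigroup_integrable.
- exact: semigroup_integrable.
Qed.

Lemma semigroup_cst (c : R) t x : semigroup mu t (fun=> c) x = c.
Proof. by rewrite /semigroup Rintegral_cst//= probability_setT/= mulr1. Qed.

Lemma semigroupD g h t x : bounded_measurable g -> bounded_measurable h ->
  semigroup mu t (fun y => g y + h y) x = semigroup mu t g x + semigroup mu t h x.
Proof. by move=> bg bh; rewrite /semigroup RintegralD//; exact: semigroup_integrable. Qed.

Lemma semigroupB g h t x : bounded_measurable g -> bounded_measurable h ->
  semigroup mu t (fun y => g y - h y) x = semigroup mu t g x - semigroup mu t h x.
Proof. by move=> bg bh; rewrite /semigroup RintegralB//; exact: semigroup_integrable. Qed.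

Lemma semigroupZ (c : R) g t x : bounded_measurable g ->
  semigroup mu t (fun y => c * g y) x = c * semigroup mu t g x.
Proof. by move=> bg; rewrite /semigroup RintegralZl//; exact: semigroup_integrable. Qed.

Lemma semigroup_shift g t x (a : R) :
  semigroup mu t (fun y => g (y - a)) x = semigroup mu t g (x - a).
Proof. by rewrite /semigroup; apply: eq_Rintegral => z _; rewrite addrAC. Qed.

Lemma semigroup_itv g t x (a b : R) : bounded_measurable g -> (forall y, a <= g y <= b) ->
  a <= semigroup mu t g x <= b.
Proof.
move=> bg gab; rewrite -{1}(semigroup_cst a t x) -{1}(semigroup_cst b t x).
apply/andP; split; apply: semigroup_le => //; try exact: bounded_measurable_cst.
  by move=> y; have /andP[] := gab y.
by move=> y; have /andP[] := gab y.
Qed.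

Lemma bounded_measurable_semigroup g t : measurable_fun setT g -> (forall y, 0 <= g y <= 1) ->
  bounded_measurable (semigroup mu t g).
Proof.
move=> mg g01; apply: bounded_measurable01; last first.
  by move=> x; apply: semigroup_itv => //; exact: bounded_measurable01.
pose k (p : R * measurableTypeR R) : \bar R := (g (p.1 - p.2))%:E.
have mk : measurable_fun setT k.
  by apply/measurable_EFinP; apply: (measurableT_comp mg); exact: measurable_funB.
have k0 p : (0 <= k p)%E by rewrite lee_fin; have /andP[] := g01 (p.1 - p.2).
apply: (measurableT_comp (fine_measurable _)) => //.
exact: (measurable_fun_fubini_tonelli_F k mk k0).
Qed.

Lemma semigroup_comp (J : R -> R) g t s x : semigroup_measures J mu -> 0 <= t -> 0 <= s ->
  measurable_fun setT g -> (forall y, 0 <= g y <= 1) ->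
  semigroup mu t (semigroup mu s g) x = semigroup mu (t + s) g x.
Proof.
move=> hmu t0 s0 mg g01; apply: EFin_inj.
have [mP [M PM]] := bounded_measurable_semigroup s mg g01.
have P01 y : 0 <= semigroup mu s g y <= 1.
  by apply: semigroup_itv => //; exact: bounded_measurable01.
rewrite (@semigroupE _ _ _ _ 1 _ mP P01) (@semigroupE _ _ _ _ 1 _ mg g01).
rewrite (semigroup_conv (g := fun w => (g (x - w))%:E) hmu t0 s0).
- apply: eq_integral => z _; rewrite (@semigroupE _ _ _ _ 1 _ mg g01).
  by apply: eq_integral => y _; rewrite opprD addrA.
- by apply/measurable_EFinP; exact: measurable_reflect.
- by move=> y; rewrite lee_fin; have /andP[] := g01 (x - y).
Qed.

End semigroup_calculus.

(** * Comparison over one time step *)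

(** The hypotheses of the Cauchy problem, bundled so as to be passed to the
    comparison lemmas as a single argument. *)
Record cauchy_data (R : realType) (s theta : R) (J f : R -> R)
    (mu : R -> probability (measurableTypeR R) R) (u : R -> R -> R) : Prop := CauchyData {
  cd_s : 0 < s < 1 / 2 ;
  cd_kernel : kernel_hyp s J ;
  cd_theta : 0 < theta < 1 ;
  cd_ignition : ignition theta f ;
  cd_semigroup : semigroup_measures J mu ;
  cd_mild : mild_solution mu f (\1_(`]-oo, 0]) : R -> R) u ;
  cd_front : forall t : R, 0 <= t -> front_profile (u t) }.

Section steps.
Context {R : realType} {s theta : R} {J f : R -> R}
  {mu : R -> probability (measurableTypeR R) R} {u : R -> R -> R}.
Context (cd : cauchy_data s theta J f mu u).

Lemma theta_gt0 : 0 < theta. Proof. by have /andP[] := cd_theta cd. Qed.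

Lemma solution_itv (t x : R) : 0 <= t -> 0 <= u t x <= 1.
Proof. by have [_ + _] := cd_mild cd; apply. Qed.

Lemma measurable_solution (t : R) : 0 <= t -> measurable_fun setT (u t).
Proof.
move=> t0; have [mon _ _] := cd_front cd t0.
apply: nonincreasing_measurable => // x y _ _; exact: mon.
Qed.

Lemma bounded_solution (t : R) : 0 <= t -> bounded_measurable (u t).
Proof.
move=> t0; apply: bounded_measurable01; first exact: measurable_solution.
by move=> x; exact: solution_itv.
Qed.

Lemma bounded_reaction (g : R -> R) : measurable_fun setT g -> (forall x, 0 <= g x <= 1) ->
  bounded_measurable (f \o g).
Proof.
move=> mg g01; have [K K0 hK] := ignition_lipschitz (cd_ignition cd).
have -> : f \o g = (f \o @clamp01 R) \o g.
  by apply/funext => x; rewrite /= clamp01_id.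
split.
  apply: (measurableT_comp _ mg); apply: (@lipschitz_measurable _ _ K) => x y /=.
  by rewrite (le_trans (hK _ _ (clamp01_itv _) (clamp01_itv _)))// ler_wpM2l ?(ltW K0) ?clamp01_lip.
have z01 : 0 <= (0 : R) <= 1 by rewrite lexx ler01.
exists (`|f 0| + K) => x; rewrite /= clamp01_id//.
rewrite -[f (g x)](subrKC (f 0)) (le_trans (ler_normD _ _))// lerD2l.
rewrite (le_trans (hK _ _ (g01 x) z01))// subr0 ler_piMr ?(ltW K0)//.
by have /andP[h0 h1] := g01 x; rewrite ger0_norm.
Qed.

Lemma solution_restart (t t' x : R) : 0 <= t -> t <= t' ->
  ((u t' x)%:E = (semigroup mu (t' - t) (u t) x)%:E +
    \int[lebesgue_measure]_(tau in `]t, t']) inflow mu f u t' x tau)%E.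
Proof.
move=> t0 tt'.
rewrite (@semigroupE _ _ _ _ 1 _ (measurable_solution t0)); last by move=> y; exact: solution_itv.
apply: (mild_restart x (cd_kernel cd) (cd_semigroup cd) (cd_ignition cd) theta_gt0 _ _ (cd_mild cd) t0 tt').
  by apply: measurable_indic.
by move=> y; rewrite indicE; case: (_ \in _); rewrite /= ?lexx ?ler01.
Qed.

Lemma integral_slab_cst (a b c : R) : a <= b ->
  (\int[lebesgue_measure]_(tau in `]a, b]) (cst c%:E (tau : R)) = ((b - a) * c)%:E)%E.
Proof.
move=> ab; rewrite integral_cst//= lebesgue_measure_itv/= lte_fin.
case: ltP => h; first by rewrite -EFinD -EFinM mulrC.
by rewrite mule0; have -> : a = b; [lra|rewrite subrr mul0r].
Qed.

Lemma inflowE (t tau x : R) : 0 <= tau -> tau <= t ->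
  inflow mu f u t x tau = (semigroup mu (t - tau) (f \o u tau) x)%:E.
Proof.
by move=> t0 tt; rewrite -(semigroup_source x (cd_ignition cd) theta_gt0 (cd_mild cd) t0 tt).
Qed.

Lemma measurable_solution_inflow t x : measurable_fun setT (inflow mu f u t x).
Proof.
apply: (measurable_inflow_time t x (cd_kernel cd) (cd_semigroup cd) (cd_ignition cd) theta_gt0).
by have [mu1 _ _] := cd_mild cd; exact: measurable_source (cd_ignition cd) mu1.
Qed.

Lemma inflow_ge0 t x tau : (0 <= inflow mu f u t x tau)%E.
Proof.
apply: integral_ge0 => z _; rewrite lee_fin.
by have [K _ hK] := source_bounds u (cd_ignition cd) theta_gt0; have /andP[] := hK (tau, x - z).
Qed.

Lemma solution_ge (t t' x c : R) : 0 <= t -> t <= t' -> 0 <= c ->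
  (forall tau : R, t < tau -> tau <= t' -> c <= semigroup mu (t' - tau) (f \o u tau) x) ->
  semigroup mu (t' - t) (u t) x + (t' - t) * c <= u t' x.
Proof.
move=> t0 tt' c0 hc; rewrite -lee_fin (solution_restart x t0 tt') EFinD leeD2l//.
rewrite -integral_slab_cst//; apply: ge0_le_integral => //=.
- by apply: measurable_funTS; exact: measurable_solution_inflow.
- move=> tau; rewrite in_itv/= => /andP[h1 h2].
  by rewrite inflowE ?lee_fin ?hc// (le_trans t0)// ltW.
Qed.

Lemma solution_le (t t' x c : R) : 0 <= t -> t <= t' -> 
  (forall tau : R, t < tau -> tau <= t' -> semigroup mu (t' - tau) (f \o u tau) x <= c) ->
  u t' x <= semigroup mu (t' - t) (u t) x + (t' - t) * c.
Proof.
move=> t0 tt' hc; rewrite -lee_fin (solution_restart x t0 tt') EFinD leeD2l//.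
rewrite -integral_slab_cst//; apply: ge0_le_integral => //=.
- by move=> tau _; exact: inflow_ge0.
- by apply: measurable_funTS; exact: measurable_solution_inflow.
- move=> tau; rewrite in_itv/= => /andP[h1 h2].
  by rewrite inflowE ?lee_fin ?hc// (le_trans t0)// ltW.
Qed.

(** The nonlinearity is nonnegative, so the solution is above the linear flow. *)
Lemma semigroup_le_solution (t t' x : R) : 0 <= t -> t <= t' ->
  semigroup mu (t' - t) (u t) x <= u t' x.
Proof.
move=> t0 tt'; have := @solution_ge t t' x 0 t0 tt' (lexx 0); rewrite mulr0 addr0; apply.
move=> tau h1 h2; have tau0 : 0 <= tau by rewrite (le_trans t0)// ltW.
by rewrite -lee_fin -inflowE// inflow_ge0.
Qed.

(** One time step from below: the reaction may be evaluated along the linear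
    flow [semigroup mu (r - t) w] of the lower datum, at the price of the
    factor [1 + K (t' - t)], because [f v + K v] is nondecreasing. *)
Lemma lower_step (K : R) (w : R -> R) (t t' x c : R) : 0 <= K ->
  (forall v v' : R, 0 <= v <= 1 -> 0 <= v' <= 1 -> `|f v - f v'| <= K * `|v - v'|) ->
  measurable_fun setT w -> (forall y, 0 <= w y <= 1) ->
  0 <= t -> t <= t' -> (forall y, w y <= u t y) ->
  (forall r : R, t <= r -> r <= t' -> c <= semigroup mu (t' - r) (f \o semigroup mu (r - t) w) x) ->
  (t' - t) * c <= (1 + K * (t' - t)) * (u t' x - semigroup mu (t' - t) w x).
Proof.
move=> K0 fK mw w01 t0 tt' wu hc.
have t'0 : 0 <= t' by exact: le_trans tt'.
have bw := bounded_measurable01 mw w01.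
set D := u t' x - semigroup mu (t' - t) w x.
have D0 : 0 <= D.
  rewrite subr_ge0 (le_trans _ (semigroup_le_solution x t0 tt'))// semigroup_le//.
  exact: bounded_solution.
have key : forall r, t < r -> r <= t' -> Num.max 0 (c - K * D) <= semigroup mu (t' - r) (f \o u r) x.
  move=> r /ltW tr rt'; have r0 : 0 <= r by exact: le_trans tr.
  have d0 : 0 <= t' - r by rewrite subr_ge0.
  have e0 : 0 <= r - t by rewrite subr_ge0.
  pose B := semigroup mu (r - t) w.
  have B01 y : 0 <= B y <= 1 by exact: semigroup_itv.
  have bB : bounded_measurable B by exact: bounded_measurable_semigroup.
  have bu := bounded_solution r0.
  have bfB : bounded_measurable (f \o B) by apply: bounded_reaction; [case: bB|].
  have bfu : bounded_measurable (f \o u r).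
    by apply: bounded_reaction => [|y]; [exact: measurable_solution|exact: solution_itv].
  have Bu y : B y <= u r y.
    rewrite (le_trans _ (semigroup_le_solution y t0 tr))// semigroup_le//.
    exact: bounded_solution.
  rewrite ge_max; apply/andP; split.
    have [h1 _] : (0 <= semigroup mu (t' - r) (f \o u r) x) /\ True.
      by rewrite -lee_fin -inflowE// inflow_ge0.
    exact: h1.
  have h1 : semigroup mu (t' - r) (fun y => (f \o B) y - K * (u r y - B y)) x <=
      semigroup mu (t' - r) (f \o u r) x.
    apply: semigroup_le => //.
      by apply: bounded_measurableB => //; apply: bounded_measurableZ; exact: bounded_measurableB.
    move=> y; have := fK _ _ (B01 y) (solution_itv y r0).
    rewrite [X in K * X]distrC (@ger0_norm _ (u r y - B y)) ?subr_ge0//.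
    by rewrite ler_norml => /andP[_ h2]; rewrite /=; lra.
  apply: le_trans h1; rewrite semigroupB//; last first.
    by apply: bounded_measurableZ; exact: bounded_measurableB.
  rewrite semigroupZ ?semigroupB//; last exact: bounded_measurableB.
  rewrite lerB ?hc// ler_wpM2l// /D lerB ?semigroup_le_solution//.
  rewrite /B (semigroup_comp x (cd_semigroup cd) d0 e0 mw w01).
  by rewrite addrA subrK.
have DE : D = u t' x - semigroup mu (t' - t) w x by [].
have m0 : 0 <= Num.max 0 (c - K * D) by rewrite le_max lexx.
have h := solution_ge t0 tt' m0 key.
have h2 : semigroup mu (t' - t) w x <= semigroup mu (t' - t) (u t) x.
  by apply: semigroup_le => //; exact: bounded_solution.
have h3 : (t' - t) * (c - K * D) <= (t' - t) * Num.max 0 (c - K * D).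
  by rewrite ler_wpM2l ?subr_ge0// le_max lexx orbT.
have h4 : (t' - t) * (c - K * D) <= D.
  by apply: (le_trans h3); rewrite DE lerBrDr -DE; lra.
by move: h4; generalize D => D' h4; lra.
Qed.

(** One time step from above, for the nondecreasing majorant [K (v - theta1)+]
    of the reaction. Where [W >= 1] there is nothing to prove, so the
    inequality is only asked where [W < 1]. The excess of the solution over
    [W] is at most half of any of its upper bounds, hence nonpositive. *)
Lemma upper_step (K theta1 h : R) (W0 W c : R -> R) (t : R) : 0 <= K ->
  (forall v v' : R, 0 <= v <= 1 -> 0 <= v' <= 1 -> `|f v - f v'| <= K * `|v - v'|) ->
  0 <= theta1 <= theta -> 0 <= h -> h * K <= 1 / 2 ->
  bounded_measurable W0 -> bounded_measurable W -> (forall y, 0 <= W y) ->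
  0 <= t -> (forall y, u t y <= W0 y) ->
  (forall x, 0 <= c x) ->
  (forall x sig : R, 0 <= sig <= h -> W x < 1 ->
     semigroup mu sig (fun y => K * Num.max 0 (W y - theta1)) x <= c x) ->
  (forall x sig : R, 0 <= sig <= h -> W x < 1 ->
     semigroup mu sig W0 x + h * c x <= W x) ->
  forall sig x : R, 0 <= sig <= h -> u (t + sig) x <= W x.
Proof.
move=> K0 fK /andP[th10 th1] h0 hK bW0 bW W_ge0 t0 uW0 c0 hc hW.
have [mW _] := bW.
have fle v : 0 <= v <= 1 -> f v <= K * Num.max 0 (v - theta1).
  move=> v01; have [_ _ f0 _] := cd_ignition cd.
  have [vt|vt] := leP v theta1.
    rewrite f0 ?mulr_ge0// ?le_max ?lexx//; move/andP : v01 => [-> _]/=.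
    exact: le_trans th1.
  have th01 : 0 <= theta1 <= 1.
    by rewrite th10/= (le_trans th1)//; have /andP[_ /ltW] := cd_theta cd.
  have := fK _ _ v01 th01; rewrite (f0 theta1) ?th10// subr0 => /(le_trans (ler_norm _)).
  move=> /le_trans; apply; rewrite ger0_norm ?subr_ge0 ?(ltW vt)// ler_wpM2l//.
  by rewrite le_max lexx orbT.
have bG : bounded_measurable (fun y => K * Num.max 0 (W y - theta1)).
  apply: bounded_measurableZ; have [_ [M hM]] := bW; split.
    by apply: measurable_maxr => //; exact: measurable_funB.
  exists (M + theta1) => y; rewrite ger0_norm ?le_max ?lexx// ge_max.
  have := hM y; rewrite ler_norml => /andP[hl hr].
  by apply/andP; split; lra.
have improve S : 0 <= S -> (forall sig x : R, 0 <= sig <= h -> u (t + sig) x <= W x + S) ->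
    forall sig x : R, 0 <= sig <= h -> u (t + sig) x <= W x + S / 2.
  move=> S0 hS sig x sigh; have /andP[sig0 sig1] := sigh.
  have ts0 : 0 <= t + sig by rewrite addr_ge0.
  have [W1|W1] := leP 1 (W x).
    by have /andP[_ u1] := solution_itv x ts0; rewrite (le_trans u1)// (le_trans W1)// lerDl divr_ge0.
  have tts : t <= t + sig by rewrite lerDl.
  have := @solution_le t (t + sig) x (c x + K * S) t0 tts.
  rewrite [t + sig - t]addrAC subrr add0r => /(_ _)/le_trans; apply; first last.
    have h1 : semigroup mu sig (u t) x <= semigroup mu sig W0 x.
      by apply: semigroup_le => //; exact: bounded_solution.
    have h2 := hW x sig sigh W1.
    have h3 : sig * (c x + K * S) <= h * (c x + K * S).
      by rewrite ler_wpM2r// addr_ge0// mulr_ge0.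
    have h4 : h * (K * S) <= 1 / 2 * S by rewrite mulrA ler_wpM2r.
    rewrite mulrDr in h3; lra.
  move=> tau t1 t2; have tau0 : 0 <= tau by rewrite (le_trans t0)// ltW.
  have d1 : 0 <= tau - t <= h by rewrite subr_ge0 (ltW t1)/= lerBlDl (le_trans t2)// lerD2l.
  have d2 : 0 <= t + sig - tau <= h.
    rewrite subr_ge0 t2/= lerBlDr [leRHS]addrC lerD//; exact: ltW.
  apply: (@le_trans _ _ (semigroup mu (t + sig - tau) (fun y => K * Num.max 0 (W y - theta1) + K * S) x)).
    apply: semigroup_le.
    - by apply: bounded_reaction => [|y]; [exact: measurable_solution|exact: solution_itv].
    - by apply: bounded_measurableD => //; exact: bounded_measurable_cst.
    - move=> y; rewrite (le_trans (fle _ (solution_itv y tau0)))// -mulrDr ler_wpM2l//.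
      have := hS (tau - t) y d1; rewrite subrKC => hu.
      by case: (lerP 0 (u tau y - theta1)) => g1; case: (lerP 0 (W y - theta1)) => g2; lra.
  rewrite semigroupD//; last exact: bounded_measurable_cst.
  by rewrite semigroup_cst lerD2r hc.
have iter n sig x : 0 <= sig <= h -> u (t + sig) x <= W x + 1 / 2 ^+ n.
  elim: n sig x => [|n IH] sig x sigh.
    rewrite expr0 divr1; have /andP[sig0 _] := sigh.
    have /andP[_ u1] := solution_itv x (addr_ge0 t0 sig0).
    by rewrite (le_trans u1)// lerDr.
  by rewrite exprSr invfM mulrA; apply: improve.
move=> sig x sigh; rewrite leNgt; apply/negP => lt.
have d0 : 0 < u (t + sig) x - W x by rewrite subr_gt0.
have [n _ /(_ n (leqnn n))/= hn] := near_infty_natSinv_expn_lt (PosNum d0).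
have := iter n sig x sigh; lra.
Qed.

End steps.

(** * The logarithmic profile of the subsolution *)

Lemma ln_le_subr1 (R : realType) (x : R) : 0 < x -> ln x <= x - 1.
Proof. by move=> x0; have := @le_ln1Dx R (x - 1); rewrite subrKC; apply; lra. Qed.

(** A plateau of height [a], then a logarithmic decay at scale [L], passing through
    [m] at [L]. Beyond [L] the slope is [b / x], so that the small gain [x^(-2s)]
    provided by the jumps pays for a translation by [x^(1 - 2s)], the speed of the
    expected front. *)
Definition log_profile (R : realType) (a m b L x : R) : R :=
  if x <= 0 then a else Num.max 0 (Num.min a (m - b * ln (x / L))).

Section log_profile_facts.
Context {R : realType} (a m b L : R).
Context (a0 : 0 < a) (ma : 0 <= m <= a) (b0 : 0 < b) (L0 : 0 < L).

Local Notation w := (log_profile a m b L).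

Lemma log_profile_itv (x : R) : 0 <= w x <= a.
Proof.
rewrite /log_profile; case: ifP => _; first by rewrite (ltW a0) lexx.
by rewrite le_max lexx/= ge_max (ltW a0)/= ge_min lexx.
Qed.

Lemma log_profile_le0 (x : R) : x <= 0 -> w x = a.
Proof. by rewrite /log_profile => ->. Qed.

Lemma log_slopeE (x y : R) : 0 < x -> 0 < y ->
  (m - b * ln (x / L)) - (m - b * ln (y / L)) = b * ln (y / x).
Proof.
move=> x0 y0; rewrite (_ : _ - _ = b * (ln (y / L) - ln (x / L))); last by ring.
by rewrite -ln_div ?posrE ?divr_gt0// invfM invrK mulrACA mulVf ?gt_eqF// mulr1.
Qed.

Lemma log_ge (x y : R) : 0 < x -> x <= y -> m - b * ln (y / L) <= m - b * ln (x / L).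
Proof.
move=> x0 xy; have y0 : 0 < y by exact: lt_le_trans xy.
by rewrite lerD2l lerN2 ler_wpM2l ?(ltW b0)// ler_ln ?posrE ?divr_gt0// ler_wpM2r// invr_ge0 ltW.
Qed.

Lemma log_profile_noninc (x y : R) : x <= y -> w y <= w x.
Proof.
move=> xy; rewrite {2}/log_profile; case: ifP => [_|/negbT].
  by have /andP[] := log_profile_itv y.
rewrite -ltNge => x0; have y0 : 0 < y by exact: lt_le_trans xy.
rewrite /log_profile (leNgt y 0) y0/=.
have := log_ge x0 xy; move: (m - b * ln (y / L)) (m - b * ln (x / L)) => p q pq.
by apply: le_max2 => //; exact: le_min2.
Qed.

Lemma measurable_log_profile : measurable_fun setT w.
Proof.
by apply: nonincreasing_measurable => // x y xy; exact: log_profile_noninc.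
Qed.

Lemma log_profile_sub_ln (x y : R) : 0 < x -> x <= y -> w x - w y <= b * ln (y / x).
Proof.
move=> x0 xy; have y0 : 0 < y by exact: lt_le_trans xy.
have := log_slopeE x0 y0; have := log_ge x0 xy.
rewrite /log_profile (leNgt x 0) x0 (leNgt y 0) y0/=.
have : 0 <= b * ln (y / x) by rewrite mulr_ge0 ?(ltW b0)// ln_ge0// ler_pdivlMr// mul1r.
move: (m - b * ln (y / L)) (m - b * ln (x / L)) (b * _) => q p e e0 pq h.
rewrite lerBlDl ge_max addr_ge0 ?le_max ?lexx//=.
have hq : q <= Num.max 0 q by rewrite le_max lexx orbT.
rewrite [leLHS]minC; case: (leP a q) => aq.
  by rewrite (max_r (ltW a0)) ge_min; apply/orP; right; rewrite lerDl.
by rewrite ge_min; apply/orP; left; rewrite (le_trans _ (lerD hq (lexx e)))//; lra.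
Qed.

Lemma log_profile_sub_le (x y : R) : 0 < x -> x <= y -> w x - w y <= b * ((y - x) / x).
Proof.
move=> x0 xy; have y0 : 0 < y by exact: lt_le_trans xy.
rewrite (le_trans (log_profile_sub_ln x0 xy))// ler_wpM2l ?(ltW b0)//.
by rewrite mulrBl divff ?gt_eqF// ln_le_subr1// divr_gt0.
Qed.

Lemma log_profile_ge (x : R) : x <= L -> m <= w x.
Proof.
have /andP[m0 ma'] := ma.
move=> xL; rewrite /log_profile; case: ifP => // /negbT; rewrite -ltNge => x0.
have : ln (x / L) <= 0 by rewrite ln_le0// ler_pdivrMr// mul1r.
move=> l0; rewrite le_max le_min ma'/=.
by apply/orP; right; rewrite lerDl oppr_ge0 mulr_ge0_le0// ltW.
Qed.

Lemma log_profile_le (x : R) : L <= x -> w x <= m.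
Proof.
have /andP[m0 ma'] := ma.
move=> xL; have x0 : 0 < x by exact: lt_le_trans xL.
rewrite /log_profile (leNgt x 0) x0/= ge_max m0/= ge_min; apply/orP; right.
by rewrite gerDl oppr_le0 mulr_ge0 ?(ltW b0)// ln_ge0// ler_pdivlMr// mul1r.
Qed.

Lemma log_profile0 (x : R) : L * expR (m / b) <= x -> w x = 0.
Proof.
move=> xB; have B0 : 0 < L * expR (m / b) by rewrite mulr_gt0// expR_gt0.
have x0 : 0 < x by exact: lt_le_trans xB.
rewrite /log_profile (leNgt x 0) x0/=.
have h : m - b * ln (x / L) <= 0.
  rewrite subr_le0 -ler_pdivrMl// mulrC -[leLHS]expRK ler_ln ?posrE ?expR_gt0 ?divr_gt0//.
  by rewrite ler_pdivlMr// [leLHS]mulrC.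
by rewrite max_l// ge_min h orbT.
Qed.

(** The profile is flat near the origin, hence Lipschitz at scale [L]. *)
Lemma log_profile_lip (x y : R) : x <= y ->
  w x - w y <= b * expR ((a - m) / b) / L * (y - x).
Proof.
move=> xy; set xa := L * expR (- ((a - m) / b)).
have xa0 : 0 < xa by rewrite mulr_gt0// expR_gt0.
have wa z : z <= xa -> w z = a.
  move=> zxa; rewrite /log_profile; case: ifP => // /negbT; rewrite -ltNge => z0.
  have h : a <= m - b * ln (z / L).
    have : ln (z / L) <= - ((a - m) / b).
      rewrite -[leRHS]expRK ler_ln ?posrE ?expR_gt0 ?divr_gt0//.
      by rewrite ler_pdivrMr// [leRHS]mulrC.
    rewrite -(ler_pM2l b0) mulrN mulrCA divff ?gt_eqF// mulr1; lra.
  by rewrite min_l// max_r// ltW.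
have e : b * expR ((a - m) / b) / L = b / xa.
  by rewrite /xa expRN invfM invrK mulrAC mulrA.
rewrite e; have bxa : 0 <= b / xa by rewrite divr_ge0// ltW.
have [yxa|yxa] := leP y xa.
  by rewrite !wa ?(le_trans xy)// subrr mulr_ge0// subr_ge0.
have [xxa|xxa] := leP x xa.
  have -> : w x = w xa by rewrite !wa.
  rewrite (le_trans (log_profile_sub_le xa0 (ltW yxa)))//.
  by rewrite mulrA mulrAC ler_wpM2l// lerB.
have x0 : 0 < x by exact: lt_trans xxa.
rewrite (le_trans (log_profile_sub_le x0 xy))// mulrA mulrAC.
by rewrite ler_wpM2r ?subr_ge0// ler_wpM2l ?(ltW b0)// lef_pV2// ltW.
Qed.

End log_profile_facts.

(** The opposite of the logarithm is convex, so the profile loses nothing from short jumps;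
    a jump of length at least [x] to the left reaches the plateau, which gains
    [2 delta], while the symmetric jump to the right loses at most [delta] as
    long as its length is at most [M x]. *)
Lemma log_profile_second_difference (R : realType) (a delta b M L x z : R) :
  0 < delta -> 2 * delta <= a <= 1 -> 1 <= M -> 0 < b -> b * ln (1 + M) = delta ->
  0 < L -> L <= x ->
  delta * far x z - 2 * far (M * x) z <=
    log_profile a (a - 2 * delta) b L (x - z) + log_profile a (a - 2 * delta) b L (x + z) -
    2 * log_profile a (a - 2 * delta) b L x.
Proof.
move=> d0 /andP[da a1] M1 b0 bM L0 Lx; set w := log_profile _ _ _ _.
wlog z0 : z / 0 <= z.
  move=> H; have [z0|/ltW z0] := leP 0 z; first exact: H.
  have := H (- z); rewrite oppr_ge0 opprK /far normrN => /(_ z0).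
  by rewrite [w (x + z) + _]addrC.
have a0 : 0 < a by lra.
have x0 : 0 < x by exact: lt_le_trans Lx.
have ma : 0 <= a - 2 * delta <= a by apply/andP; split; lra.
have wle y : L <= y -> w y <= a - 2 * delta by exact: log_profile_le.
have w_ge0 y : 0 <= w y by have /andP[] := log_profile_itv (a - 2 * delta) b L a0 y.
have wx := wle x Lx.
have right y : x <= y -> y <= (1 + M) * x -> w x - w y <= delta.
  move=> xy yM; rewrite (le_trans (log_profile_sub_ln (a - 2 * delta) a0 b0 L0 x0 xy))// -bM.
  have y0 : 0 < y by exact: lt_le_trans xy.
  have M0 : 0 < 1 + M by rewrite addr_gt0// (lt_le_trans _ M1).
  by rewrite ler_wpM2l ?(ltW b0)// ler_ln ?posrE ?divr_gt0// ler_pdivrMr.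
rewrite /far (ger0_norm z0).
have xMx : x <= M * x by rewrite ler_peMl// ltW.
have [zx|xz] := leP x z.
  rewrite [w (x - z)]log_profile_le0 ?subr_le0//.
  have [zM|zM] := leP (M * x) z.
    by have := w_ge0 (x + z); lra.
  have := right (x + z); rewrite lerDl z0 mulrDl mul1r lerD2l => /(_ isT (ltW zM)); lra.
have Mz : (M * x <= z) = false by apply/negbTE; rewrite -ltNge (lt_le_trans xz).
rewrite Mz !mulr0 subr0.
have xz0 : 0 < x - z by rewrite subr_gt0.
have xz1 : 0 < x + z by rewrite ltr_wpDr.
have rz : w x - w (x + z) <= delta.
  apply: right; first by rewrite lerDl.
  by rewrite mulrDl mul1r lerD2l ltW// (lt_le_trans xz).
have lz : w x <= w (x - z) by apply: log_profile_noninc => //; rewrite gerBl.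
have [wx0|wx0] := leP (w x) 0.
  by have := w_ge0 (x - z); have := w_ge0 (x + z); lra.
pose l (y : R) := a - 2 * delta - b * ln (y / L).
have wE y : 0 < y -> w y = Num.max 0 (Num.min a (l y)).
  by move=> y0; rewrite /w /log_profile leNgt y0.
have lx : w x <= l x.
  move: wx0; rewrite (wE x x0); case: (leP a (l x)) => h.
    by rewrite max_r// ltW.
  by case: (leP 0 (l x)) => // _; rewrite ltxx.
have conc : l (x - z) + l (x + z) - 2 * l x >= 0.
  have -> : l (x - z) + l (x + z) - 2 * l x = (l (x - z) - l x) - (l x - l (x + z)) by ring.
  rewrite /l !log_slopeE// -mulrBr mulr_ge0 ?(ltW b0)// subr_ge0.
  rewrite ler_ln ?posrE ?divr_gt0// ler_pdivrMr// mulrAC ler_pdivlMr//.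
  by rewrite -subr_ge0 (_ : _ - _ = z ^+ 2) ?sqr_ge0//; ring.
have lr : l (x + z) <= w (x + z).
  rewrite (wE _ xz1); case: (leP a (l (x + z))) => h; last by rewrite le_max lexx orbT.
  have : l (x + z) <= l x by apply: log_ge => //; rewrite lerDl.
  have : l x <= a - 2 * delta.
    by rewrite /l gerBl mulr_ge0 ?(ltW b0)// ln_ge0// ler_pdivlMr// mul1r.
  lra.
have [la|la] := leP a (l (x - z)).
  have -> : w (x - z) = a by rewrite (wE _ xz0) min_l// max_r// ltW.
  lra.
have : l (x - z) <= w (x - z) by rewrite (wE _ xz0) (min_r (ltW la)) le_max lexx orbT.
lra.
Qed.

Lemma semigroup_second_difference (R : realType) (J : R -> R)
    (mu : R -> probability (measurableTypeR R) R) (t : R) (g : R -> R) (x : R) :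
  semigroup_measures J mu -> 0 <= t -> measurable_fun setT g -> (forall y, 0 <= g y <= 1) ->
  2 * (semigroup mu t g x - g x) = \int[mu t]_z (g (x - z) + g (x + z) - 2 * g x).
Proof.
move=> hmu t0 mg g01; have bg := bounded_measurable01 mg g01.
have bl : bounded_measurable (fun z => g (x - z)) by exact: bounded_measurable_reflect.
have mr : measurable_fun setT (fun z : R => g (x + z)).
  by apply: (measurableT_comp mg); exact: measurable_funD.
have br : bounded_measurable (fun z => g (x + z)) by exact: bounded_measurable01.
have sym : semigroup mu t g x = \int[mu t]_z g (x + z).
  rewrite /semigroup /Rintegral; congr fine.
  rewrite -(semigroup_sym (g := fun z => (g (x + z))%:E) hmu t0)//.
    exact/measurable_EFinP.
  by move=> y; rewrite lee_fin; have /andP[] := g01 (x + y).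
have i1 := bounded_measurable_integrable (mu t) bl.
have i2 := bounded_measurable_integrable (mu t) br.
have i3 := bounded_measurable_integrable (mu t) (bounded_measurable_cst (2 * g x)).
have i4 := bounded_measurable_integrable (mu t) (bounded_measurableD bl br).
rewrite RintegralB// RintegralD// -sym -/(semigroup mu t g x).
by rewrite Rintegral_cst//= probability_setT/= mulr1; ring.
Qed.

(** Symmetrizing the jumps turns the increment into a mean of second differences.
    By the choice of [M], what the jumps beyond [M * x] may lose is at most half of
    what the jumps beyond [x] gain. *)
Lemma semigroup_log_profile_ge (R : realType) (s : R) (J : R -> R)
    (mu : R -> probability (measurableTypeR R) R) (C c R1 a delta b M L h x : R) :
  semigroup_measures J mu ->
  (forall t r : R, 0 <= t <= 2 -> 0 < r -> \int[mu t]_z trunc r z <= C * r `^ (- (2 * s))) ->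
  (forall t r : R, 1 <= t <= 2 -> R1 <= r -> c * r `^ (- (2 * s)) <= \int[mu t]_z far r z) ->
  0 < delta -> 2 * delta <= a <= 1 -> 1 <= M -> 0 < b -> b * ln (1 + M) = delta ->
  4 * C * M `^ (- (2 * s)) <= delta * c ->
  0 < L -> R1 <= L -> L <= x -> 1 <= h <= 2 ->
  delta * c / 4 * x `^ (- (2 * s)) <=
    semigroup mu h (log_profile a (a - 2 * delta) b L) x - log_profile a (a - 2 * delta) b L x.
Proof.
move=> hmu hC hc d0 da M1 b0 bM MC L0 RL Lx h12.
have /andP[h1 h2] := h12; have h0 : 0 <= h by exact: le_trans h1.
have /andP[da0 a1] := da; have a0 : 0 < a by lra.
have x0 : 0 < x by exact: lt_le_trans Lx.
have M0 : 0 < M by exact: lt_le_trans M1.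
have Mx0 : 0 < M * x by exact: mulr_gt0.
set w := log_profile _ _ _ _.
have w01 y : 0 <= w y <= 1.
  have /andP[w0 wa] := log_profile_itv (a - 2 * delta) b L a0 y.
  by rewrite w0 (le_trans wa).
have mw : measurable_fun setT w by exact: measurable_log_profile.
have bw := bounded_measurable01 mw w01.
have bl : bounded_measurable (fun z => w (x - z)) by exact: bounded_measurable_reflect.
have br : bounded_measurable (fun z => w (x + z)).
  by apply: bounded_measurable01 => //; apply: (measurableT_comp mw); exact: measurable_funD.
have bd := bounded_measurableB (bounded_measurableD bl br) (bounded_measurable_cst (2 * w x)).
have bfar r : bounded_measurable (far (R := R) r).
  apply: bounded_measurable01; first exact: measurable_far.
  by move=> z; rewrite /far; case: ifP => _; rewrite ?lexx ler01.
have bf1 := bounded_measurableZ delta (bfar x).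
have bf2 := bounded_measurableZ 2 (bfar (M * x)).
have : \int[mu h]_z (delta * far x z - 2 * far (M * x) z) <= 2 * (semigroup mu h w x - w x).
  rewrite (semigroup_second_difference x hmu h0 mw w01); apply: le_Rintegral => //.
  - exact: bounded_measurable_integrable (bounded_measurableB bf1 bf2).
  - exact: bounded_measurable_integrable bd.
  - by move=> z _; exact: log_profile_second_difference.
rewrite RintegralB//; [|exact: bounded_measurable_integrable..].
rewrite !RintegralZl//; [|exact: integrable_far..].
have := hc h x h12 (le_trans RL Lx); rewrite -(ler_pM2l d0) mulrA => k1.
have k2 : \int[mu h]_z far (M * x) z <= C * (M * x) `^ (- (2 * s)).
  apply: le_trans (hC h _ _ Mx0); last by rewrite h0.
  apply: le_Rintegral => //; [exact: integrable_far|exact: integrable_trunc|].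
  move=> z _; rewrite /far /trunc; case: ifP => [|_].
    by move=> Mz; rewrite le_min lexx/= ler_pdivlMr// mul1r.
  by rewrite le_min ler01 divr_ge0// ltW.
have k3 : 4 * (C * (M * x) `^ (- (2 * s))) <= delta * c * x `^ (- (2 * s)).
  rewrite (powRM _ (ltW M0) (ltW x0)) !mulrA ler_wpM2r ?powR_ge0//.
move: k1 k2 k3; move: (\int[mu h]_z far x z) (\int[mu h]_z far (M * x) z) => p q.
lra.
Qed.

(** The increments of such a function are dominated by [trunc l], whose mean is small
    if [l] is large. *)
Lemma semigroup_lipschitz_near (R : realType) (s : R)
    (mu : R -> probability (measurableTypeR R) R) (C l t : R) (g : R -> R) (x : R) :
  (forall t r : R, 0 <= t <= 2 -> 0 < r -> \int[mu t]_z trunc r z <= C * r `^ (- (2 * s))) ->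
  0 < l -> 0 <= t <= 2 -> measurable_fun setT g -> (forall y, 0 <= g y <= 1) ->
  (forall y z, `|g y - g z| <= `|y - z| / l) ->
  `|semigroup mu t g x - g x| <= C * l `^ (- (2 * s)).
Proof.
move=> hC l0 t02 mg g01 glip; have bg := bounded_measurable01 mg g01.
have bl : bounded_measurable (fun z => g (x - z)) by exact: bounded_measurable_reflect.
have bt : bounded_measurable (trunc (R := R) l).
  apply: bounded_measurable01; first exact: measurable_trunc.
  by move=> z; rewrite trunc_ge0 ?trunc_le1// ltW.
have dist z : `|g (x - z) - g x| <= trunc l z.
  rewrite /trunc le_min; apply/andP; split; last first.
    by have := glip (x - z) x; rewrite addrAC subrr add0r normrN.
  have /andP[? ?] := g01 (x - z); have /andP[? ?] := g01 x.
  by rewrite ler_norml; apply/andP; split; lra.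
have E : semigroup mu t g x - g x = \int[mu t]_z (g (x - z) - g x).
  rewrite RintegralB//; first by rewrite Rintegral_cst//= probability_setT/= mulr1.
  - exact: bounded_measurable_integrable.
  - exact: bounded_measurable_integrable (bounded_measurable_cst _).
rewrite E; apply: le_trans (hC t l t02 l0).
have bd := bounded_measurableB bl (bounded_measurable_cst (g x)).
apply: (le_trans (le_normr_Rintegral _ _)) => //; first exact: bounded_measurable_integrable.
apply: le_Rintegral => //.
- apply: bounded_measurable_integrable; apply: bounded_measurable01.
    by apply: measurableT_comp => //; case: bd.
  by move=> z; rewrite normr_ge0 (le_trans (dist z))// trunc_le1.
- exact: bounded_measurable_integrable.
Qed.

(** * The lower bound *)

Lemma ignition_min (R : realType) (theta : R) (f : R -> R) (p q : R) : ignition theta f ->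
  theta < p -> 0 < theta -> p <= q -> q < 1 ->
  exists2 c0 : R, 0 < c0 & forall v, p <= v <= q -> c0 <= f v.
Proof.
move=> hf tp t0 pq q1; have [K K0 hK] := ignition_lipschitz hf.
have cont : {within `[p, q], continuous (fun v => f (clamp01 v))}.
  apply: continuous_subspaceT; apply: (@lipschitz_continuous _ _ K) => x y.
  by rewrite (le_trans (hK _ _ (clamp01_itv _) (clamp01_itv _)))// ler_wpM2l ?(ltW K0) ?clamp01_lip.
have [v0 v0pq minv] := EVT_min pq cont.
have cl v : p <= v <= q -> clamp01 v = v.
  move=> /andP[pv vq]; apply: clamp01_id; apply/andP; split; lra.
exists (f v0).
  move: v0pq; rewrite in_itv/= => /andP[h1 h2].
  have [_ _ _ fp] := hf; apply: fp; apply/andP; split; lra.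
move=> v vpq; have := minv v; rewrite in_itv/= cl// cl; first exact.
by move: v0pq; rewrite in_itv.
Qed.

Section bulk.
Context {R : realType} {s theta : R} {J f : R -> R}
  {mu : R -> probability (measurableTypeR R) R} {u : R -> R -> R}.
Context (cd : cauchy_data s theta J f mu u).

(** Where the profile stays above the ignition threshold on a long interval,
    the linear flow keeps it above the threshold, and the reaction is bounded
    below there; a large jump out of this interval has small probability. *)
Lemma semigroup_reaction_ge (C c0 p a l L t r x : R) (g : R -> R) :
  (forall t r : R, 0 <= t <= 2 -> 0 < r -> \int[mu t]_z trunc r z <= C * r `^ (- (2 * s))) ->
  0 <= c0 -> a <= 1 -> (forall v, p <= v <= a -> c0 <= f v) ->
  0 < l -> 0 <= t <= 2 -> 0 <= r <= 2 ->
  measurable_fun setT g -> (forall y, 0 <= g y <= a) ->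
  (forall y z, `|g y - g z| <= `|y - z| / l) ->
  forall e, 0 < e -> C * l `^ (- (2 * s)) <= e -> C * (e * l) `^ (- (2 * s)) <= 1 / 2 ->
  (forall y, y <= L -> p + 2 * e <= g y) -> x <= L ->
  c0 / 2 <= semigroup mu t (f \o semigroup mu r g) x.
Proof.
move=> hC c00 a1 fc l0 t02 r02 mg ga glip e e0 hl hel gL xL.
have g01 y : 0 <= g y <= 1 by have /andP[-> /le_trans->] := ga y.
have bg := bounded_measurable01 mg g01.
have el0 : 0 < e * l by exact: mulr_gt0.
pose P := semigroup mu r g.
have P01 y : 0 <= P y <= 1 by exact: semigroup_itv.
have Pa y : P y <= a by have /andP[] := semigroup_itv mu r y bg ga.
have bP : bounded_measurable P by exact: bounded_measurable_semigroup.
have bfP : bounded_measurable (f \o P) by apply: (bounded_reaction cd) => //; case: bP.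
have bt : bounded_measurable (trunc (R := R) (e * l)).
  apply: bounded_measurable01; first exact: measurable_trunc.
  by move=> z; rewrite trunc_ge0 ?trunc_le1// ltW.
have ptw z : c0 - c0 * trunc (e * l) z <= (f \o P) (x - z).
  have [elz|zel] := leP (e * l) `|z|.
    have -> : trunc (e * l) z = 1 by rewrite /trunc min_l// ler_pdivlMr// mul1r.
    by rewrite mulr1 subrr (ignition_ge0 (cd_ignition cd)).
  rewrite (@le_trans _ _ c0)//; first by rewrite gerBl mulr_ge0// trunc_ge0// ltW.
  apply: fc; rewrite Pa andbT.
  have h1 := semigroup_lipschitz_near (x - z) hC l0 r02 mg g01 glip.
  have h2 : g x - e <= g (x - z).
    have := glip x (x - z); rewrite opprB subrKC => h3.
    have : `|z| / l <= e by rewrite ler_pdivrMr// ltW.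
    by move: h3; rewrite ler_norml => /andP[_ h3]; lra.
  have h3 := gL x xL.
  have : `|semigroup mu r g (x - z) - g (x - z)| <= e by exact: le_trans hl.
  rewrite -/(P (x - z)) ler_norml => /andP[h4 _]; move: h2 h4.
  move: (g (x - z)) (P (x - z)) => p1 p2; lra.
have i1 := bounded_measurable_integrable (mu t) (bounded_measurable_cst c0).
have i2 := bounded_measurable_integrable (mu t) (bounded_measurableZ c0 bt).
have i3 := bounded_measurable_integrable (mu t) bt.
have i4 := bounded_measurable_integrable (mu t)
  (bounded_measurableB (bounded_measurable_cst c0) (bounded_measurableZ c0 bt)).
have : \int[mu t]_z (c0 - c0 * trunc (e * l) z) <= semigroup mu t (f \o P) x.
  apply: le_Rintegral => //; exact: semigroup_integrable.
apply: le_trans; rewrite RintegralB// RintegralZl// Rintegral_cst//= probability_setT/= mulr1.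
have : c0 * \int[mu t]_z trunc (e * l) z <= c0 * (1 / 2).
  by rewrite ler_wpM2l// (le_trans _ hel)// hC.
lra.
Qed.

End bulk.

Lemma powRN_small (R : realType) (p k : R) : 0 < p -> 0 < k ->
  exists2 L0 : R, 0 < L0 & forall L, L0 <= L -> L `^ (- p) <= k.
Proof.
move=> p0 k0; exists (k `^ (- p^-1)); first exact: powR_gt0.
move=> L kL; have L0 : 0 < L by apply: lt_le_trans kL; exact: powR_gt0.
rewrite -[leRHS]powRr1 ?(ltW k0)// (_ : 1 = (- p^-1) * (- p)); last by rewrite mulrNN mulVf// gt_eqF.
rewrite powRrM ![_ `^ (- p)]powRN lef_pV2 ?posrE ?powR_gt0//.
by rewrite ge0_ler_powR ?nnegrE ?powR_ge0 ?(ltW p0) ?(ltW L0).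
Qed.

(** The profile, at any large scale [L], may be pushed by the flow to the right
    at speed of order [L^(1 - 2s)]: beyond [L] thanks to the far jumps from the
    plateau, and before [L] thanks to the reaction. *)
Lemma lower_front (R : realType) (s theta : R) (J f : R -> R)
    (mu : R -> probability (measurableTypeR R) R) (u : R -> R -> R)
    (cd : cauchy_data s theta J f mu u) (a : R) : theta < a < 1 ->
  exists m b eps L0 : R, [/\ 0 <= m <= a, 0 < b, 0 < eps, 0 < L0 &
    forall L h t X : R, L0 <= L -> 1 <= h <= 2 -> 0 <= t ->
      (forall y, log_profile a m b L (y - X) <= u t y) ->
      forall y, log_profile a m b L (y - (X + h * (eps * (L * L `^ (- (2 * s)))))) <= u (t + h) y].
Proof.
move=> /andP[ta a1]; have t0 := theta_gt0 cd.
have a0 : 0 < a by exact: lt_trans ta.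
have hmu := cd_semigroup cd.
have /andP[s0 s12] := cd_s cd.
have [C C0 hC] := truncated_moment (cd_s cd) (cd_kernel cd) hmu.
have [c [R1 [cc0 R10 hc]]] := far_lower_bound (cd_s cd) (cd_kernel cd) hmu.
have [K K0 fK] := ignition_lipschitz (cd_ignition cd).
(* [delta] separates the threshold, the lowest value at which the reaction is
   used, the value [m] of the profile at [L], and (twice) the plateau *)
pose delta := (a - theta) / 4; have d0 : 0 < delta by rewrite divr_gt0 ?subr_gt0.
have da : a - 2 * delta = theta + 2 * delta by rewrite /delta; lra.
have a2d : 2 * delta <= a <= 1 by apply/andP; split; rewrite /delta; lra.
have ma : 0 <= a - 2 * delta <= a by apply/andP; split; rewrite /delta; lra.
have pa : theta + delta <= a by rewrite /delta; lra.
clearbody delta.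
have ss0 : 0 < 2 * s by rewrite mulr_gt0.
have s21 : 2 * s < 1 by lra.
have [M0 _ hM] := powRN_small ss0 (divr_gt0 (mulr_gt0 d0 cc0) (mulr_gt0 (ltr0n R 4) C0)).
(* jumps beyond [M x], for which the profile may lose, are rare enough *)
pose M := Num.max 1 M0.
have M1 : 1 <= M by rewrite le_max lexx.
have MC : 4 * C * M `^ (- (2 * s)) <= delta * c.
  by rewrite mulrC -ler_pdivlMr ?mulr_gt0// hM// le_max lexx orbT.
clearbody M.
have lM0 : 0 < ln (1 + M) by rewrite ln_gt0// ltrDl (lt_le_trans _ M1).
pose b := delta / ln (1 + M); have b0 : 0 < b by exact: divr_gt0.
have bM : b * ln (1 + M) = delta by rewrite divfK// gt_eqF.
clearbody b.
(* half the gain [delta * c / 2 * x^(-2s)] of the second difference has to cover a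
   translation by [h * eps * L^(1 - 2s)], with [h <= 2], of a profile whose slope
   is at most [2 * b / x] on the way *)
pose eps := delta * c / (16 * b); have eps0 : 0 < eps by rewrite divr_gt0// mulr_gt0.
have epsE : delta * c / 4 = 4 * (b * eps) by rewrite /eps; field; exact: lt0r_neq0.
clearbody eps.
pose Lam := b * expR ((a - (a - 2 * delta)) / b).
have Lam0 : 0 < Lam by rewrite mulr_gt0// expR_gt0.
have lip0 L x1 y1 : 0 < L -> x1 <= y1 -> log_profile a (a - 2 * delta) b L x1 -
    log_profile a (a - 2 * delta) b L y1 <= Lam / L * (y1 - x1).
  by move=> L0 xy; exact: log_profile_lip.
clearbody Lam.
have tp : theta < theta + delta by rewrite ltrDl.
have [c0 c00 fc] := ignition_min (cd_ignition cd) tp t0 pa a1.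
pose D := c0 / 2 / (1 + K * 2).
have K20 : 0 < 1 + K * 2 by rewrite addr_gt0 ?mulr_gt0.
have D0 : 0 < D by rewrite !divr_gt0.
have DE : D * (1 + K * 2) = c0 / 2 by rewrite divfK// gt_eqF.
clearbody D.
(* the scale is taken so large that the translation by [v] is at most [L / 2],
   that the flow moves the profile by less than the margin above the threshold
   and seldom jumps out of the bulk, and that the reaction [D] exceeds what the
   flow and the translation together may take away *)
have [L1 L10 hL1] : exists2 L1 : R, 0 < L1 & forall L, L1 <= L ->
    [/\ L `^ (- (2 * s)) * (4 * eps) <= 1,
        C * (L / Lam) `^ (- (2 * s)) <= delta / 2,
        C * (delta / 2 * (L / Lam)) `^ (- (2 * s)) <= 1 / 2 &
        C * (L / Lam) `^ (- (2 * s)) + Lam * (2 * eps) * L `^ (- (2 * s)) <= D].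
  pose B2 := C * Lam^-1 `^ (- (2 * s)).
  have B20 : 0 < B2 by rewrite mulr_gt0// powR_gt0// invr_gt0.
  pose B3 := C * (delta / 2 * Lam^-1) `^ (- (2 * s)).
  have B30 : 0 < B3.
    by rewrite mulr_gt0// powR_gt0// mulr_gt0 ?invr_gt0// divr_gt0.
  have B40 : 0 < B2 + Lam * (2 * eps) by rewrite addr_gt0// mulr_gt0// mulr_gt0.
  have e40 : 0 < 4 * eps by rewrite mulr_gt0.
  have k0 : 0 < Num.min (Num.min (1 / (4 * eps)) (delta / 2 / B2))
                        (Num.min (1 / 2 / B3) (D / (B2 + Lam * (2 * eps)))).
    by rewrite !lt_min !divr_gt0.
  have [L1 L10 hL1] := powRN_small ss0 k0; exists L1 => // L LL.
  have L0 : 0 <= L by rewrite (le_trans _ LL)// ltW.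
  have Li : 0 <= Lam^-1 by rewrite invr_ge0 ltW.
  have dLi : 0 <= delta / 2 * Lam^-1 by rewrite mulr_ge0// divr_ge0// ltW.
  have := hL1 L LL; rewrite !le_min !ler_pdivlMr// => /andP[/andP[q1 q2] /andP[q3 q4]].
  have E2 : C * (L / Lam) `^ (- (2 * s)) = L `^ (- (2 * s)) * B2.
    by rewrite powRM// /B2; ring.
  rewrite E2; split => //.
    have -> : delta / 2 * (L / Lam) = delta / 2 * Lam^-1 * L by ring.
    by rewrite powRM// [C * _]mulrA -/B3 [B3 * _]mulrC.
  by apply: le_trans q4; rewrite mulrDr [Lam * _ * _]mulrC.
exists (a - 2 * delta), b, eps, (Num.max R1 L1); split => //.
  by rewrite lt_max R10.
move=> L h t X; rewrite ge_max => /andP[RL LL] h12 tt0 wu y.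
have L0 : 0 < L by exact: lt_le_trans RL.
have [q1 e2 e3 q4] := hL1 L LL.
have LqE x : L <= x -> L * L `^ (- (2 * s)) <= x * x `^ (- (2 * s)).
  move=> Lx; have x0 : 0 < x by exact: lt_le_trans Lx.
  rewrite -{1}(powRr1 (ltW L0)) -{1}(powRr1 (ltW x0)) -!powRD; first last.
  - by rewrite (gt_eqF L0) implybT.
  - by rewrite (gt_eqF x0) implybT.
  - by rewrite ge0_ler_powR ?nnegrE ?(ltW L0) ?(ltW x0) ?subr_ge0 ?(ltW s21)//.
have q0 : 0 < L `^ (- (2 * s)) by exact: powR_gt0.
move: (L `^ _) LqE q0 q1 q4 => q LqE q0 q1 q4.
set w := log_profile _ _ _ _ in wu *.
have wa x : 0 <= w x <= a by exact: log_profile_itv.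
have noninc x1 y1 : x1 <= y1 -> w y1 <= w x1 by exact: log_profile_noninc.
have slope x1 y1 : 0 < x1 -> x1 <= y1 -> w x1 - w y1 <= b * ((y1 - x1) / x1).
  exact: log_profile_sub_le.
have lip x1 y1 : x1 <= y1 -> w x1 - w y1 <= Lam / L * (y1 - x1) by exact: lip0.
have plateau x : x <= L -> a - 2 * delta <= w x by exact: log_profile_ge.
have gain x : L <= x -> delta * c / 4 * x `^ (- (2 * s)) <= semigroup mu h w x - w x.
  by move=> Lx; exact: (semigroup_log_profile_ge hmu hC hc d0 a2d M1 b0 bM MC L0 RL Lx h12).
have mw : measurable_fun setT w by exact: measurable_log_profile.
clearbody w.
have w01 x : 0 <= w x <= 1 by have /andP[-> /le_trans->//] := wa x; exact: ltW.
have bw := bounded_measurable01 mw w01.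
have /andP[h1 h2] := h12; have h0 : 0 <= h by exact: le_trans h1.
have eLq0 : 0 < eps * (L * q) by rewrite mulr_gt0// mulr_gt0.
have -> : y - (X + h * (eps * (L * q))) = y - X - h * (eps * (L * q)) by ring.
have v2 : h * (eps * (L * q)) <= 2 * (eps * (L * q)) by rewrite ler_wpM2r// ltW.
have v0 : 0 < h * (eps * (L * q)) by rewrite mulr_gt0// (lt_le_trans _ h1).
move: (h * _) v2 v0 => v v2 v0.
have [x xE] : exists x, x = y - X by eexists.
rewrite -xE.
have tt : t <= t + h by rewrite lerDl.
have ht : t + h - t = h by rewrite addrAC subrr add0r.
have wX : measurable_fun setT (fun z : R => w (z - X)).
  by apply: (measurableT_comp mw); exact: measurable_funB.
have wX01 z : 0 <= w (z - X) <= 1 by exact: w01.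
have bwX := bounded_measurable01 wX wX01.
have [Lx|xL] := leP L x.
  have vL : v <= L / 2.
    move: q1 => /(ler_wpM2l (ltW L0)) h3; clear -h3 v2; lra.
  have step : semigroup mu h w x <= u (t + h) y.
    rewrite xE -semigroup_shift -{1}ht (le_trans _ (semigroup_le_solution cd y tt0 tt))//.
    by apply: semigroup_le => //; exact: bounded_solution cd _ tt0.
  suff : w (x - v) - w x <= delta * c / 4 * x `^ (- (2 * s)).
    by move: (gain x Lx) step; move: (semigroup mu h w x) (x `^ _) => P1 P2; clear; lra.
  have x0 : 0 < x by exact: lt_le_trans Lx.
  have xv0 : 0 < x - v by clear -vL Lx L0; lra.
  have xv : x - v <= x by rewrite gerBl ltW.
  apply: (le_trans (slope _ _ xv0 xv)).
  rewrite opprB subrKC.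
  have -> : delta * c / 4 * x `^ (- (2 * s)) = b * (4 * eps * x `^ (- (2 * s))).
    by rewrite epsE; ring.
  rewrite ler_wpM2l ?(ltW b0)// ler_pdivrMr//.
  have k : v <= 2 * (eps * (x * x `^ (- (2 * s)))).
    by rewrite (le_trans v2)// ler_wpM2l// ler_wpM2l ?LqE// ltW.
  apply: (le_trans k).
  have : 0 <= eps * x `^ (- (2 * s)) by rewrite mulr_ge0 ?powR_ge0// ltW.
  move: (x `^ _) => g eg; have : 0 <= (eps * g) * (2 * x - 4 * v) by rewrite mulr_ge0//; clear -vL Lx; lra.
  by clear; lra.
have l0 : 0 < L / Lam by exact: divr_gt0.
have glip y1 z1 : `|w (y1 - X) - w (z1 - X)| <= `|y1 - z1| / (L / Lam).
  wlog yz : y1 z1 / y1 <= z1.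
    move=> H; have [yz|/ltW yz] := leP y1 z1; first exact: H.
    by rewrite distrC [X in _ <= X / _]distrC; exact: H.
  rewrite ger0_norm ?subr_ge0 ?noninc ?lerD2r//.
  have := lip (y1 - X) (z1 - X); rewrite lerD2r => /(_ yz) /le_trans; apply.
  rewrite distrC ger0_norm ?subr_ge0// invf_div mulrC ler_wpM2r ?divr_ge0 ?(ltW L0) ?(ltW Lam0)//.
  by rewrite opprB addrA subrK.
have near := semigroup_lipschitz_near y hC l0 _ wX wX01 glip.
have nh := near h; rewrite semigroup_shift -xE in nh.
have gwa z : 0 <= w (z - X) <= a by exact: wa.
have gL z : z <= X + L -> theta + delta + 2 * (delta / 2) <= w (z - X).
  move=> zL; have -> : theta + delta + 2 * (delta / 2) = a - 2 * delta by rewrite da; clear; lra.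
  by apply: plateau; rewrite lerBlDl.
have yXL : y <= X + L by rewrite -lerBlDl -xE ltW.
have := @lower_step _ _ _ _ _ _ _ cd K _ t (t + h) y (c0 / 2) (ltW K0) fK wX wX01 tt0 tt wu.
rewrite ht semigroup_shift -xE => /(_ _) step.
have {}step : h * (c0 / 2) <= (1 + K * h) * (u (t + h) y - semigroup mu h w x).
  apply: step => r tr rth.
  have d2 : 0 < delta / 2 by rewrite divr_gt0.
  apply: (semigroup_reaction_ge cd hC (ltW c00) (ltW a1) fc l0 _ _ wX gwa glip d2 e2 e3 gL yXL).
    by clear -tr rth h2; apply/andP; split; lra.
  by clear -tr rth h2; apply/andP; split; lra.
have {}nh : `|semigroup mu h w x - w x| <= C * (L / Lam) `^ (- (2 * s)) by rewrite nh// h0 h2.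
have lv := lip (x - v) x; rewrite gerBl (ltW v0) opprB subrKC in lv.
have {}lv := lv isT.
have Lv : Lam / L * v <= Lam * (2 * eps) * q.
  rewrite (le_trans (ler_wpM2l _ v2)) ?divr_ge0 ?(ltW Lam0) ?(ltW L0)//.
  rewrite (_ : Lam / L * _ = Lam * (2 * eps) * q)//; field; exact: lt0r_neq0.
have Kh : 0 < 1 + K * h by rewrite ltr_wpDr// mulr_ge0// ltW.
have stepD : D <= u (t + h) y - semigroup mu h w x.
  rewrite -(ler_pM2l Kh) (le_trans _ step)//.
  rewrite -DE; have : 0 <= D * (h - 1) by rewrite mulr_ge0 ?(ltW D0)// subr_ge0.
  have : 0 <= K * h * D by rewrite mulr_ge0 ?(ltW D0)// mulr_ge0// ltW.
  by clear; lra.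
move: nh; rewrite ler_norml => /andP[nh _].
move: q4 stepD nh lv Lv; move: (semigroup mu h w x) (Lam / L * v) (C * _) => P1 P2 P3.
by clear; lra.
Qed.

(** The transform at time zero is that of the Dirac mass. *)
Lemma semigroup0 (R : realType) (J : R -> R) (mu : R -> probability (measurableTypeR R) R)
    (g : R -> R) (x : R) : semigroup_measures J mu -> measurable_fun setT g ->
  semigroup mu 0 g x = g x.
Proof.
move=> hmu mg; pose d0 : probability (measurableTypeR R) R := @dirac _ (measurableTypeR R) (0 : R) R.
have d0E (h : R -> R) : measurable_fun setT h -> \int[d0]_z h z = h 0.
  move=> mh; rewrite /Rintegral integral_dirac//; last exact/measurable_EFinP.
  by rewrite diracT mul1e.
have same (A : set (measurableTypeR R)) : measurable A -> mu 0 A = d0 A.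
  apply: eq_probability_fourier => xi.
    rewrite (semigroup_cos xi hmu (lexx 0)) mul0r expR0 d0E ?mulr0 ?cos0//.
    exact: measurable_cosM.
  rewrite (semigroup_sin xi hmu (lexx 0)) d0E ?mulr0 ?sin0//.
  exact: measurable_sinM.
rewrite /semigroup /Rintegral.
rewrite (eq_measure_integral d0); last by move=> A mA _; exact: same.
by rewrite -/(Rintegral _ _ _) d0E ?subr0//; exact: measurable_reflect.
Qed.

Lemma solution_initial (R : realType) (s theta : R) (J f : R -> R)
    (mu : R -> probability (measurableTypeR R) R) (u : R -> R -> R) (x : R) :
  cauchy_data s theta J f mu u -> u 0 x = if x <= 0 then 1 else 0.
Proof.
move=> cd; have [_ _ /(_ 0 x (lexx 0))->] := cd_mild cd.
rewrite set_itv1 Rintegral_set1 addr0 (semigroup0 _ (cd_semigroup cd)); last exact: measurable_indic.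
rewrite indicE mem_setE in_itv/=; by case: ifP.
Qed.

Section lower_bound.
Context {R : realType} {s theta : R} {J f : R -> R}
  {mu : R -> probability (measurableTypeR R) R} {u : R -> R -> R}.
Context (cd : cauchy_data s theta J f mu u).

(** The time [t] is cut into steps of length between [1] and [2], the scale
    [L = kap t^(1/(2s))] being that for which the plateau travels over a
    distance of order [L]. The plateau starts far enough to the left for the
    translated profile to lie below the initial datum. *)
Lemma solution_accelerates (lambda : R) : 0 < lambda < 1 ->
  exists kap T : R, [/\ 0 < kap, 0 < T &
    forall t, T <= t -> lambda <= u t (kap * t `^ (1 / (2 * s)))].
Proof.
move=> /andP[l0 l1]; have /andP[th0 th1] := cd_theta cd.
pose a := (1 + Num.max lambda theta) / 2.
have mx1 : Num.max lambda theta < 1 by rewrite gt_max l1 th1.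
have mxl : lambda <= Num.max lambda theta by rewrite le_max lexx.
have mxt : theta <= Num.max lambda theta by rewrite le_max lexx orbT.
have la : lambda <= a by rewrite /a; lra.
have aitv : theta < a < 1 by apply/andP; split; rewrite /a; lra.
have /andP[ta a1] := aitv; have a0 : 0 < a by exact: lt_trans ta.
have [m [b [eps [L0 [ma b0 eps0 L00 step]]]]] := lower_front cd aitv.
have /andP[s0 s12] := cd_s cd.
have ss0 : 0 < 2 * s by rewrite mulr_gt0.
(* the profile vanishes beyond [B * L] *)
pose B := expR (m / b); have B0 : 0 < B by exact: expR_gt0.
have Be0 : 0 < (B + 1) / eps by rewrite divr_gt0// addr_gt0.
(* with this scale the total displacement after time [t] is [(B + 1) * L] *)
pose kap := ((B + 1) / eps) `^ (- (2 * s)^-1).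
have kap0 : 0 < kap by exact: powR_gt0.
have kapE : kap `^ (- (2 * s)) = (B + 1) / eps.
  by rewrite /kap -powRrM mulrNN mulVf ?gt_eqF// powRr1// ltW.
exists kap, (Num.max 1 ((L0 / kap) `^ (2 * s))); split => //.
move=> t; rewrite ge_max => /andP[t1 tT].
have t0 : 0 < t by exact: lt_le_trans t1.
set L := kap * _.
have LL0 : L0 <= L.
  rewrite /L mulrC -ler_pdivrMr//.
  have -> : L0 / kap = ((L0 / kap) `^ (2 * s)) `^ (1 / (2 * s)).
    by rewrite -powRrM div1r divff ?gt_eqF// powRr1// divr_ge0// ltW.
  by rewrite ge0_ler_powR ?nnegrE ?powR_ge0 ?(ltW t0)// divr_ge0// ltW.
have Lpos : 0 < L by exact: lt_le_trans LL0.
have qE : eps * (L * L `^ (- (2 * s))) * t = L * (B + 1).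
  rewrite {2}/L powRM ?powR_ge0 ?(ltW kap0)// kapE -powRrM mulrN div1r mulVf ?gt_eqF//.
  rewrite powR_inv1 ?(ltW t0)//; field; apply/andP; split; exact: lt0r_neq0.
pose n := Num.Def.trunc t; pose h := t / n%:R.
have n0 : (0 < n)%N by rewrite truncn_gt0.
have n0R : 0 < n%:R :> R by rewrite ltr0n.
have n1R : 1 <= n%:R :> R by rewrite ler1n.
have /andP[nt tn] := truncn_itv (ltW t0).
have h12 : 1 <= h <= 2.
  rewrite /h ler_pdivlMr// mul1r nt/= ler_pdivrMr//.
  rewrite (le_trans (ltW tn))// -/n -natr1; lra.
have nh : n%:R * h = t by rewrite mulrC divfK// gt_eqF.
have h0 : 0 <= h by have /andP[h1 _] := h12; exact: le_trans h1.
set w := log_profile a m b L.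
set v := eps * _ in qE.
have iter k y : w (y - (- (L * B) + k%:R * h * v)) <= u (k%:R * h) y.
  elim: k y => [|k IH] y.
    rewrite !mul0r addr0 opprK (solution_initial _ cd); case: ifPn => [_|].
      by have /andP[_ /le_trans] := log_profile_itv m b L a0 (y + L * B); apply; exact: ltW.
    rewrite -ltNge => y0; rewrite /w log_profile0//.
    by rewrite lerDr ltW.
  have kh0 : 0 <= k%:R * h by rewrite mulr_ge0.
  have := step L h (k%:R * h) _ LL0 h12 kh0 IH y.
  rewrite -/v -natr1 mulrDl mul1r.
  by rewrite (_ : _ + _ + h * v = - (L * B) + (k%:R * h + h) * v)//; ring.
have := iter n L; rewrite nh.
rewrite (_ : L - _ = 0); last by rewrite (mulrC t) qE; ring.
by rewrite /w log_profile_le0//; exact: le_trans.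
Qed.

End lower_bound.

(** * The algebraic profile of the supersolution *)

Lemma one_powR (R : realType) (r : R) : 1 `^ r = 1 :> R.
Proof. by rewrite powR1. Qed.

(** With [A] the right-hand side, this is the sum of the inequalities [ln r <= r - 1]
    at [x / A] and at [1 / A], with weights [al] and [1 - al]. *)
Lemma powR_le_affine (R : realType) (al x : R) : 0 <= al <= 1 -> 0 < x ->
  x `^ al <= 1 + al * (x - 1).
Proof.
move=> /andP[al0 al1] x0.
have A0 : 0 < 1 + al * (x - 1).
  move: al0; rewrite le_eqVlt => /predU1P[<-|al0]; first by rewrite mul0r addr0.
  have := mulr_gt0 al0 x0; lra.
set A := 1 + _ in A0 *.
have xA : x / A > 0 by exact: divr_gt0.
have h1 := ler_wpM2l al0 (ln_le_subr1 xA).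
have h2 : (1 - al) * ln A^-1 <= (1 - al) * (A^-1 - 1).
  by rewrite ler_wpM2l ?subr_ge0// ln_le_subr1// invr_gt0.
have E : al * (x / A - 1) + (1 - al) * (A^-1 - 1) = 0.
  by rewrite /A; field; exact: lt0r_neq0.
rewrite -ler_ln ?posrE ?powR_gt0// ln_powR.
move: h1 h2; rewrite ln_div ?posrE// lnV ?posrE//; lra.
Qed.

(** A plateau of height one up to [l], then an algebraic decay. Its exponent [al] is
    small: the slower the decay, the more a translation gains far ahead of the
    plateau, and the excess in the exponent of the front is of order [al]. *)
Definition power_profile (R : realType) (al l y : R) : R :=
  if y <= l then 1 else (y / l) `^ (- al).

Section power_profile_facts.
Context {R : realType} (al l : R).
Context (al01 : 0 < al <= 1) (l0 : 0 < l).

Local Notation w := (power_profile al l).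

Lemma power_profile_tail (y : R) : l <= y -> w y = (y / l) `^ (- al).
Proof.
rewrite le_eqVlt /power_profile => /predU1P[<-|ly]; last by rewrite leNgt ly.
by rewrite lexx divff ?gt_eqF// powR1.
Qed.

Lemma power_profile_gt0 (y : R) : 0 < w y.
Proof.
rewrite /power_profile; case: ifPn => //; rewrite -ltNge => ly.
by rewrite powR_gt0// divr_gt0// (lt_trans l0).
Qed.

Lemma power_profile_noninc (x y : R) : x <= y -> w y <= w x.
Proof.
have /andP[al0 _] := al01.
have le1 z : l <= z -> (z / l) `^ (- al) <= 1.
  move=> lz; rewrite powRN invf_le1 ?powR_gt0 ?divr_gt0 ?(lt_le_trans l0)//.
  rewrite -[leLHS](one_powR al) ge0_ler_powR ?nnegrE ?(ltW al0)//.
    by rewrite divr_ge0 ?(ltW l0)// (le_trans (ltW l0)).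
  by rewrite ler_pdivlMr// mul1r.
move=> xy; rewrite /power_profile; case: (leP x l) => lx; case: (leP y l) => ly //.
- by apply: le1; exact: ltW.
- by move: (lt_le_trans lx xy); rewrite ltNge ly.
have x0 : 0 < x by exact: lt_trans lx.
have y0 : 0 < y by exact: lt_trans ly.
rewrite !powRN lef_pV2 ?posrE ?powR_gt0 ?divr_gt0//.
rewrite ge0_ler_powR ?nnegrE ?divr_ge0 ?(ltW l0) ?(ltW x0) ?(ltW y0) ?(ltW al0)//.
by rewrite ler_wpM2r// invr_ge0 ltW.
Qed.

Lemma power_profile_le1 (y : R) : w y <= 1.
Proof.
have [yl|ly] := leP y l; first by rewrite /power_profile yl.
by rewrite (le_trans (power_profile_noninc (ltW ly)))// /power_profile lexx.
Qed.

Lemma power_profile_itv (y : R) : 0 <= w y <= 1.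
Proof. by rewrite (ltW (power_profile_gt0 y)) power_profile_le1. Qed.

Lemma measurable_power_profile : measurable_fun setT w.
Proof. by apply: nonincreasing_measurable => // x y xy; exact: power_profile_noninc. Qed.

Lemma power_profile_ratio (x y : R) : l <= x -> l <= y -> w y = w x * (x / y) `^ al.
Proof.
move=> lx ly; have x0 : 0 < x by exact: lt_le_trans lx.
have y0 : 0 < y by exact: lt_le_trans ly.
have xl0 : 0 <= x / l by apply: divr_ge0; exact: ltW.
have yl0 : 0 <= y / l by apply: divr_ge0; exact: ltW.
have xy0 : 0 <= x / y by apply: divr_ge0; exact: ltW.
rewrite !power_profile_tail// -mulN1r !powRrM !powR_inv1// -powRM ?invr_ge0//.
by congr (_ `^ _); field; rewrite !gt_eqF.
Qed.

Lemma power_profile_gain (x y : R) : l <= x -> x <= y ->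
  w x * (al * ((y - x) / y)) <= w x - w y.
Proof.
move=> lx xy; have x0 : 0 < x by exact: lt_le_trans lx.
have y0 : 0 < y by exact: lt_le_trans xy.
rewrite (power_profile_ratio lx (le_trans lx xy)) -{2}[w x]mulr1 -mulrBr.
rewrite ler_pM2l ?power_profile_gt0//.
have al01' : 0 <= al <= 1 by have /andP[/ltW-> ->] := al01.
have := powR_le_affine al01' (divr_gt0 x0 y0).
rewrite mulrBl divff ?gt_eqF//; lra.
Qed.

(** The decay is slow enough for a jump of length [z] from [y] to increase the
    profile by at most [z / y]. *)
Lemma power_profile_jump (y z : R) : l <= y -> w (y - z) - w y <= trunc y z.
Proof.
have /andP[al0 al1] := al01.
move=> ly; have y0 : 0 < y by exact: lt_le_trans ly.
rewrite /trunc le_min; apply/andP; split.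
  by have := power_profile_le1 (y - z); have := power_profile_gt0 y; lra.
have [z0|z0] := leP z 0.
  rewrite (@le_trans _ _ 0) ?divr_ge0 ?(ltW y0)// subr_le0.
  by apply: power_profile_noninc; rewrite lerDl oppr_ge0.
have [yz|zy] := leP y z.
  rewrite (@le_trans _ _ 1)//; last by rewrite ler_pdivlMr// mul1r gtr0_norm.
  by have := power_profile_le1 (y - z); have := power_profile_gt0 y; lra.
rewrite gtr0_norm//.
pose p := Num.max (y - z) l.
have lp : l <= p by rewrite le_max lexx orbT.
have p0 : 0 < p by exact: lt_le_trans lp.
have py : p <= y by rewrite ge_max ly andbT gerBl ltW.
have -> : w (y - z) = w p.
  rewrite /p; case: (leP (y - z) l) => // h.
  by rewrite /power_profile h lexx.
rewrite (power_profile_ratio lp ly) -{1}[w p]mulr1 -mulrBr.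
have r1 : p / y <= 1 by rewrite ler_pdivrMr// mul1r.
have r0 : 0 < p / y by exact: divr_gt0.
have h1 : p / y <= (p / y) `^ al.
  by rewrite -{1}[p / y]powRr1 ?(ltW r0)//; apply: ger_powR => //; rewrite ?r0.
have h2 : (y - z) / y <= p / y by rewrite ler_wpM2r ?invr_ge0 ?(ltW y0)// le_max lexx.
have h3 : (p / y) `^ al <= 1.
  by rewrite -[leRHS](one_powR al) ge0_ler_powR ?nnegrE ?(ltW al0) ?(ltW r0).
apply: (@le_trans _ _ (1 * (1 - (p / y) `^ al))).
  by rewrite ler_wpM2r ?subr_ge0// power_profile_le1.
by move: h2; rewrite mulrBl divff ?gt_eqF//; lra.
Qed.

End power_profile_facts.

(** * The upper bound *)

Lemma semigroup_power_profile_le (R : realType) (s : R)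
    (mu : R -> probability (measurableTypeR R) R) (C al l t y : R) :
  (forall t r : R, 0 <= t <= 2 -> 0 < r -> \int[mu t]_z trunc r z <= C * r `^ (- (2 * s))) ->
  0 < al <= 1 -> 0 < l -> l <= y -> 0 <= t <= 2 ->
  semigroup mu t (power_profile al l) y <= power_profile al l y + C * y `^ (- (2 * s)).
Proof.
move=> hC al01 l0 ly t02; have y0 : 0 < y by exact: lt_le_trans ly.
have bw : bounded_measurable (power_profile al l).
  apply: bounded_measurable01; first exact: measurable_power_profile.
  by move=> z; exact: power_profile_itv.
have bl := bounded_measurable_reflect y bw.
have bt : bounded_measurable (trunc (R := R) y).
  apply: bounded_measurable01; first exact: measurable_trunc.
  by move=> z; rewrite trunc_ge0 ?trunc_le1// ltW.
have bc := bounded_measurable_cst (power_profile al l y).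
rewrite -lerBlDl (le_trans _ (hC t y t02 y0))//.
rewrite (_ : _ - _ = \int[mu t]_z (power_profile al l (y - z) - power_profile al l y)).
  apply: le_Rintegral => //.
  - exact: bounded_measurable_integrable (bounded_measurableB bl bc).
  - exact: bounded_measurable_integrable.
  - by move=> z _; exact: power_profile_jump.
rewrite RintegralB//; [|exact: bounded_measurable_integrable..].
by rewrite Rintegral_cst//= probability_setT/= mulr1.
Qed.

Lemma half_powR_ge (R : realType) (r : R) : 0 <= r <= 1 -> 2^-1 <= (2^-1 : R) `^ r.
Proof.
move=> /andP[r0 r1]; have h0 : 0 < 2^-1 :> R by rewrite invr_gt0.
rewrite -{1}[2^-1 : R]powRr1 ?(ltW h0)//; apply: ger_powR => //.
by rewrite h0/=; lra.
Qed.

(** The supersolution at a given time; the cut at one costs nothing, the solution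
    being at most one. *)
Definition raised_profile (R : realType) (al l X E x : R) : R :=
  Num.min 1 (power_profile al l (x - X) + E).

Section upper_front.
Context {R : realType} {s theta : R} {J f : R -> R}
  {mu : R -> probability (measurableTypeR R) R} {u : R -> R -> R}.
Context (cd : cauchy_data s theta J f mu u).
Context (C K vt al h l v N : R).
Context (C0 : 0 < C)
  (hC : forall t r : R, 0 <= t <= 2 -> 0 < r -> \int[mu t]_z trunc r z <= C * r `^ (- (2 * s)))
  (K0 : 0 < K)
  (fK : forall v v' : R, 0 <= v <= 1 -> 0 <= v' <= 1 -> `|f v - f v'| <= K * `|v - v'|).
Context (vt0 : 0 < vt) (vtheta : 2 * vt <= theta) (al01 : 0 < al <= 1)
  (h01 : 0 <= h <= 1) (hK : h * K <= al * vt / 12) (l0 : 0 < l)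
  (lC : C * l `^ (- (2 * s)) <= al * vt / 12) (N0 : 0 < N)
  (vE : v = l * vt `^ (- al^-1))
  (NC : C * N `^ (1 + al - 2 * s) <= al / 3 * (v * l `^ al)).

Local Notation w := (power_profile al l).
Local Notation W := (raised_profile al l).

Lemma raised_profile_itv (X E x : R) : 0 <= E -> 0 <= W X E x <= 1.
Proof.
move=> E0; rewrite /raised_profile le_min ge_min lexx ler01/= andbT.
by rewrite addr_ge0// ltW// power_profile_gt0.
Qed.

Lemma bounded_raised_profile (X E : R) : 0 <= E -> bounded_measurable (W X E).
Proof.
move=> E0; apply: bounded_measurable01; last by move=> x; exact: raised_profile_itv.
apply: measurable_minr => //; apply: measurable_funD => //.
by apply: (measurableT_comp (measurable_power_profile al01 l0)); exact: measurable_funB.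
Qed.

Lemma threshold_lt1 : vt < 1.
Proof.
by have /andP[_ t1] := cd_theta cd; move: vt0 vtheta t1; lra.
Qed.

Lemma threshold_ge : l <= v.
Proof.
have /andP[al0 _] := al01.
rewrite vE ler_peMr ?(ltW l0)// -(one_powR (- al^-1)) !powRN lef_pV2 ?posrE ?powR_gt0//.
by rewrite ge0_ler_powR ?nnegrE ?(ltW vt0) ?invr_ge0 ?(ltW al0) ?(ltW threshold_lt1).
Qed.

Lemma threshold_gt0 : 0 < v. Proof. exact: lt_le_trans threshold_ge. Qed.

Lemma power_profile_threshold : w v = vt.
Proof.
have /andP[al0 _] := al01.
rewrite power_profile_tail ?threshold_ge// vE mulrAC divff ?gt_eqF// mul1r.
by rewrite -powRrM mulrNN mulVf ?gt_eqF// powRr1// ltW.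
Qed.

(** The reaction vanishes below [2 * vt], hence further than [v] ahead of the front, so
    that a point further than [2 * v] only sees it after a jump longer than half its
    distance to the front. *)
Lemma far_source_le (X E x sig : R) : 0 <= E -> E <= vt -> 0 <= sig <= 2 ->
  2 * v <= x - X ->
  semigroup mu sig (fun z => K * Num.max 0 (W X E z - 2 * vt)) x <=
    K * (C * ((x - X) / 2) `^ (- (2 * s))).
Proof.
move=> E0 Evt sig02 vy; have v0 := threshold_gt0.
have y0 : 0 < (x - X) / 2 by rewrite divr_gt0//; lra.
have bt : bounded_measurable (trunc (R := R) ((x - X) / 2)).
  apply: bounded_measurable01; first exact: measurable_trunc.
  by move=> z; rewrite trunc_ge0 ?trunc_le1// ltW.
have it := bounded_measurable_integrable (mu sig) bt.
apply: (@le_trans _ _ (K * \int[mu sig]_z trunc ((x - X) / 2) z)); last first.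
  by rewrite ler_wpM2l ?(ltW K0)// hC.
rewrite -RintegralZl//; apply: le_Rintegral => //.
- apply: bounded_measurable_integrable; apply: bounded_measurableZ.
  have [mW _] := bounded_measurable_reflect x (bounded_raised_profile X E0).
  apply: bounded_measurable01.
    by apply: measurable_maxr => //; exact: measurable_funB.
  move=> z; rewrite le_max lexx/= ge_max ler01/=.
  by have := raised_profile_itv X (x - z) E0; have := vt0; lra.
- exact: bounded_measurable_integrable (bounded_measurableZ K bt).
move=> z _; rewrite ler_wpM2l ?(ltW K0)//.
have [yz|zy] := leP ((x - X) / 2) `|z|.
  have -> : trunc ((x - X) / 2) z = 1 by rewrite /trunc min_l// ler_pdivlMr// mul1r.
  rewrite ge_max ler01/=.
  by have := raised_profile_itv X (x - z) E0; have := vt0; lra.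
have T0 : 0 <= trunc ((x - X) / 2) z by rewrite trunc_ge0// ltW.
rewrite ge_max T0/= (le_trans _ T0)// subr_le0.
rewrite /raised_profile ge_min; apply/orP; right.
have : w (x - z - X) <= vt.
  rewrite -power_profile_threshold; apply: power_profile_noninc => //.
  by move: zy; rewrite ltr_norml => /andP[_ zy]; lra.
lra.
Qed.

(** One time step: the supersolution advances by [v] and is raised by a small
    amount. Just ahead of the front the translation of the profile pays for the
    reaction; further ahead it pays for the far jumps, up to the distance [N],
    beyond which the raise does. *)
Lemma upper_front (t X E : R) : 0 <= t -> 0 <= E -> E + 2 * C * N `^ (- (2 * s)) <= vt ->
  (forall y, u t y <= W X E y) ->
  forall y, u (t + h) y <= W (X + v) (E + 2 * C * N `^ (- (2 * s))) y.
Proof.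
move=> t0 E0; set eps := 2 * C * _ => Evt uW y.
have /andP[s0 s12] := cd_s cd; have /andP[al0 al1] := al01; have /andP[h0 h1] := h01.
have eps0 : 0 < eps by rewrite mulr_gt0 ?powR_gt0// mulr_gt0.
have Ee0 : 0 <= E + eps by rewrite addr_ge0// ltW.
have v0 := threshold_gt0; have lv := threshold_ge; have vt1 := threshold_lt1.
have alvt : al * vt <= 1 by rewrite mulr_ile1// ltW.
pose q := 2 * s.
pose c (x : R) := if x - (X + v) < 2 * v then K else K * (C * ((x - (X + v)) / 2) `^ (- q)).
have sigle sig : 0 <= sig <= h -> 0 <= sig <= 2 by move=> /andP[? ?]; apply/andP; split; lra.
have half x : 0 < x -> (x / 2) `^ (- q) <= 2 * x `^ (- q).
  move=> x0; rewrite powRM ?(ltW x0)// mulrC ler_wpM2r ?powR_ge0//.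
  rewrite powRN -[leRHS]invrK lef_pV2 ?posrE ?powR_gt0 ?invr_gt0//.
  by rewrite half_powR_ge// /q; apply/andP; split; lra.
have th2 : 0 <= 2 * vt <= theta by rewrite vtheta andbT mulr_ge0// ltW.
have hK2 : h * K <= 1 / 2.
  by apply: (le_trans hK); move: alvt; move: (al * vt) => p; lra.
have hh : 0 <= h <= h by rewrite h0 lexx.
apply: (@upper_step _ _ _ _ _ _ _ cd K (2 * vt) h (W X E) (W (X + v) (E + eps)) c t
  (ltW K0) fK th2 h0 hK2 (bounded_raised_profile X E0) (bounded_raised_profile (X + v) Ee0)) => //.
- by move=> x; have /andP[] := raised_profile_itv (X + v) x Ee0.
- by move=> x; rewrite /c; case: ifP => _; rewrite ?(ltW K0)// mulr_ge0 ?(ltW K0)// mulr_ge0 ?powR_ge0// ltW.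
- move=> x sig sigh W1; rewrite /c; case: (ltP (x - (X + v)) (2 * v)) => xv; last first.
    by apply: far_source_le => //; exact: sigle.
  have bW := bounded_raised_profile (X + v) Ee0.
  have b01 z : 0 <= K * Num.max 0 (W (X + v) (E + eps) z - 2 * vt) <= K.
    rewrite mulr_ge0 ?(ltW K0) ?le_max ?lexx//= ler_piMr ?(ltW K0)// ge_max ler01/=.
    by have := raised_profile_itv (X + v) z Ee0; have := vt0; lra.
  have [mW _] := bW.
  have bb : bounded_measurable (fun z => K * Num.max 0 (W (X + v) (E + eps) z - 2 * vt)).
    split.
      by apply: measurable_funM => //; apply: measurable_maxr => //; exact: measurable_funB.
    by exists K => z; have /andP[h2 h3] := b01 z; rewrite ger0_norm.
  by have /andP[] := semigroup_itv mu sig x bb b01.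
move=> x sig sigh W1; have {}sigh := sigle _ sigh.
pose y1 := x - (X + v); pose y2 := x - X.
have y12 : y2 = y1 + v by rewrite /y1 /y2; ring.
have [WE wlt] : W (X + v) (E + eps) x = w y1 + (E + eps) /\ w y1 < 1.
  move: W1; rewrite /raised_profile -/y1; have [//|h3 _] := leP 1 (w y1 + (E + eps)).
    by rewrite ltxx.
  split=> [//|].
  by move: h3 E0 eps0; move: (w y1) (E) (eps) => p1 p2 p3; lra.
have ly1 : l <= y1.
  by rewrite leNgt; apply/negP => /ltW yl; move: wlt; rewrite /power_profile yl ltxx.
have y10 : 0 < y1 by exact: lt_le_trans ly1.
have y1y2 : y1 <= y2 by rewrite y12 lerDl ltW.
have y20 : 0 < y2 by exact: lt_le_trans y1y2.
have P1 : semigroup mu sig (W X E) x <= w y2 + C * y2 `^ (- q) + E.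
  apply: (@le_trans _ _ (semigroup mu sig (fun z => w (z - X) + E) x)).
    apply: semigroup_le; first exact: bounded_raised_profile.
      apply: bounded_measurableD; last exact: bounded_measurable_cst.
      apply: bounded_measurable01; last by move=> z; exact: power_profile_itv.
      by apply: (measurableT_comp (measurable_power_profile al01 l0)); exact: measurable_funB.
    by move=> z; rewrite /raised_profile ge_min lexx orbT.
  rewrite semigroupD; last exact: bounded_measurable_cst.
    rewrite semigroup_cst semigroup_shift lerD2r.
    by apply: semigroup_power_profile_le => //; exact: le_trans y1y2.
  apply: bounded_measurable01; last by move=> z; exact: power_profile_itv.
  by apply: (measurableT_comp (measurable_power_profile al01 l0)); exact: measurable_funB.
rewrite WE.
suff gain : C * y2 `^ (- q) + h * c x <= w y1 - w y2 + eps by move: P1 gain; lra.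
have pow_le p r : 0 < p -> p <= r -> r `^ (- q) <= p `^ (- q).
  move=> p0 pr; have r0 : 0 < r by exact: lt_le_trans pr.
  rewrite !powRN lef_pV2 ?posrE ?powR_gt0// ge0_ler_powR ?nnegrE ?(ltW p0) ?(ltW r0)//.
  by rewrite /q mulr_ge0// ltW.
have wgain := power_profile_gain al01 l0 ly1 y1y2.
have vy : (y2 - y1) / y2 = v / y2 by rewrite y12 addrAC subrr add0r.
rewrite vy in wgain.
rewrite /c -/y1; case: (ltP y1 (2 * v)) => y1v.
  have c1 : C * y2 `^ (- q) <= al * vt / 12.
    apply: le_trans lC; rewrite ler_wpM2l ?(ltW C0)// pow_le//; exact: le_trans y1y2.
  have v3 : 1 / 3 <= v / y2 by rewrite ler_pdivlMr// y12; lra.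
  have wy1 : vt / 2 <= w y1.
    rewrite (@le_trans _ _ (w (2 * v)))//; last by apply: power_profile_noninc => //; exact: ltW.
    have l2v : l <= 2 * v by lra.
    rewrite (power_profile_ratio al l0 lv l2v).
    rewrite power_profile_threshold ler_wpM2l ?(ltW vt0)//.
    have -> : v / (2 * v) = 2^-1 by field; exact: lt0r_neq0.
    by rewrite half_powR_ge// (ltW al0).
  have : vt / 2 * (al * (1 / 3)) <= w y1 * (al * (v / y2)).
    apply: ler_pM => //; first by rewrite divr_ge0// ltW.
      by rewrite mulr_ge0 ?divr_ge0// ltW.
    by rewrite ler_wpM2l// ltW.
  move: wgain; move: (w y1 * _) => g; move: c1 hK eps0; lra.
have loss : C * y2 `^ (- q) + h * (K * (C * (y1 / 2) `^ (- q))) <= 2 * C * y1 `^ (- q).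
  have e1 : C * y2 `^ (- q) <= C * y1 `^ (- q) by rewrite ler_wpM2l ?(ltW C0)// pow_le.
  have e2 : C * (y1 / 2) `^ (- q) <= C * (2 * y1 `^ (- q)) by rewrite ler_wpM2l ?(ltW C0)// half.
  have p0 : 0 <= C * (y1 / 2) `^ (- q) by rewrite mulr_ge0 ?powR_ge0// ltW.
  have e3 : h * K * (C * (y1 / 2) `^ (- q)) <= 1 / 2 * (C * (y1 / 2) `^ (- q)) by rewrite ler_wpM2r.
  lra.
apply: (le_trans loss).
have [Ny|yN] := leP N y1.
  have : 2 * C * y1 `^ (- q) <= eps by rewrite ler_wpM2l ?mulr_ge0 ?(ltW C0)// pow_le.
  have : w y2 <= w y1 by exact: power_profile_noninc.
  lra.
have ex0 : 0 <= 1 + al - q by rewrite /q; lra.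
have yC : C * y1 `^ (1 + al - q) <= al / 3 * (v * l `^ al).
  apply: le_trans NC; rewrite ler_wpM2l ?(ltW C0)// ge0_ler_powR ?nnegrE ?(ltW y10) ?(ltW N0)//.
  exact: ltW.
have wyE : w y1 * y1 `^ al = l `^ al.
  rewrite power_profile_tail// -powR_inv1 ?(ltW l0)// powRM ?(ltW y10) ?powR_ge0//.
  rewrite -powRrM mulrNN mul1r mulrAC -powRD ?addNr ?powRr0 ?mul1r//.
  by rewrite (gt_eqF y10) implybT.
have yE : y1 `^ (1 + al - q) = y1 * (y1 `^ al * y1 `^ (- q)).
  have nz r : (r == 0) ==> (y1 != 0) by rewrite (gt_eqF y10) implybT.
  by rewrite powRD ?nz// powRD ?nz// powRr1 ?(ltW y10)// mulrA.
have fin : C * y1 `^ (- q) <= al / 3 * (v * w y1) / y1.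
  have pal : 0 < y1 `^ al by exact: powR_gt0.
  rewrite ler_pdivlMr// -(ler_pM2r pal).
  by move: yC; rewrite yE -wyE; congr (_ <= _); ring.
have v23 : v * (2 / 3) / y1 <= v / y2.
  rewrite ler_pdivrMr// mulrAC ler_pdivlMr// -!mulrA ler_wpM2l ?(ltW v0)// y12; lra.
have : w y1 * (al * (v * (2 / 3) / y1)) <= w y1 * (al * (v / y2)).
  by rewrite ler_wpM2l ?(ltW (power_profile_gt0 _ l0 _))// ler_wpM2l// ltW.
have -> : w y1 * (al * (v * (2 / 3) / y1)) = 2 * (al / 3 * (v * w y1) / y1) by ring.
move: wgain fin eps0; move: (w y1 * (al * _)) (al / 3 * _ / y1) => g1 g2; lra.
Qed.

End upper_front.

(** Steps of bounded length, all with the same scale [l], chosen so that after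
    time [t] the front has moved by at most [N], a little more than
    [t^(1/(2s))], while the raises accumulate to at most [vt]. *)
Lemma solution_small_ahead (R : realType) (s theta : R) (J f : R -> R)
    (mu : R -> probability (measurableTypeR R) R) (u : R -> R -> R)
    (cd : cauchy_data s theta J f mu u) (lambda rho : R) : 0 < lambda -> 0 < rho ->
  exists B T : R, [/\ 0 < B, 0 < T &
    forall t x, T <= t -> B * t `^ (1 / (2 * s) + rho) <= x -> u t x < lambda].
Proof.
move=> lam0 rho0; have /andP[s0 s12] := cd_s cd; have th0 := theta_gt0 cd.
have [C C0 hC] := truncated_moment (cd_s cd) (cd_kernel cd) (cd_semigroup cd).
have [K K0 fK] := ignition_lipschitz (cd_ignition cd).
have q0 : 0 < 2 * s by rewrite mulr_gt0.
have q1 : 2 * s < 1 by lra.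
have [al [al01 alrho]] : exists al : R, 0 < al <= 1 /\ al <= 2 * s * rho.
  exists (Num.min 1 (2 * s * rho)).
  by rewrite lt_min ltr01 mulr_gt0//= !ge_min !lexx orbT.
have /andP[al0 al1] := al01.
have [vt [vt0 vtheta vtlam]] : exists vt : R, [/\ 0 < vt, 2 * vt <= theta & 2 * vt < lambda].
  exists (Num.min theta lambda / 4); have m0 : 0 < Num.min theta lambda by rewrite lt_min th0.
  have m1 : Num.min theta lambda <= theta by rewrite ge_min lexx.
  have m2 : Num.min theta lambda <= lambda by rewrite ge_min lexx orbT.
  by split; [exact: divr_gt0|lra|lra].
have alvt0 : 0 < al * vt by exact: mulr_gt0.
have [h0 [h00 h01 h0K]] : exists h0 : R, [/\ 0 < h0, h0 <= 1 & h0 * K <= al * vt / 12].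
  exists (Num.min 1 (al * vt / 12 / K)); split.
  - by rewrite lt_min ltr01/= divr_gt0// divr_gt0.
  - by rewrite ge_min lexx.
  - by rewrite -ler_pdivlMr// ge_min lexx orbT.
(* the front then moves by at most [N] in at most [2 * t / h0] steps *)
have [kap kap0 kapE] : exists2 kap : R, 0 < kap & kap * vt `^ (- al^-1) = h0 / 2.
  exists (h0 / 2 * vt `^ al^-1); first by rewrite mulr_gt0 ?powR_gt0// divr_gt0.
  by rewrite powRN mulfK// gt_eqF// powR_gt0.
(* with [N = B * t^((1 + al) / (2s))] and [B^(2s) = D], the condition of
   [upper_front] relating [N] and the scale becomes an equality *)
have [D D0 DE] : exists2 D : R, 0 < D & D * (al * kap `^ (1 + al)) = 3 * C.
  exists (3 * C / (al * kap `^ (1 + al))); last by rewrite divfK// gt_eqF// mulr_gt0// powR_gt0.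
  by rewrite divr_gt0 ?mulr_gt0// powR_gt0.
have [B B0 BE] : exists2 B : R, 0 < B & B `^ (2 * s) = D.
  exists (D `^ (2 * s)^-1); first exact: powR_gt0.
  by rewrite -powRrM mulVf ?gt_eqF// powRr1// ltW.
pose gam := (1 + al) / (2 * s) - 1.
have gam0 : 0 < gam by rewrite subr_gt0 ltr_pdivlMr// mul1r; lra.
have [L1 L10 hL1] : exists2 L1 : R, 0 < L1 &
    forall l, L1 <= l -> C * l `^ (- (2 * s)) <= al * vt / 12.
  have k0 : 0 < al * vt / 12 / C by rewrite divr_gt0// divr_gt0.
  have [L1 L10 hL1] := powRN_small q0 k0.
  by exists L1 => // l /hL1; rewrite ler_pdivlMr// mulrC.
have [T1 T10 hT1] := powRN_small gam0 (divr_gt0 (mulr_gt0 kap0 B0) L10).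
have k2 : 0 < vt * h0 * D / (4 * C) by rewrite divr_gt0 ?mulr_gt0.
have [T2 T20 hT2] := powRN_small al0 k2.
exists (2 * B), (Num.max 1 (Num.max T1 T2)).
split; [exact: mulr_gt0|by rewrite lt_max ltr01|].
move=> t x; rewrite !ge_max => /and3P[t1 tT1 tT2] xt.
have t0 : 0 < t by exact: lt_le_trans t1.
pose N := B * t `^ ((1 + al) / (2 * s)).
have N0 : 0 < N by rewrite mulr_gt0// powR_gt0.
have NE : N `^ (- (2 * s)) = D^-1 * (t `^ (1 + al))^-1.
  rewrite powRM ?powR_ge0 ?(ltW B0)// powRN BE -powRrM mulrN divfK ?gt_eqF//.
  by rewrite powRN.
pose l := kap * N / t.
have l0 : 0 < l by rewrite divr_gt0// mulr_gt0.
have lC : C * l `^ (- (2 * s)) <= al * vt / 12.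
  apply: hL1; have := hT1 t tT1; rewrite powRN ler_pdivlMr// mulrC -ler_pdivlMr ?invr_gt0 ?powR_gt0//.
  rewrite invrK => /le_trans; apply.
  have -> : l = kap * B * (t `^ ((1 + al) / (2 * s)) / t) by rewrite /l /N; ring.
  by rewrite /gam powRD ?(gt_eqF t0) ?implybT// powR_inv1// ltW.
pose v := l * vt `^ (- al^-1).
have vE : v = h0 / 2 * N / t by rewrite /v -kapE /l; ring.
have lv : l <= v by exact: (threshold_ge cd vt0 vtheta al01 l0 erefl).
have v0 : 0 < v by exact: lt_le_trans lv.
have NC : C * N `^ (1 + al - 2 * s) <= al / 3 * (v * l `^ al).
  apply: (@le_trans _ _ (al / 3 * (l * l `^ al))); last first.
    by rewrite ler_wpM2l ?divr_ge0 ?(ltW al0)// ler_wpM2r ?powR_ge0.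
  have nzN r : (r == 0) ==> (N != 0) by rewrite (gt_eqF N0) implybT.
  have nzl r : (r == 0) ==> (l != 0) by rewrite (gt_eqF l0) implybT.
  have -> : l * l `^ al = l `^ (1 + al) by rewrite powRD ?nzl// powRr1// ltW.
  rewrite powRD ?nzN// NE /l powRM ?invr_ge0 ?(ltW t0)//; last by rewrite mulr_ge0// ltW.
  rewrite (powRM _ (ltW kap0) (ltW N0)) -[t^-1]powR_inv1 ?(ltW t0)// -powRrM mulN1r powRN.
  have -> : C = D * (al * kap `^ (1 + al)) / 3 by rewrite DE; field.
  have nD : D != 0 by rewrite gt_eqF.
  by rewrite le_eqVlt; apply/orP; left; apply/eqP; field; rewrite nD gt_eqF// powR_gt0.
pose n := (Num.Def.trunc (t / h0)).+1; pose h := t / n%:R.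
have n0 : 0 < n%:R :> R by rewrite ltr0n.
have /andP[nt tn] := truncn_itv (ltW (divr_gt0 t0 h00)).
have hh0 : h <= h0.
  by rewrite ler_pdivrMr// mulrC -ler_pdivrMr// ltW.
have hp : 0 < h by exact: divr_gt0.
have n2 : n%:R <= 2 * t / h0.
  have : 1 <= t / h0 by rewrite ler_pdivlMr// mul1r (le_trans h01).
  by move: nt; rewrite /n -natr1 -[2 * t / h0]mulrA; move: (t / h0) (_%:R) => p r; clear; lra.
have hK : h * K <= al * vt / 12 by rewrite (le_trans _ h0K)// ler_wpM2r// ltW.
have hitv : 0 <= h <= 1 by rewrite (ltW hp)/= (le_trans hh0).
pose eps := 2 * C * N `^ (- (2 * s)).
have eps0 : 0 < eps by rewrite mulr_gt0 ?powR_gt0// mulr_gt0.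
have neps : n%:R * eps <= vt.
  rewrite (le_trans (ler_wpM2r (ltW eps0) n2))// /eps NE.
  have tE : t * (t `^ (1 + al))^-1 = t `^ (- al).
    rewrite powRD ?(gt_eqF t0) ?implybT// powRr1 ?(ltW t0)// powRN; field.
    by rewrite !gt_eqF// powR_gt0.
  have -> : 2 * t / h0 * (2 * C * (D^-1 * (t `^ (1 + al))^-1)) =
      4 * C / (h0 * D) * (t * (t `^ (1 + al))^-1).
    by field; rewrite !gt_eqF// powR_gt0.
  rewrite tE; have := hT2 t tT2; move: (t `^ (- al)) => p hp1.
  rewrite (@le_trans _ _ (4 * C / (h0 * D) * (vt * h0 * D / (4 * C))))//.
    by rewrite ler_wpM2l// divr_ge0 ?mulr_ge0// ltW.
  by rewrite le_eqVlt; apply/orP; left; apply/eqP; field; rewrite !gt_eqF.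
have nv : n%:R * v <= N.
  rewrite (le_trans (ler_wpM2r (ltW v0) n2))// vE.
  by rewrite le_eqVlt; apply/orP; left; apply/eqP; field; rewrite !gt_eqF.
have iter k y : (k <= n)%N -> u (k%:R * h) y <= raised_profile al l (k%:R * v) (k%:R * eps) y.
  elim: k y => [|k IH] y kn.
    rewrite !mul0r (solution_initial _ cd) /raised_profile subr0 addr0 le_min.
    case: ifP => y0; last by rewrite ler01 ltW// power_profile_gt0.
    by rewrite /power_profile (le_trans y0 (ltW l0)) lexx.
  have kh0 : 0 <= k%:R * h by rewrite mulr_ge0// ltW.
  have ke0 : 0 <= k%:R * eps by rewrite mulr_ge0// ltW.
  have ke1 : k%:R * eps + eps <= vt.
    rewrite (le_trans _ neps)// -{2}[eps]mul1r -mulrDl natr1.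
    by rewrite ler_wpM2r ?(ltW eps0)// ler_nat.
  have := upper_front cd C0 hC K0 fK vt0 vtheta al01 hitv hK l0 lC N0 erefl NC kh0 ke0 ke1
    (fun y => IH y (ltnW kn)) y.
  by rewrite -/eps -/v -natr1 !mulrDl !mul1r.
have nh : n%:R * h = t by rewrite mulrC divfK// gt_eqF.
have := iter n x (leqnn n); rewrite nh => /le_lt_trans; apply.
rewrite /raised_profile gt_min; apply/orP; right.
have N2x : 2 * N <= x.
  apply: le_trans xt; rewrite /N mulrA ler_wpM2l ?mulr_ge0 ?(ltW B0)//.
  apply: ler_powR => //; rewrite mulrDl lerD2l ler_pdivrMr//.
  by rewrite mulrC.
have vx : v <= x - n%:R * v.
  have : 1 * v <= n%:R * v by rewrite ler_wpM2r ?(ltW v0)// ler1n.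
  by move: nv N2x; move: (n%:R * v) => p; clear; lra.
have := power_profile_noninc al01 l0 vx.
rewrite (power_profile_threshold cd vt0 vtheta al01 l0 erefl).
by move: neps vtlam; move: (n%:R * eps) => p; clear; lra.
Qed.

Theorem theorem1p3 (R : realType) (s theta : R) (J f : R -> R)
    (mu : R -> probability (measurableTypeR R) R) (u : R -> R -> R)
    (hs : 0 < s < 1 / 2)
    (hJ : kernel_hyp s J)
    (htheta : 0 < theta < 1)
    (hf : ignition theta f)
    (hmu : semigroup_measures J mu)
    (hu : mild_solution mu f (\1_(`]-oo, 0]) : R -> R) u)
    (hfront : forall t : R, 0 <= t -> front_profile (u t))
    (lambda : R) (hlambda : 0 < lambda < 1) :
  (exists C T : R, [/\ 0 < C, 0 < T &
     forall t : R, T <= t ->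
       C * t `^ (1 / (2 * s)) <= level_line u lambda t]) /\
  (forall rho : R, 0 < rho ->
     exists C T : R, [/\ 0 < C, 0 < T &
       forall t : R, T <= t ->
         level_line u lambda t <= C * t `^ (1 / (2 * s) + rho)]).
Proof.
have cd : cauchy_data s theta J f mu u by [].
have /andP[lam0 lam1] := hlambda.
split=> [|rho rho0].
  have [C [T [C0 T0 low]]] := solution_accelerates cd hlambda.
  exists C, T; split => // t Tt; apply: ub_le_sup; last exact: low.
  have [_ _ u0] := hfront t (le_trans (ltW T0) Tt).
  have [A [_ hA]] := cvgr_lt _ u0 _ lam0.
  exists (A + 1) => x /= lx; rewrite leNgt; apply/negP => Ax.
  have xA : A < x by apply: lt_trans Ax; rewrite ltrDl.
  by have := hA x xA; rewrite /= ltNge lx.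
have [C [T [C0 T0 up]]] := solution_small_ahead cd lam0 rho0.
exists C, T; split => // t Tt; apply: sup_le_ub; last first.
  move=> x /= lx; rewrite leNgt; apply/negP => /ltW /(up t x Tt).
  by rewrite ltNge lx.
have [_ u1 _] := hfront t (le_trans (ltW T0) Tt).
have [A [_ hA]] := cvgr_gt _ u1 _ lam1.
by exists (A - 1); apply/ltW/hA; rewrite ltrBlDr ltrDl.
Qed.
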